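(* Let $1\le p\le 2$, $\varsigma\in M^p(\mathbb{Z}^n\times\mathbb{T}^n)$ and $g_1,g_2\in M^1(\mathbb{Z}^n)$. Then the localization operator $\mathfrak{L}^{g_1,g_2}_\varsigma:\ell^2(\mathbb{Z}^n)\to\ell^2(\mathbb{Z}^n)$ is compact.
   Context: $\mathbb{T}^n$ is the torus with normalized Haar measure $dw$; $\mathbb{Z}^n\times\mathbb{T}^n$ carries the product of counting measure and $dw$. $T_mf(k)=f(k-m)$, $M_wf(k)=e^{2\pi i w\cdot k}f(k)$, and the short-time Fourier transform is $V_gf(m,w)=\langle f,M_wT_mg\rangle=\sum_{k\in\mathbb{Z}^n}f(k)\overline{g(k-m)}e^{-2\pi i w\cdot k}$. $\mathcal{S}(\mathbb{Z}^n)$ is the space of rapidly decreasing functions on $\mathbb{Z}^n$, $\mathcal{S}'(\mathbb{Z}^n)$ its dual (tempered distributions); $\mathcal{S}(\mathbb{Z}^n\times\mathbb{T}^n)$ and $\mathcal{S}'(\mathbb{Z}^n\times\mathbb{T}^n)$ are the Schwartz functions and tempered distributions on the group $\mathbb{Z}^n\times\mathbb{T}^n$. Modulation spaces: fix a non-zero window $g\in\mathcal{S}(\mathbb{Z}^n)$; for $1\le p\le\infty$, $M^p(\mathbb{Z}^n)=\{f\in\mathcal{S}'(\mathbb{Z}^n): V_gf\in L^p(\mathbb{Z}^n\times\mathbb{T}^n)\}$ with $\|f\|_{M^p(\mathbb{Z}^n)}=\|V_gf\|_{L^p}$. Similarly, fix a non-zero $g\in\mathcal{S}(\mathbb{Z}^n\times\mathbb{T}^n)$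 and set $$V_gF(m,\omega,\xi,k)=\sum_{j\in\mathbb{Z}^n}\int_{\mathbb{T}^n}e^{-2\pi i j\xi}e^{-2\pi i\eta k}F(j,\eta)\overline{g(j-m,\eta-\omega)}\,d\eta,\quad m,k\in\mathbb{Z}^n,\ \omega,\xi\in\mathbb{T}^n;$$ $M^p(\mathbb{Z}^n\times\mathbb{T}^n)$ is the space of $F\in\mathcal{S}'(\mathbb{Z}^n\times\mathbb{T}^n)$ with $\|F\|_{M^p(\mathbb{Z}^n\times\mathbb{T}^n)}=\|V_gF\|_{L^p((\mathbb{Z}^n\times\mathbb{T}^n)\times(\mathbb{T}^n\times\mathbb{Z}^n))}<\infty$. Different windows give equivalent norms. Localization operator: $\mathfrak{L}^{g_1,g_2}_\varsigma f(k)=\sum_{m\in\mathbb{Z}^n}\int_{\mathbb{T}^n}\varsigma(m,w)V_{g_1}f(m,w)\,M_wT_mg_2(k)\,dw$, or in the weak sense $$\langle\mathfrak{L}^{g_1,g_2}_\varsigma f,h\rangle_{\ell^2(\mathbb{Z}^n)}=\sum_{m\in\mathbb{Z}^n}\int_{\mathbb{T}^n}\varsigma(m,w)\,V_{g_1}f(m,w)\,\overline{V_{g_2}h(m,w)}\,dw,\qquad f,h\in\ell^2(\mathbb{Z}^n).$$ *)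

(* Defs.v *)
From HB Require Import structures.
From mathcomp Require Import all_boot all_order all_algebra.
From mathcomp Require Import complex.
From mathcomp Require Import all_classical all_reals all_analysis.
From mathcomp Require Import measurable_realfun.
From mathcomp Require finmap.

Set Implicit Arguments.
Unset Strict Implicit.
Unset Printing Implicit Defensive.

Import Order.TTheory GRing.Theory Num.Theory.
Import numFieldNormedType.Exports.

Local Open Scope classical_set_scope.
Local Open Scope ring_scope.

Notation normc := (@ComplexField.Normc.normc _).

HB.instance Definition _ := isPointed.Build int 0.
HB.instance Definition _ := @isMeasurable.Build default_measure_display
  int discrete_measurable discrete_measurable0
  discrete_measurableC discrete_measurableU.

Section measurable_row.
Context {d : measure_display} {T : measurableType d} (n : nat).

Let coord : 'I_n -> 'rV[T]_n -> T := fun i x => x ord0 i.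

Let row_set0 : g_sigma_preimage coord set0.
Proof. exact: sigma_algebra0. Qed.

Let row_setC A : g_sigma_preimage coord A -> g_sigma_preimage coord (~` A).
Proof. exact: sigma_algebraC. Qed.

Let row_bigcup (F : (set 'rV[T]_n)^nat) : (forall i, g_sigma_preimage coord (F i)) ->
  g_sigma_preimage coord (\bigcup_i (F i)).
Proof. exact: sigma_algebra_bigcup. Qed.

HB.instance Definition _ := @isMeasurable.Build (measure_tuple_display d)
  'rV[T]_n (g_sigma_preimage coord) row_set0 row_setC row_bigcup.

End measurable_row.

Lemma measurable_coord d (T : measurableType d) n (i : 'I_n) :
  measurable_fun [set: 'rV[T]_n] (fun x : 'rV[T]_n => x ord0 i).
Proof.
move=> _ Y mY; rewrite setTI; apply: sub_sigma_algebra => /=.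
rewrite -bigcup_seq/=; exists i => /=; first by rewrite mem_index_enum.
by exists Y => //; rewrite setTI.
Qed.

Lemma measurable_fun_row d1 d2 (T1 : measurableType d1) (T2 : measurableType d2)
    n (f : T1 -> 'rV[T2]_n) :
  (forall i, measurable_fun [set: T1] (fun x => f x ord0 i)) ->
  measurable_fun [set: T1] f.
Proof.
move=> mf.
have sub : g_sigma_preimage (fun (i : 'I_n) (x : 'rV[T2]_n) => x ord0 i)
    `<=` [set A | measurable (f @^-1` A)].
  apply: smallest_sub.
    split => /=.
    - by rewrite preimage_set0.
    - by move=> A mA; rewrite setTD preimage_setC; exact: measurableC.
    - by move=> F mF; rewrite preimage_bigcup; exact: bigcupT_measurable.
  move=> A; rewrite -bigcup_seq/= => -[i _ [B mB <-]] /=.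
  rewrite setTI -comp_preimage.
  by have := mf i measurableT B mB; rewrite setTI.
by move=> _ A mA; rewrite setTI; exact: sub.
Qed.

Lemma measurable_rV_int n (A : set 'rV[int]_n) : measurable A.
Proof.
have m1 (x : 'rV[int]_n) : measurable [set x].
  have -> : [set x] =
      \big[setI/setT]_(i < n) [set y : 'rV[int]_n | y ord0 i = x ord0 i].
    apply/seteqP; split=> [y -> |y].
      by rewrite -bigcap_seq => i _.
    by rewrite -bigcap_seq /= => yx; apply/rowP => i; apply: yx; rewrite /= mem_index_enum.
  apply: bigsetI_measurable => i _.
  rewrite -[X in measurable X]setTI.
  exact: (@measurable_coord _ _ n i measurableT [set x ord0 i]).
by apply: countable_measurable => //; exact: countableP.
Qed.

Lemma measurable_fun_rV_int n d (T : sigmaRingType d) (f : 'rV[int]_n -> T) :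
  measurable_fun [set: 'rV[int]_n] f.
Proof. by move=> _ Y _; exact: measurable_rV_int. Qed.

Lemma sigma_finite_counting_rV_int (R : realType) n :
  sigma_finite [set: 'rV[int]_n] (@counting _ R).
Proof.
exists (fun m => [set k | (pickle k <= m)%N]).
  by apply/seteqP; split=> // k _; exists (pickle k) => /=.
move=> m; split; first exact: measurable_rV_int.
rewrite /counting /= asboolT ?ltry//.
apply: (@sub_finite_set _ _ (pickle @^-1` `I_m.+1)) => //.
apply: finite_preimage; last exact: finite_II.
by move=> x y _ _ /(pcan_inj pickleK).
Qed.

HB.instance Definition _ (R : realType) n :=
  @Measure_isSigmaFinite.Build _ 'rV[int]_n R counting
    (sigma_finite_counting_rV_int R n).

Section torus.
Context {R : realType}.

Definition row_cons n (t : measurableTypeR R * 'rV[R]_n) : 'rV[R]_n.+1 :=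
  row_mx (const_mx t.1 : 'rV[R]_1) t.2.

Let measurable_row_cons n : measurable_fun setT (@row_cons n).
Proof.
apply: measurable_fun_row => i; under eq_fun do rewrite mxE.
case: (@fintype.split 1 n i) => j.
  by under eq_fun do rewrite mxE; exact: measurable_fst.
exact: (measurableT_comp (measurable_coord j)).
Qed.

HB.instance Definition _ n :=
  isMeasurableFun.Build _ _ _ _ (@row_cons n) (@measurable_row_cons n).

(* The n-fold product of the Lebesgue measure of [0, 1].  Functions on the torus
   T^n are encoded as 1-periodic functions on R^n; integrating one of them
   against this measure is integrating it against the normalized Haar measure. *)
Fixpoint haar n : probability 'rV[R]_n R :=
  if n isn't n'.+1 then dirac (0 : 'rV[R]_0)
  else distribution (uniform_prob (@ltr01 R) \x haar n')%E (@row_cons n').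

End torus.

Section complex_integral.
Context d (T : measurableType d) (R : realType).
Variable mu : {measure set T -> \bar R}.
Implicit Type f : T -> R[i].

Definition Cmeasurable f :=
  measurable_fun [set: T] (fun x => complex.Re (f x)) /\
  measurable_fun [set: T] (fun x => complex.Im (f x)).

Definition Cintegrable f :=
  mu.-integrable [set: T] (fun x => (complex.Re (f x))%:E) /\
  mu.-integrable [set: T] (fun x => (complex.Im (f x))%:E).

Definition Cintegral f : R[i] :=
  (\int[mu]_x complex.Re (f x) +i* \int[mu]_x complex.Im (f x))%C.

Definition CLnorm (p : \bar R) f : \bar R :=
  'N[mu]_p [EFin \o normc \o f].

Definition in_Lp (p : \bar R) f := Cmeasurable f /\ (CLnorm p f < +oo)%E.

End complex_integral.
Arguments Cintegral {d T R} mu f.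
Arguments CLnorm {d T R} mu p f.

Section ell2_norm.
Context {R : realType} {n : nat}.
Implicit Types f g : 'rV[int]_n -> R[i].

Local Notation N2 := (CLnorm (@counting 'rV[int]_n R) 2%:E).

Let mZ d (T : sigmaRingType d) (h : 'rV[int]_n -> T) :
  measurable_fun [set: 'rV[int]_n] h.
Proof. exact: measurable_fun_rV_int. Qed.

Let normcE (x : R[i]) : (normc x)%:C%C = `|x|.
Proof. by []. Qed.

Let normc_ge0 (x : R[i]) : 0 <= normc x.
Proof. by rewrite -lecR normcE normr_ge0. Qed.

Let normcD (x y : R[i]) : normc (x + y) <= normc x + normc y.
Proof. by rewrite -lecR rmorphD /= !normcE ler_normD. Qed.

Let N2E f : N2 f = ((\int[counting]_k ((normc (f k)) ^+ 2)%:E) `^ 2^-1)%E.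
Proof.
rewrite /CLnorm unlock; congr (_ `^ _)%E; apply: eq_integral => k _ /=.
by rewrite ger0_norm// powR_mulrn.
Qed.

Lemma CLnorm2D f g : (N2 (f + g)%R <= N2 f + N2 g)%E.
Proof.
apply: le_trans (minkowski_EFin counting (@mZ _ _ (normc \o f))
  (@mZ _ _ (normc \o g)) _); last by rewrite ler1n.
rewrite /CLnorm unlock; apply: gt0_ler_poweR.
- by rewrite invr_ge0.
- rewrite in_itv /= leey andbT; apply: integral_ge0 => k _.
  by rewrite ?poweR_ge0// lee_fin powR_ge0.
- by rewrite in_itv /= leey andbT; apply: integral_ge0 => k _.
apply: ge0_le_integral => //=; try exact: mZ.
move=> k _; rewrite lee_fin ge0_ler_powR ?nnegrE ?normr_ge0//.
rewrite (ger0_norm (normc_ge0 _)) (ger0_norm (addr_ge0 _ _))//.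
exact: normcD.
Qed.

Lemma CLnorm2Z a f : N2 (a *: f)%R = ((normc a)%:E * N2 f)%E.
Proof.
rewrite !N2E; under eq_integral do
  rewrite ComplexField.Normc.normcM exprMn EFinM.
have sq_ge0 (x : R[i]) : (0 <= (normc x ^+ 2)%:E)%E by rewrite lee_fin sqr_ge0.
rewrite ge0_integralZl//.
rewrite poweRM//; last exact: integral_ge0.
by rewrite poweR_EFin -powR_mulrn// -powRrM mulfV// powRr1.
Qed.

Lemma CLnorm2_eq0 f : N2 f = 0%E -> f = 0.
Proof.
move=> f0; apply/funext => k.
pose h k : \bar R := (normc (f k))%:E.
have mf : measurable_fun setT h by exact: mZ.
have two_gt0 : (0 < 2%:E :> \bar R)%E by rewrite lte_fin.
have [A [mA A0 sA]] := Lnorm_eq0_eq0 mf two_gt0 f0.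
have [->//|fk0] := eqVneq (f k) 0.
have Ak : A k.
  apply: sA => /= /(_ I)/eqP; rewrite eqe => /eqP.
  by move/ComplexField.Normc.eq0_normc/eqP; rewrite (negbTE fk0).
have : (@counting 'rV[int]_n R [set k] <= @counting 'rV[int]_n R A)%E.
  apply: (le_measure (@counting 'rV[int]_n R)); rewrite ?inE//.
    exact: measurable_rV_int.
  by move=> _ ->.
rewrite A0 /counting asboolT//= fset_set1 finmap.cardfs1.
by rewrite lee_fin ler10.
Qed.

Definition square_summable : pred ('rV[int]_n -> R[i]) :=
  fun f => `[< (N2 f < +oo)%E >].

Lemma square_summable_submod : submod_closed square_summable.
Proof.
split.
  apply/asboolP; rewrite -(scale0r (0 : 'rV[int]_n -> R[i])) CLnorm2Z.
  by rewrite ComplexField.Normc.normc0 mul0e.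
move=> a f g /asboolP hf /asboolP hg; apply/asboolP.
apply: le_lt_trans (CLnorm2D _ _) _; rewrite CLnorm2Z lte_add_pinfty//.
by rewrite lte_mul_pinfty ?lee_fin ?normc_ge0.
Qed.

HB.instance Definition _ := GRing.isSubmodClosed.Build _ _ square_summable
  square_summable_submod.

End ell2_norm.

Record ell2 (R : realType) (n : nat) := Ell2 {
  ell2_fun :> 'rV[int]_n -> R[i];
  ell2P : square_summable ell2_fun }.

HB.instance Definition _ R n := [isSub for @ell2_fun R n].
HB.instance Definition _ R n := [Choice of ell2 R n by <:].
HB.instance Definition _ R n := [SubChoice_isSubLmodule of ell2 R n by <:].

Section ell2_metric.
Context {R : realType} {n : nat}.
Implicit Types f g : ell2 R n.

Definition ell2_norm f : R := fine (CLnorm counting 2%:E f).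

Definition ell2_inner f g : R[i] := Cintegral counting (fun k => f k * ((g k)^*)%C).

Let ell2_normE f : (ell2_norm f)%:E = CLnorm counting 2%:E f.
Proof.
by rewrite fineK// ge0_fin_numE ?Lnorm_ge0//; exact/asboolP/(ell2P f).
Qed.

Lemma ell2_normD f g : ell2_norm (f + g) <= ell2_norm f + ell2_norm g.
Proof. by rewrite -lee_fin EFinD !ell2_normE; exact: CLnorm2D. Qed.

Lemma ell2_normZ a f : ell2_norm (a *: f) = normc a * ell2_norm f.
Proof. by apply: EFin_inj; rewrite EFinM !ell2_normE; exact: CLnorm2Z. Qed.

Lemma ell2_norm0_eq0 f : ell2_norm f = 0 -> f = 0.
Proof.
move=> f0; apply: val_inj; apply: CLnorm2_eq0.
by rewrite -ell2_normE f0.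
Qed.

Definition ell2_dist f g : R := ell2_norm (f - g).

Let ell2_distxx f : ell2_dist f f = 0.
Proof.
by rewrite /ell2_dist subrr -(scale0r (0 : ell2 R n)) ell2_normZ
  ComplexField.Normc.normc0 mul0r.
Qed.

Let ell2_dist_positivity f g : ell2_dist f g = 0 -> f = g.
Proof. by move=> /ell2_norm0_eq0/eqP; rewrite subr_eq0 => /eqP. Qed.

Let ell2_dist_sym f g : ell2_dist f g = ell2_dist g f.
Proof.
rewrite /ell2_dist -opprB -scaleN1r ell2_normZ.
by rewrite /= oppr0 sqrrN expr1n expr0n addr0 sqrtr1 mul1r.
Qed.

Let ell2_dist_triangle g f h : ell2_dist f h <= ell2_dist f g + ell2_dist g h.
Proof. by rewrite /ell2_dist -(subrKA g f (- h)) ell2_normD. Qed.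

HB.instance Definition _ := @isMetric.Build R (ell2 R n) ell2_dist
  ell2_distxx ell2_dist_positivity ell2_dist_sym ell2_dist_triangle.

End ell2_metric.

Section compact_operator.
Context {R : realType} {n : nat}.

Definition compact_operator (L : {linear ell2 R n -> ell2 R n}) :=
  precompact (L @` [set f | ell2_norm f <= 1]).

End compact_operator.

Section test_functions.
Context {R : realType} {n : nat}.

Definition weight (k : 'rV[int]_n) : R := 1 + \sum_i `|(k ord0 i)%:~R|.

Definition seminormZ (N : nat) (phi : 'rV[int]_n -> R[i]) : \bar R :=
  ereal_sup (range (fun k => (weight k ^+ N * normc (phi k))%:E)).

Definition schwartzZ : set ('rV[int]_n -> R[i]) :=
  [set phi | forall N, (seminormZ N phi < +oo)%E].

Definition partial (i : 'I_n) (f : 'rV[R]_n -> R[i]) : 'rV[R]_n -> R[i] :=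
  fun x => ('D_(delta_mx ord0 i) (fun y => complex.Re (f y)) x +i*
            'D_(delta_mx ord0 i) (fun y => complex.Im (f y)) x)%C.

Definition partials (s : seq 'I_n) (f : 'rV[R]_n -> R[i]) := foldr partial f s.

Definition smooth (f : 'rV[R]_n -> R[i]) := forall (s : seq 'I_n) x,
  differentiable (fun y => complex.Re (partials s f y)) x /\
  differentiable (fun y => complex.Im (partials s f y)) x.

Definition periodic (f : 'rV[R]_n -> R[i]) := forall x (l : 'rV[int]_n),
  f (x + map_mx intr l) = f x.

Definition seminormZT (N : nat) (phi : 'rV[int]_n * 'rV[R]_n -> R[i]) : \bar R :=
  ereal_sup [set r | exists j x (s : seq 'I_n), (size s <= N)%N /\
    r = (weight j ^+ N * normc (partials s (fun y => phi (j, y)) x))%:E].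

Definition schwartzZT : set ('rV[int]_n * 'rV[R]_n -> R[i]) :=
  [set phi | (forall j, periodic (fun y => phi (j, y))) /\
             (forall j, smooth (fun y => phi (j, y))) /\
             (forall N, (seminormZT N phi < +oo)%E)].

End test_functions.

(* Elements of the topological dual of the space S of test functions whose
   topology is given by the increasing sequence q of seminorms; the values of u
   outside S are irrelevant. *)
Definition tempered (R : realType) (X : Type) (S : set (X -> R[i]))
    (q : nat -> (X -> R[i]) -> \bar R) (u : (X -> R[i]) -> R[i]) :=
  (forall (a : R[i]) phi psi, S phi -> S psi -> u (a *: phi + psi) = a * u phi + u psi) /\
  (forall phi, S phi -> forall eps : R, 0 < eps ->
     exists N (delta : R), 0 < delta /\
       forall psi, S psi -> (q N (psi - phi)%R < delta%:E)%E ->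
         normc (u psi - u phi) < eps).

Lemma sigma_finite_product d1 d2 (T1 : measurableType d1)
    (T2 : measurableType d2) (R : realType)
    (m1 : {sigma_finite_measure set T1 -> \bar R})
    (m2 : {sigma_finite_measure set T2 -> \bar R}) :
  sigma_finite setT (m1 \x m2)%E.
Proof.
have /sigma_finiteP[F [TF ndF Foo]] := sigma_finiteT m1.
have /sigma_finiteP[G [TG ndG Goo]] := sigma_finiteT m2.
exists (fun n => F n `*` G n).
  rewrite -setXTT TF TG predeqE => -[x y]; split.
    move=> [/= [n _ Fnx] [k _ Gky]]; exists (maxn n k) => //; split.
    - by move: x Fnx; exact/subsetPset/ndF/leq_maxl.
    - by move: y Gky; exact/subsetPset/ndG/leq_maxr.
  by move=> [n _ []/= ? ?]; split; exists n.
move=> k; have [mF Fk] := Foo k; have [mG Gk] := Goo k.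
split; first exact: measurableX.
by rewrite product_measure1E// lte_mul_pinfty// ge0_fin_numE.
Qed.

Section phase_space_measures.
Context {R : realType} {n : nat}.

Definition muZT : set ('rV[int]_n * 'rV[R]_n) -> \bar R :=
  (counting \x haar n)%E.

Definition muTZ : set ('rV[R]_n * 'rV[int]_n) -> \bar R :=
  (haar n \x counting)%E.

HB.instance Definition _ := Measure.on muZT.
HB.instance Definition _ := Measure.on muTZ.

HB.instance Definition _ := @Measure_isSigmaFinite.Build _ _ R muZT
  (sigma_finite_product counting (haar n)).
HB.instance Definition _ := @Measure_isSigmaFinite.Build _ _ R muTZ
  (sigma_finite_product (haar n) counting).

End phase_space_measures.

Section time_frequency.
Context {R : realType} {n : nat}.
Local Notation Z := 'rV[int]_n.
Local Notation T := 'rV[R]_n.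

Definition dot (w : T) (k : Z) : R := \sum_i w ord0 i * (k ord0 i)%:~R.

Definition expi2pi (t : R) : R[i] :=
  (cos (2 * pi * t) +i* sin (2 * pi * t))%C.

Definition translation (m : Z) (f : Z -> R[i]) : Z -> R[i] :=
  fun k => f (k - m).

Definition modulation (w : T) (f : Z -> R[i]) : Z -> R[i] :=
  fun k => expi2pi (dot w k) * f k.

Definition stft (g f : Z -> R[i]) (m : Z) (w : T) : R[i] :=
  Cintegral counting (fun k => f k * ((modulation w (translation m g) k)^*)%C).

(* A distribution u is paired bilinearly with a test function, so that for the
   distribution given by a sequence f this is stft g f. *)
Definition stft_dist (g : Z -> R[i]) (u : (Z -> R[i]) -> R[i])
    (x : Z * T) : R[i] :=
  u (fun k => ((modulation x.2 (translation x.1 g) k)^*)%C).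

Definition stftZT_dist (g : Z * T -> R[i]) (F : (Z * T -> R[i]) -> R[i])
    (x : (Z * T) * (T * Z)) : R[i] :=
  let: ((m, w), (xi, k)) := x in
  F (fun y => expi2pi (- dot xi y.1) * expi2pi (- dot y.2 k) *
              ((g (y.1 - m, y.2 - w))^*)%C).

Definition modulation_spaceZ (g : Z -> R[i]) (p : R) : set ((Z -> R[i]) -> R[i]) :=
  [set u | tempered schwartzZ seminormZ u /\
           in_Lp muZT p%:E (stft_dist g u)].

Definition modulation_spaceZT (g : Z * T -> R[i]) (p : R) :
    set ((Z * T -> R[i]) -> R[i]) :=
  [set F | tempered schwartzZT seminormZT F /\
           in_Lp (muZT \x muTZ)%E p%:E (stftZT_dist g F)].

(* Z^n being discrete, a distribution on it is a sequence. *)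
Definition seq_of_dist (u : (Z -> R[i]) -> R[i]) : Z -> R[i] :=
  fun k => u (fun j => (j == k)%:R).

Definition represents (sigma : Z * T -> R[i]) (F : (Z * T -> R[i]) -> R[i]) :=
  forall phi, schwartzZT phi ->
    Cintegrable muZT (fun x => sigma x * phi x) /\
    F phi = Cintegral muZT (fun x => sigma x * phi x).

(* L is the bounded operator given by the weak formula.  The symbol F is a
   tempered distribution while the weak formula integrates a function sigma, so
   F has to be given by sigma; this is always possible for F in M^p, p <= 2. *)
Definition localization_operator (F : (Z * T -> R[i]) -> R[i])
    (g1 g2 : Z -> R[i]) (L : {linear ell2 R n -> ell2 R n}) :=
  continuous L /\
  exists sigma, represents sigma F /\
    forall f h : ell2 R n,
      let I x := sigma x * stft g1 f x.1 x.2 * ((stft g2 h x.1 x.2)^*)%C in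
      Cintegrable muZT I /\ ell2_inner (L f) h = Cintegral muZT I.

End time_frequency.

(* Main.v *)
Require Import Defs.
From HB Require Import structures.
From mathcomp Require Import all_boot all_order all_algebra.
From mathcomp Require Import complex.
From mathcomp Require Import all_classical all_reals all_analysis.
From mathcomp Require Import measurable_realfun.
From mathcomp Require Import ring lra zify.
Set Implicit Arguments.
Unset Strict Implicit.
Unset Printing Implicit Defensive.
Import Order.TTheory GRing.Theory Num.Theory.
Import numFieldNormedType.Exports.
Local Open Scope classical_set_scope.
Local Open Scope ring_scope.

(** Write c(j, k) for the value of the symbol on the test function equal to the
character chi_k on the level j of the lattice and to zero on the other levels.
The proof turns the hypotheses on the short-time Fourier transforms into
summability of coefficients, and then shows that the matrix of the localization
operator is Hilbert-Schmidt.

Coefficients.  For a fixed position m, the transform of a distribution u on the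
lattice is, as a function of the frequency, a trigonometric series whose
coefficients are the products of the values of u and of the shifted window.  A
coefficient is at most the mean modulus of its series; summing over m shows that
u is an absolutely summable sequence when its transform is integrable
(modulation_space_l1).  The same argument, applied once in each of the two
torus variables, bounds a multiple of |c(j, k)| by the mean of the modulus of the
transform of the symbol over the two tori.  The tori have total mass one, so the
p-th power of the mean is controlled by the mean of the p-th power, and c is
p-summable; as p <= 2, it is square summable (modulation_space_l2).

The operator.  The matrix of the operator in the canonical basis is
K(b, a) = sum_m conj(g1(a - m)) g2(b - m) c(m, b - a), for any function that
represents the symbol (weak_form_delta_le).  By Cauchy-Schwarz the sum of the
|K(b, a)|^2 is at most |g1|_1^2 |g2|_1^2 |c|_2^2 (hilbert_schmidt_kernel).  Hence
|(L f)(b)| <= r(b) |f| for a square summable r, because a functional on l^2 is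
bounded by the l^2 norm of its values on the canonical basis
(ell2_functional_le).

Compactness.  The image of the unit ball lies in the Hilbert cube of the
sequences y with |y(b)| <= r(b), which is precompact: up to identifying complex
numbers with pairs of reals, it lies in the continuous image of a product of
segments, and this product is compact by Tychonoff (precompact_hilbert_cube).

Existence.  Level by level, the Riesz-Fischer theorem gives functions s_j on the
torus with coefficients c(j, .) and uniformly bounded mean modulus.  Together
they represent the symbol: a tempered distribution is determined by its values on
the characters of the levels, since trigonometric polynomials are dense among
smooth functions, with all derivatives, and test functions decay across the
levels (functional_eq0, trigonometric_density).  The weak formula is then a
bounded sesquilinear form on l^2, and the operator is read off its values
(localization_operator_exists). *)

(** * Complex-valued integrals *)

Section complex_modulus.
Variable R : realType.
Implicit Types z w : R[i].

Lemma normcE z : (normc z)%:C%C = `|z|. Proof. by []. Qed.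

Lemma normc_ge0 z : 0 <= normc z.
Proof. by rewrite -lecR normcE normr_ge0. Qed.

Lemma normcD z w : normc (z + w) <= normc z + normc w.
Proof. by rewrite -lecR rmorphD /= !normcE ler_normD. Qed.

Lemma normcM z w : normc (z * w) = normc z * normc w.
Proof. exact: ComplexField.Normc.normcM. Qed.

Lemma normc0 : normc (0 : R[i]) = 0.
Proof. exact: ComplexField.Normc.normc0. Qed.

Lemma normc1 : normc (1 : R[i]) = 1.
Proof. exact: ComplexField.Normc.normc1. Qed.

Lemma normcN z : normc (- z) = normc z.
Proof. by apply: complexI; rewrite !normcE normrN. Qed.

Lemma normcB z w : normc (z - w) = normc (w - z).
Proof. by rewrite -opprB normcN. Qed.

Lemma ler_normcB z w : normc z - normc w <= normc (z - w).
Proof. by rewrite lerBlDr -{1}(subrK w z) normcD. Qed.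

Lemma normc_conj z : normc (z^*)%C = normc z.
Proof. by case: z => a b /=; rewrite sqrrN. Qed.

Lemma normc_real (x : R) : normc (x%:C)%C = `|x|.
Proof. by rewrite /= expr0n addr0 sqrtr_sqr. Qed.

Lemma normc_eq0 z : (normc z == 0) = (z == 0).
Proof.
apply/eqP/eqP => [/ComplexField.Normc.eq0_normc//|->]; exact: normc0.
Qed.

Lemma normc_sum I (r : seq I) (P : pred I) (F : I -> R[i]) :
  normc (\sum_(i <- r | P i) F i) <= \sum_(i <- r | P i) normc (F i).
Proof.
elim/big_ind2 : _ => [|x1 x2 y1 y2 h1 h2|//]; first by rewrite normc0.
exact: le_trans (normcD _ _) (lerD _ _).
Qed.

Lemma ReM z w : complex.Re (z * w) =
  complex.Re z * complex.Re w - complex.Im z * complex.Im w.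
Proof. by case: z; case: w. Qed.

Lemma ImM z w : complex.Im (z * w) =
  complex.Re z * complex.Im w + complex.Im z * complex.Re w.
Proof. by case: z; case: w. Qed.

Lemma ReD z w : complex.Re (z + w) = complex.Re z + complex.Re w.
Proof. by case: z; case: w. Qed.

Lemma ImD z w : complex.Im (z + w) = complex.Im z + complex.Im w.
Proof. by case: z; case: w. Qed.

Lemma Re_conj z : complex.Re (z^*)%C = complex.Re z.
Proof. by case: z. Qed.

Lemma Im_conj z : complex.Im (z^*)%C = - complex.Im z.
Proof. by case: z. Qed.

Lemma sqr_normc z : normc z ^+ 2 = complex.Re z ^+ 2 + complex.Im z ^+ 2.
Proof. by case: z => a b /=; rewrite sqr_sqrtr// addr_ge0// sqr_ge0. Qed.

Lemma normr_Re z : `|complex.Re z| <= normc z.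
Proof.
rewrite -(@ler_pXn2r _ 2)// ?nnegrE ?normr_ge0 ?normc_ge0//.
by rewrite sqr_normc real_normK ?num_real// lerDl sqr_ge0.
Qed.

Lemma normr_Im z : `|complex.Im z| <= normc z.
Proof.
rewrite -(@ler_pXn2r _ 2)// ?nnegrE ?normr_ge0 ?normc_ge0//.
by rewrite sqr_normc [X in X <= _]real_normK ?num_real// lerDr sqr_ge0.
Qed.

Lemma normc_le_ReIm z : normc z <= `|complex.Re z| + `|complex.Im z|.
Proof.
rewrite -(@ler_pXn2r _ 2)// ?nnegrE ?normc_ge0 ?addr_ge0//.
rewrite sqr_normc sqrrD !real_normK ?num_real//.
by rewrite lerD2r lerDl mulrn_wge0// mulr_ge0.
Qed.

Lemma mulr_conj z : z * (z^*)%C = ((normc z ^+ 2)%:C)%C.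
Proof.
rewrite sqr_normc; case: z => a b; apply/eqP; rewrite eq_complex/=.
by apply/andP; split; apply/eqP; ring.
Qed.

End complex_modulus.

Section complex_integral_theory.
Context d (T : measurableType d) (R : realType).
Variable mu : {measure set T -> \bar R}.
Implicit Types f g : T -> R[i].

Lemma Cmeasurable_cst (c : R[i]) : Cmeasurable (fun _ : T => c).
Proof. by split; exact: measurable_cst. Qed.

Lemma CmeasurableM f g : Cmeasurable f -> Cmeasurable g ->
  Cmeasurable (fun x => f x * g x).
Proof.
move=> [f1 f2] [g1 g2]; split.
- under eq_fun do rewrite ReM.
  by apply: measurable_funB; exact: measurable_funM.
- under eq_fun do rewrite ImM.
  by apply: measurable_funD; exact: measurable_funM.
Qed.

Lemma Cmeasurable_conj f : Cmeasurable f -> Cmeasurable (fun x => ((f x)^*)%C).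
Proof.
move=> [f1 f2]; split.
- by under eq_fun do rewrite Re_conj.
- under eq_fun do rewrite Im_conj -mulN1r.
  exact: measurable_funM.
Qed.

Lemma measurable_normc f : Cmeasurable f ->
  measurable_fun [set: T] (fun x => normc (f x)).
Proof.
move=> [f1 f2]; have -> : (fun x => normc (f x)) =
    (fun x => Num.sqrt (complex.Re (f x) ^+ 2 + complex.Im (f x) ^+ 2)).
  by apply/funext => x; rewrite -sqr_normc sqrtr_sqr ger0_norm ?normc_ge0.
apply: (@measurableT_comp _ _ _ _ _ _ (@Num.sqrt R)).
  by apply: continuous_measurable_fun; exact: sqrt_continuous.
by apply: measurable_funD; exact: measurable_funX.
Qed.

Lemma emeasurable_normc f : Cmeasurable f ->
  measurable_fun [set: T] (fun x => (normc (f x))%:E).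
Proof. by move=> mf; apply/measurable_EFinP; exact: measurable_normc. Qed.

Lemma CintegrableP f : Cintegrable mu f <->
  Cmeasurable f /\ (\int[mu]_x (normc (f x))%:E < +oo)%E.
Proof.
split=> [[/integrableP[m1 i1] /integrableP[m2 i2]]|[mf fi]].
  have mf : Cmeasurable f by split; apply/measurable_EFinP.
  split => //.
  apply: (@le_lt_trans _ _ (\int[mu]_x (`|(complex.Re (f x))%:E| + `|(complex.Im (f x))%:E|))%E).
    apply: ge0_le_integral => //.
    - by move=> x _; rewrite lee_fin normc_ge0.
    - exact: emeasurable_normc.
    - by apply: emeasurable_funD; exact: measurableT_comp.
    - by move=> x _; rewrite -EFinD lee_fin normc_le_ReIm.
  by rewrite ge0_integralD//; [exact: lte_add_pinfty|exact: measurableT_comp|exact: measurableT_comp].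
split; apply/integrableP; split.
- by apply/measurable_EFinP; exact: mf.1.
- apply: le_lt_trans fi; apply: ge0_le_integral => //.
  + by apply/measurableT_comp => //; apply/measurable_EFinP; exact: mf.1.
  + exact: emeasurable_normc.
  + by move=> x _; rewrite lee_fin normr_Re.
- by apply/measurable_EFinP; exact: mf.2.
- apply: le_lt_trans fi; apply: ge0_le_integral => //.
  + by apply/measurableT_comp => //; apply/measurable_EFinP; exact: mf.2.
  + exact: emeasurable_normc.
  + by move=> x _; rewrite lee_fin normr_Im.
Qed.

Lemma Cintegrable_meas f : Cintegrable mu f -> Cmeasurable f.
Proof. by move=> /CintegrableP[]. Qed.

Lemma le_Cintegrable f (g : T -> R) : Cmeasurable f ->
  (forall x, normc (f x) <= g x) -> measurable_fun [set: T] g ->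
  (\int[mu]_x (g x)%:E < +oo)%E -> Cintegrable mu f.
Proof.
move=> mf fg mg gi; apply/CintegrableP; split => //.
apply: le_lt_trans gi; apply: ge0_le_integral => //.
- by move=> x _; rewrite lee_fin normc_ge0.
- exact: emeasurable_normc.
- exact/measurable_EFinP.
- by move=> x _; rewrite lee_fin.
Qed.

Lemma CintegrableD f g : Cintegrable mu f -> Cintegrable mu g ->
  Cintegrable mu (fun x => f x + g x).
Proof.
move=> [f1 f2] [g1 g2]; split.
- by under eq_fun do rewrite ReD EFinD; exact: integrableD.
- by under eq_fun do rewrite ImD EFinD; exact: integrableD.
Qed.

Lemma CintegralD f g : Cintegrable mu f -> Cintegrable mu g ->
  Cintegral mu (fun x => f x + g x) = Cintegral mu f + Cintegral mu g.
Proof.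
move=> [f1 f2] [g1 g2]; apply/eqP; rewrite eq_complex/=; apply/andP; split; apply/eqP.
- by under eq_Rintegral do rewrite ReD; exact: RintegralD.
- by under eq_Rintegral do rewrite ImD; exact: RintegralD.
Qed.

Lemma CintegrableZ (a : R[i]) f : Cintegrable mu f ->
  Cintegrable mu (fun x => a * f x).
Proof.
move=> /CintegrableP[mf fi]; apply/CintegrableP; split.
  by apply: CmeasurableM => //; exact: Cmeasurable_cst.
under eq_integral do rewrite normcM EFinM.
rewrite ge0_integralZl//; first by rewrite lte_mul_pinfty// lee_fin normc_ge0.
- exact: emeasurable_normc.
- by move=> x _; rewrite lee_fin normc_ge0.
- by rewrite lee_fin normc_ge0.
Qed.

Lemma CintegralZ (a : R[i]) f : Cintegrable mu f ->
  Cintegral mu (fun x => a * f x) = a * Cintegral mu f.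
Proof.
move=> [f1 f2]; case: a => a b; apply/eqP; rewrite eq_complex/=; apply/andP; split; apply/eqP.
- under eq_Rintegral do rewrite ReM/=.
  rewrite RintegralB ?RintegralZl//.
  + exact: (integrableZl measurableT a f1).
  + exact: (integrableZl measurableT b f2).
- under eq_Rintegral do rewrite ImM/=.
  rewrite RintegralD ?RintegralZl//.
  + exact: (integrableZl measurableT a f2).
  + exact: (integrableZl measurableT b f1).
Qed.

Lemma Cintegral0 : Cintegral mu (fun _ : T => 0) = 0.
Proof.
by rewrite /Cintegral /Rintegral integral0.
Qed.

Lemma Cintegrable0 : Cintegrable mu (fun _ : T => 0 : R[i]).
Proof. by split; exact: integrable0. Qed.

Lemma Cintegrable_sum I (r : seq I) (F : I -> T -> R[i]) :
  (forall i, Cintegrable mu (F i)) ->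
  Cintegrable mu (fun x => \sum_(i <- r) F i x).
Proof.
move=> mF; elim: r => [|i r IH].
  by under eq_fun do rewrite big_nil; exact: Cintegrable0.
by under eq_fun do rewrite big_cons; exact: CintegrableD.
Qed.

Lemma Cintegral_sum I (r : seq I) (F : I -> T -> R[i]) :
  (forall i, Cintegrable mu (F i)) ->
  Cintegral mu (fun x => \sum_(i <- r) F i x) =
  \sum_(i <- r) Cintegral mu (F i).
Proof.
move=> mF; elim: r => [|i r IH].
  by under eq_fun do rewrite big_nil; rewrite big_nil Cintegral0.
under eq_fun do rewrite big_cons; rewrite CintegralD ?IH ?big_cons//.
exact: Cintegrable_sum.
Qed.

Lemma eq_Cintegral f g : f =1 g -> Cintegral mu f = Cintegral mu g.
Proof. by move=> /funext ->. Qed.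

(** Rotating the integral onto the positive real axis turns its modulus into
the integral of a real part. *)
Lemma normc_Cintegral f : Cintegrable mu f ->
  ((normc (Cintegral mu f))%:E <= \int[mu]_x (normc (f x))%:E)%E.
Proof.
move=> fi; have [z zE] : exists z, z = Cintegral mu f by exists (Cintegral mu f).
rewrite -zE; have [->|z0] := eqVneq z 0.
  rewrite normc0; apply: integral_ge0 => x _.
  by rewrite lee_fin normc_ge0.
have zgt0 : 0 < normc z by rewrite lt_neqAle normc_ge0 eq_sym normc_eq0 z0.
have cfi : Cintegrable mu (fun x => (z^*)%C * f x) by exact: CintegrableZ.
have := congr1 (@complex.Re R) (CintegralZ (z^*)%C fi).
rewrite -zE [(z^*)%C * z]mulrC mulr_conj [RHS]/= => Rez.
have /CintegrableP[mf fioo] := fi.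
have : (((normc z) ^+ 2)%:E <= (normc z)%:E * \int[mu]_x (normc (f x))%:E)%E.
  rewrite -Rez -ge0_integralZl//; first last.
  - by rewrite lee_fin ltW.
  - by move=> x _; rewrite lee_fin normc_ge0.
  - exact: emeasurable_normc.
  rewrite [complex.Re _]/= /Rintegral fineK; last exact: integrable_fin_num cfi.1.
  apply: le_trans (lee_abs _) _; apply: le_trans (le_abse_integral _ _ _) _ => //.
    by have /integrableP[] := cfi.1.
  apply: ge0_le_integral => //.
  - by apply/measurableT_comp => //; have /integrableP[] := cfi.1.
  - under eq_fun do rewrite -EFinM.
    by apply/measurable_EFinP; apply: measurable_funM => //; exact: measurable_normc.
  - move=> x _; rewrite -EFinM lee_fin.
    by rewrite (le_trans (normr_Re _))// normcM normc_conj.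
by rewrite expr2 EFinM lee_pmul2l.
Qed.

End complex_integral_theory.

(** * Counting measure, iterated integrals *)

Section discrete_factor.
Context {R : realType} {n : nat}.
Local Notation Z := 'rV[int]_n.

Lemma measurable_prodZ d (Y : measurableType d) d' (X : sigmaRingType d')
    (f : Z * Y -> X) :
  (forall k, measurable_fun [set: Y] (fun y => f (k, y))) ->
  measurable_fun [set: Z * Y] f.
Proof.
move=> mf _ B mB; rewrite setTI.
have -> : f @^-1` B = \bigcup_k ([set k] `*` ((fun y => f (k, y)) @^-1` B)).
  apply/seteqP; split=> [[k y] /= Bf|[k y] [j _ /= [->]]//].
  by exists k.
apply: countable_bigcupT_measurable => [|k]; first exact: countableP.
apply: measurableX; first exact: measurable_rV_int.
by rewrite -[X in measurable X]setTI; exact: mf.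
Qed.

Lemma measurable_prodZr d (Y : measurableType d) d' (X : sigmaRingType d')
    (f : Y * Z -> X) :
  (forall k, measurable_fun [set: Y] (fun y => f (y, k))) ->
  measurable_fun [set: Y * Z] f.
Proof.
move=> mf _ B mB; rewrite setTI.
have -> : f @^-1` B = \bigcup_k (((fun y => f (y, k)) @^-1` B) `*` [set k]).
  apply/seteqP; split=> [[y k] /= Bf|[y k] [j _ /= [? ->]]//].
  by exists k.
apply: countable_bigcupT_measurable => [|k]; first exact: countableP.
apply: measurableX.
  by rewrite -[X in measurable X]setTI; exact: mf.
exact: measurable_rV_int.
Qed.

Lemma Cmeasurable_prodZ d (Y : measurableType d) (f : Z * Y -> R[i]) :
  (forall k, Cmeasurable (fun y => f (k, y))) -> Cmeasurable f.
Proof.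
by move=> mf; split; apply: measurable_prodZ => k; [exact: (mf k).1|exact: (mf k).2].
Qed.

Lemma Cmeasurable_Z (f : Z -> R[i]) : Cmeasurable f.
Proof. by split; exact: measurable_fun_rV_int. Qed.

Lemma measurable_Z d (X : sigmaRingType d) (f : Z -> X) : measurable_fun setT f.
Proof. exact: measurable_fun_rV_int. Qed.

Local Notation "\sumZ_ k F" := (\int[@counting Z R]_k F)%E
  (at level 41, k at level 0, F at level 41).

Lemma counting_set1 (a : Z) : @counting Z R [set a] = 1%E.
Proof. by rewrite /counting asboolT//= fset_set1 finmap.cardfs1. Qed.

Local Open Scope ereal_scope.

Lemma integral_counting1 (a : Z) (c : \bar R) : 0 <= c ->
  \sumZ_k (c * (\1_[set a] k)%:E) = c.
Proof.
move=> c0; rewrite ge0_integralZl//; last exact: measurable_Z.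
rewrite integral_indic//; last exact: measurable_rV_int.
by rewrite setIT [X in _ * X](counting_set1 a) mule1.
Qed.

Lemma integral_counting_seq (s : seq Z) (F : Z -> \bar R) : uniq s ->
  (forall k, 0 <= F k) -> (forall k, k \notin s -> F k = 0) ->
  \sumZ_k F k = \sum_(k <- s) F k.
Proof.
move=> us F0 Fs.
transitivity (\sumZ_k (\sum_(a <- s) (F a * (\1_[set a] k)%:E))).
  apply: eq_integral => k _; have [ks|ks] := boolP (k \in s).
    rewrite (bigD1_seq k)//= big1 ?adde0 ?indicE ?mem_set ?mule1//.
    by move=> a /negP ak; rewrite indicE memNset ?mule0// => kx; apply: ak; rewrite kx.
  rewrite (Fs _ ks) big_seq big1// => a ai.
  rewrite indicE memNset ?mule0//= => ka.
  by rewrite ka ai in ks.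
rewrite ge0_integral_sum//; last 2 first.
- by move=> a; exact: measurable_Z.
- by move=> a k _; rewrite mule_ge0.
by apply: eq_bigr => a _; exact: integral_counting1.
Qed.

Lemma integral_counting_pt (a : Z) (F : Z -> \bar R) :
  (forall k, 0 <= F k) -> (forall k, k != a -> F k = 0) -> \sumZ_k F k = F a.
Proof.
move=> F0 Fa; rewrite (@integral_counting_seq [:: a])//; first by rewrite big_seq1.
by move=> k; rewrite inE => /Fa.
Qed.

Lemma sum_le_integral_counting (s : seq Z) (F : Z -> \bar R) : uniq s ->
  (forall k, 0 <= F k) -> \sum_(k <- s) F k <= \sumZ_k F k.
Proof.
move=> us F0.
pose G k := if k \in s then F k else 0.
have -> : \sum_(k <- s) F k = \sum_(k <- s) G k.
  by rewrite big_seq [RHS]big_seq; apply: eq_bigr => k ks; rewrite /G ks.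
rewrite -(@integral_counting_seq s G)//.
- apply: ge0_le_integral => //.
  + by move=> k _; rewrite /G; case: ifP.
  + exact: measurable_Z.
  + exact: measurable_Z.
  + by move=> k _; rewrite /G; case: ifP.
- by move=> k; rewrite /G; case: ifP.
- by move=> k /negbTE ks; rewrite /G ks.
Qed.

Lemma le_integral_counting (a : Z) (F : Z -> \bar R) :
  (forall k, 0 <= F k) -> F a <= \sumZ_k F k.
Proof.
move=> F0; have := @sum_le_integral_counting [:: a] F isT F0.
by rewrite big_seq1.
Qed.

(** The finite exhaustion of the lattice given by its countability. *)
Definition Zrange (m : nat) : seq Z := pmap pickle_inv (iota 0 m).

Lemma Zrange_uniq m : uniq (Zrange m).
Proof. exact: (pmap_uniq (@pickle_invK Z) (iota_uniq 0 m)). Qed.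

Lemma mem_Zrange m k : (k \in Zrange m) = (pickle k < m)%N.
Proof.
rewrite mem_pmap; apply/mapP/idP => [[i + ki]|km].
  rewrite mem_iota/= add0n => im; have := @pickle_invK Z i.
  by rewrite -ki/= => ->.
by exists (pickle k); rewrite ?pickleK_inv// mem_iota.
Qed.

Lemma cvg_sum_Zrange (F : Z -> \bar R) : (forall k, 0 <= F k) ->
  \sum_(k <- Zrange m) F k @[m --> \oo] --> \sumZ_k F k.
Proof.
move=> F0; pose G m k := if k \in Zrange m then F k else 0.
have G0 m k : 0 <= G m k by rewrite /G; case: ifP.
have -> : (fun m => \sum_(k <- Zrange m) F k) = (fun m => \sumZ_k G m k).
  apply/funext => m; rewrite (@integral_counting_seq (Zrange m))//.
  - by rewrite big_seq [RHS]big_seq; apply: eq_bigr => k ks; rewrite /G ks.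
  - exact: Zrange_uniq.
  - by move=> k /negbTE ks; rewrite /G ks.
have -> : \sumZ_k F k = \sumZ_k (limn (G ^~ k)).
  apply: eq_integral => k _; apply/esym/cvg_lim => //.
  apply: cvg_near_cst; exists (pickle k).+1 => // m /= km.
  by rewrite /G mem_Zrange km.
apply: cvg_monotone_convergence => //.
- by move=> m; exact: measurable_Z.
- move=> k _ m m' mm'; rewrite /G !mem_Zrange.
  case: ifPn => km; last by case: ifP.
  by rewrite (leq_trans km mm').
Qed.

Lemma integral_counting_le (F : Z -> \bar R) (B : \bar R) :
  (forall k, 0 <= F k) ->
  (forall s : seq Z, uniq s -> \sum_(k <- s) F k <= B) ->
  \sumZ_k F k <= B.
Proof.
move=> F0 FB; have Fc := cvg_sum_Zrange F0.
rewrite -(cvg_lim _ Fc)//; apply: lime_le; first by apply/cvg_ex; eexists; exact: Fc.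
by apply: nearW => m; apply: FB; exact: Zrange_uniq.
Qed.

Lemma Cintegral_counting_pt (a : Z) (F : Z -> R[i]) :
  (forall k, k != a -> F k = 0%R) ->
  Cintegrable counting F /\ Cintegral counting F = F a.
Proof.
move=> Fa; have i1 : Cintegrable counting (fun k => ((k == a)%:R : R[i])).
  apply/CintegrableP; split; first exact: Cmeasurable_Z.
  rewrite (@integral_counting_pt a).
  - by rewrite ltry.
  - by move=> k; rewrite lee_fin normc_ge0.
  - by move=> k /negbTE ->; rewrite normc0.
have -> : F = (fun k => F a * (k == a)%:R)%R.
  apply/funext => k; have [->|/Fa ->] := eqVneq k a; first by rewrite mulr1.
  by rewrite mulr0.
split; first exact: CintegrableZ.
rewrite CintegralZ// eqxx; congr (_ * _)%R.
have ReE k : complex.Re ((k == a)%:R : R[i]) = (k == a)%:R by case: eqP.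
have ImE k : complex.Im ((k == a)%:R : R[i]) = 0%R by case: eqP.
have I1 : \sumZ_k ((k == a)%:R : R)%:E = 1.
  rewrite (@integral_counting_pt a) ?eqxx//.
  by move=> k; case: eqP.
apply/eqP; rewrite eq_complex [complex.Re (Cintegral _ _)]/= [complex.Im (Cintegral _ _)]/=.
under eq_Rintegral do rewrite ReE.
under [X in _ && (X == _)]eq_Rintegral do rewrite ImE.
by rewrite /Rintegral I1 integral0/= !eqxx.
Qed.

Lemma tonelliZ d (Y : measurableType d)
    (mu : {sigma_finite_measure set Y -> \bar R}) (F : Z -> Y -> \bar R) :
  (forall k, measurable_fun [set: Y] (F k)) -> (forall k y, 0 <= F k y) ->
  \sumZ_k \int[mu]_y F k y = \int[mu]_y \sumZ_k F k y.
Proof.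
move=> mF F0.
apply: (@fubini_tonelli _ _ _ _ R (@counting Z R) mu (fun x => F x.1 x.2)) => //.
by apply: measurable_prodZ => k; exact: mF.
Qed.

Lemma tonelliZZ (F : Z -> Z -> \bar R) : (forall k y, 0 <= F k y) ->
  \sumZ_k \sumZ_l F k l = \sumZ_l \sumZ_k F k l.
Proof. by move=> F0; apply: tonelliZ => // k; exact: measurable_Z. Qed.

Lemma measurable_integral2 d d' (X : measurableType d) (Y : measurableType d')
    (mu : {sigma_finite_measure set Y -> \bar R}) (F : X -> Y -> \bar R) :
  measurable_fun [set: X * Y] (fun x => F x.1 x.2) -> (forall x y, 0 <= F x y) ->
  measurable_fun [set: X] (fun x => \int[mu]_y F x y).
Proof.
move=> mF F0.
by apply: (@measurable_fun_fubini_tonelli_F _ _ X Y R mu (fun x => F x.1 x.2)).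
Qed.

End discrete_factor.
Arguments Zrange : clear implicits.
Arguments Zrange_uniq : clear implicits.

Section iterated_integrals.
Context d1 d2 (T1 : measurableType d1) (T2 : measurableType d2) (R : realType).
Variables (m1 : {sigma_finite_measure set T1 -> \bar R})
          (m2 : {sigma_finite_measure set T2 -> \bar R}).

Let Rintegral_fubini (f : T1 * T2 -> R) :
  (m1 \x m2)%E.-integrable setT (EFin \o f) ->
  m1.-integrable setT (fun x => (\int[m2]_y f (x, y))%:E) /\
  \int[(m1 \x m2)%E]_x f x = \int[m1]_x \int[m2]_y f (x, y).
Proof.
move=> fi.
have fFi := integrable_fubini_F fi.
have ff : ae_eq m1 setT (fubini_F m2 (EFin \o f)) (fun x => (\int[m2]_y f (x, y))%:E).
  apply: filterS (integrable_ae measurableT fFi) => x /(_ Logic.I) h _.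
  by rewrite /Rintegral fineK.
have mff : measurable_fun setT (fun x => (\int[m2]_y f (x, y))%:E).
  apply/measurable_EFinP; apply: (@measurableT_comp _ _ _ _ _ _ (@fine R)) => //.
  by have /integrableP[] := fFi.
split.
  apply/integrableP; split => //.
  have /integrableP[mF] := fFi; apply: le_lt_trans.
  rewrite le_eqVlt; apply/orP; left; apply/eqP/ae_eq_integral => //.
  - exact: measurableT_comp.
  - exact: measurableT_comp.
  - by apply: filterS ff => x /(_ Logic.I) <-.
rewrite /Rintegral; congr fine.
rewrite -(integral12_prod_meas1 fi); apply: ae_eq_integral => //.
by have /integrableP[] := fFi.
Qed.

Lemma Cintegral_prod (f : T1 * T2 -> R[i]) : Cintegrable (m1 \x m2)%E f ->
  Cintegrable m1 (fun x => Cintegral m2 (fun y => f (x, y))) /\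
  Cintegral (m1 \x m2)%E f = Cintegral m1 (fun x => Cintegral m2 (fun y => f (x, y))).
Proof.
move=> [/Rintegral_fubini[i1 e1] /Rintegral_fubini[i2 e2]]; split; first by split.
by rewrite /Cintegral/= e1 e2.
Qed.

End iterated_integrals.

Section cauchy_schwarz.
Context d (T : measurableType d) (R : realType).
Variable mu : {measure set T -> \bar R}.

Lemma cauchy_schwarz_integral (u v : T -> R) (A B : R) :
  measurable_fun setT u -> measurable_fun setT v -> 0 <= A -> 0 <= B ->
  (\int[mu]_x (u x ^+ 2)%:E <= (A ^+ 2)%:E)%E ->
  (\int[mu]_x (v x ^+ 2)%:E <= (B ^+ 2)%:E)%E ->
  (\int[mu]_x `|u x * v x|%:E <= (A * B)%:E)%E.
Proof.
move=> mu_ mv A0 B0 uA vB.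
have N2 (w : T -> R) (C : R) : 0 <= C -> (\int[mu]_x (w x ^+ 2)%:E <= (C ^+ 2)%:E)%E ->
    ('N[mu]_2%:E[EFin \o w] <= C%:E)%E.
  move=> C0 wC.
  have : ('N[mu]_2%:E[EFin \o w] `^ 2 <= C%:E `^ 2)%E.
    rewrite powR_Lnorm// poweR_EFin powR_mulrn//; apply: le_trans wC.
    rewrite le_eqVlt; apply/orP; left; apply/eqP/eq_integral => x _.
    by rewrite /= powR_mulrn// real_normK ?num_real.
  move=> h; have := @gt0_ler_poweR _ 2^-1 _ (_ `^ 2)%E (_ `^ 2)%E _ _ h.
  rewrite -!poweRrM ?mulfV// !poweRe1 ?Lnorm_ge0 ?lee_fin//; apply => //.
  - by rewrite in_itv/= leey poweR_ge0.
  - by rewrite in_itv/= leey lee_fin powR_ge0.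
have := @hoelder _ T R mu u v 2 2 mu_ mv (ltr0Sn _ 1) (ltr0Sn _ 1).
rewrite Lnorm1/= => h; rewrite EFinM.
apply: le_trans (h _) _; first by lra.
by apply: lee_pmul; rewrite ?Lnorm_ge0//; exact: N2.
Qed.

End cauchy_schwarz.

(** * Integration on the torus *)

Section row_cons_theory.
Context {R : realType}.

Lemma row_cons0 n (t : R) (x : 'rV[R]_n) : row_cons (t, x) ord0 ord0 = t.
Proof.
transitivity (row_mx (const_mx t : 'rV[R]_1) x ord0 (lshift n ord0)).
  by rewrite /row_cons; congr (row_mx _ _ _ _); exact: val_inj.
by rewrite row_mxEl mxE.
Qed.

Lemma row_consS n (t : R) (x : 'rV[R]_n) (j : 'I_n) :
  row_cons (t, x) ord0 (lift ord0 j) = x ord0 j.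
Proof.
have <- := row_mxEr (const_mx t : 'rV[R]_1) x ord0 j.
by rewrite /row_cons; congr (row_mx _ _ _ _); exact: val_inj.
Qed.

Lemma row_consP n (x y : 'rV[R]_n.+1) : x ord0 ord0 = y ord0 ord0 ->
  (forall j, x ord0 (lift ord0 j) = y ord0 (lift ord0 j)) -> x = y.
Proof.
move=> xy0 xyS; apply/rowP => i.
by case: (unliftP ord0 i) => [j|] ->; [exact: xyS|].
Qed.

Lemma row_cons_shift0 n (h t : R) (x : 'rV[R]_n) :
  row_cons (h + t, x) = h *: delta_mx ord0 ord0 + row_cons (t, x).
Proof.
apply: row_consP => [|j].
  by rewrite row_cons0 mxE row_cons0 !mxE eqxx/= mulr1.
by rewrite row_consS mxE row_consS !mxE eqxx/= mulr0 add0r.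
Qed.

Lemma row_cons_shiftS n (h t : R) (x : 'rV[R]_n) j :
  row_cons (t, h *: delta_mx ord0 j + x) =
  h *: delta_mx ord0 (lift ord0 j) + row_cons (t, x).
Proof.
apply: row_consP => [|k].
  by rewrite row_cons0 mxE row_cons0 !mxE eqxx/= mulr0 add0r.
by rewrite row_consS [RHS]mxE row_consS !mxE eqxx/= (inj_eq (@lift_inj _ ord0)).
Qed.

Lemma continuous_rV (V : topologicalType) n (f : V -> 'rV[R]_n) :
  (forall i, continuous (fun v => f v ord0 i)) -> continuous f.
Proof.
move=> fc v; apply/cvg_ballP => e e0.
have : \forall y \near v, forall i, ball (f v ord0 i) e (f y ord0 i).
  apply: filter_forall => i.
  by have /cvg_ballP/(_ _ e0) := fc i v.
by apply: filterS => y h; split=> // i j; rewrite (ord1 i); exact: h.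
Qed.

Lemma continuous_coord n (i : 'I_n) : continuous (fun x : 'rV[R]_n => x ord0 i).
Proof. by move=> x; exact: coord_continuous. Qed.

Lemma continuous_row_consl n (x : 'rV[R]_n) :
  continuous (fun t : R => row_cons (t, x)).
Proof.
apply: continuous_rV => i; case: (unliftP ord0 i) => [j|] ->.
  by under eq_fun do rewrite row_consS; exact: cst_continuous.
by under eq_fun do rewrite row_cons0; move=> t; exact: cvg_id.
Qed.

Lemma continuous_row_consr n (t : R) :
  continuous (fun x : 'rV[R]_n => row_cons (t, x)).
Proof.
apply: continuous_rV => i; case: (unliftP ord0 i) => [j|] ->.
  by under eq_fun do rewrite row_consS; exact: continuous_coord.
by under eq_fun do rewrite row_cons0; exact: cst_continuous.
Qed.

Lemma measurable_floorR : measurable_fun [set: R] (@Num.floor R : R -> int).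
Proof.
move=> _ B _; rewrite setTI.
have -> : (@Num.floor R) @^-1` B =
    \bigcup_(m : int) (if `[< B m >] then [set` `[m%:~R, (m + 1)%:~R[] else set0).
  apply/seteqP; split=> [x Bx|x [m _]].
    exists (Num.floor x) => //; rewrite (asboolT Bx) /= in_itv/=.
    by rewrite ge_floor floorD1_gt.
  case: asboolP => // Bm /=; rewrite in_itv/= => xm.
  by rewrite /preimage/= (floor_def xm).
apply: countable_bigcupT_measurable => [|m]; first exact: countableP.
by case: ifP.
Qed.

(** The Borel structure on rows is the one generated by the coordinates.  A
continuous function is the pointwise limit of its values at the grid points
below the argument, and these are measurable since the grids are countable. *)
Lemma continuous_measurable_rV n (f : 'rV[R]_n -> R) : continuous f ->
  measurable_fun [set: 'rV[R]_n] f.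
Proof.
move=> fc.
pose fl k (x : 'rV[R]_n) : 'rV[int]_n := \row_i Num.floor (x ord0 i * k.+1%:R).
pose gr k (z : 'rV[int]_n) : 'rV[R]_n := \row_i ((z ord0 i)%:~R / k.+1%:R).
apply: (@measurable_fun_cvg _ _ _ _ (fun k x => f (gr k (fl k x)))).
  move=> k; apply: (@measurableT_comp _ _ _ _ _ _ (f \o gr k) _ (fl k)).
    exact: measurable_fun_rV_int.
  apply: measurable_fun_row => i; under eq_fun do rewrite mxE.
  apply: (measurableT_comp measurable_floorR).
  by apply: measurable_funM => //; exact: measurable_coord.
move=> x _; apply: (@cvg_comp _ _ _ (fun k => gr k (fl k x)) f); last exact: fc.
apply/cvg_ballP => e e0.
have := near_infty_natSinv_lt (PosNum e0).
apply: filterS => k /= ke; split=> // i j; rewrite (ord1 i) !mxE /ball/=.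
apply: le_lt_trans ke.
have k0 : 0 < k.+1%:R :> R by rewrite ltr0n.
rewrite -[X in `|X - _|](mulfK (lt0r_neq0 k0)) -mulrBl normrM.
have k0V : 0 <= k.+1%:R^-1 :> R by rewrite invr_ge0 ltW.
rewrite (ger0_norm k0V) ler_piMl//.
set y := _ * _; have := ge_floor y; have := floorD1_gt y.
rewrite intrD => h1 h2; rewrite ger0_norm ?subr_ge0//; lra.
Qed.

Lemma is_derive_shift (U V : normedModType R) (f : V -> R) (phi : U -> V)
    (x u : U) (v : V) (d : R) :
  (forall h, phi (h *: u + x) = h *: v + phi x) ->
  is_derive (phi x) v f d -> is_derive x u (f \o phi) d.
Proof.
move=> phiE [fd fE].
have E : (fun h : R => h^-1 *: ((f \o phi) (h *: u + x) - (f \o phi) x)) =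
    (fun h : R => h^-1 *: (f (h *: v + phi x) - f (phi x))).
  by apply/funext => h; rewrite /= phiE.
split; first by rewrite /derivable E.
by rewrite /derive E.
Qed.

End row_cons_theory.

Section haar_theory.
Context {R : realType}.
Local Open Scope ereal_scope.

Lemma integral_haarS n (f : 'rV[R]_n.+1 -> \bar R) :
  measurable_fun setT f -> (forall x, 0 <= f x) ->
  \int[haar n.+1]_x f x =
  \int[uniform_prob (@ltr01 R)]_t \int[haar n]_x f (row_cons (t, x)).
Proof.
move=> mf f0 /=.
rewrite (@ge0_integral_distribution _ _ _ _ _ _ (@row_cons R n))//.
have mfr : measurable_fun setT (f \o @row_cons R n).
  by apply: (measurableT_comp mf); exact: measurable_funPT.
by rewrite fubini_tonelli1; [|exact: mfr|move=> x; exact: f0].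
Qed.

Lemma integral_haarS_swap n (f : 'rV[R]_n.+1 -> \bar R) :
  measurable_fun setT f -> (forall x, 0 <= f x) ->
  \int[haar n.+1]_x f x =
  \int[haar n]_x \int[lebesgue_measure]_(t in `[0%R, 1%R]) f (row_cons (t, x)).
Proof.
move=> mf f0 /=.
rewrite (@ge0_integral_distribution _ _ _ _ _ _ (@row_cons R n))//.
have mfr : measurable_fun setT (f \o @row_cons R n).
  by apply: (measurableT_comp mf); exact: measurable_funPT.
rewrite fubini_tonelli2; [|exact: mfr|by move=> x; exact: f0].
apply: eq_integral => x _.
rewrite /fubini_G integral_uniform//=; first by rewrite subr0 invr1 mul1e.
by apply: (measurableT_comp mfr); exact: measurable_pair2.
Qed.

Lemma integral_haar_cst n (B : R) : \int[haar n]_x B%:E = B%:E.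
Proof. by rewrite integral_cst// [X in _ * X]probability_setT mule1. Qed.

(** By induction on the dimension: integrating first along the direction of
the derivative, the fundamental theorem of calculus and periodicity give zero.
The constant B makes the integrand nonnegative, so that the order of the
integrations is free. *)
Lemma integral_haar_derivative n (i : 'I_n) (g h : 'rV[R]_n -> R) (B : R) :
  continuous h ->
  (forall x, is_derive x (delta_mx ord0 i) g (h x)) ->
  (forall x, g (delta_mx ord0 i + x) = g x)%R ->
  (forall x, `|h x| <= B)%R ->
  \int[haar n]_x (h x + B)%:E = B%:E.
Proof.
elim: n i g h => [[]//|n IH] i g h hc gh per hB.
have hB0 x : (0 <= h x + B)%R by have := hB x; rewrite ler_norml => /andP[]; lra.
have mh : measurable_fun setT (fun x => (h x + B)%:E).
  apply/measurable_EFinP/measurable_funD => //.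
  exact: continuous_measurable_rV.
case: (unliftP ord0 i) => [j|] iE; rewrite iE in gh per; last first.
  rewrite integral_haarS_swap//.
  transitivity (\int[@haar R n]_x B%:E); last exact: integral_haar_cst.
  apply: eq_integral => x _.
  pose F (t : R) := (g (row_cons (t, x)) + B * t)%R.
  have dF (t : R) : is_derive t 1%R F (h (row_cons (t, x)) + B)%R.
    have d1 : is_derive t 1%R (g \o (fun t => row_cons (t, x))) (h (row_cons (t, x))).
      apply: (@is_derive_shift _ _ _ g _ _ _ (delta_mx ord0 ord0)) => // s.
      by rewrite -row_cons_shift0 /GRing.scale/= mulr1.
    rewrite /F; apply: is_deriveD.
    by apply: is_derive_eq; rewrite /GRing.scale/= mulr1.
  have Fc (t : R) : {for t, continuous F}.
    by apply/differentiable_continuous/derivable1_diffP; case: (dF t).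
  rewrite (@continuous_FTC2 _ (fun t => h (row_cons (t, x)) + B)%R F)//.
  - rewrite -EFinB /F mulr1 mulr0 addr0.
    by rewrite -{1}[1%R]addr0 row_cons_shift0 scale1r per addrAC subrr add0r.
  - apply: continuous_subspaceT => t; apply: cvgD; last exact: cvg_cst.
    apply: (@cvg_comp _ _ _ (fun t => row_cons (t, x)) h); last exact: hc.
    exact: continuous_row_consl.
  - split.
    + by move=> t _; case: (dF t).
    + exact: (cvg_at_right_filter (Fc 0%R)).
    + exact: (cvg_at_left_filter (Fc 1%R)).
  - by move=> t _; rewrite derive1E; case: (dF t).
rewrite integral_haarS//.
transitivity (\int[uniform_prob (@ltr01 R)]_t B%:E).
  apply: eq_integral => t _.
  apply: (IH j (fun x => g (row_cons (t, x))) (fun x => h (row_cons (t, x)))).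
  - move=> x; apply: (@cvg_comp _ _ _ (fun x => row_cons (t, x)) h); last exact: hc.
    exact: continuous_row_consr.
  - move=> x; apply: (@is_derive_shift _ _ _ g _ _ _ (delta_mx ord0 (lift ord0 j))) => //.
    by move=> s; exact: row_cons_shiftS.
  - by move=> x; rewrite -[delta_mx _ _]scale1r row_cons_shiftS scale1r per.
  - by [].
by rewrite integral_cst// [X in _ * X]probability_setT mule1.
Qed.

End haar_theory.

(** * Characters of the torus and partial derivatives *)

Local Notation periodic := Defs.periodic.

Section characters.
Context {R : realType} {n : nat}.
Local Notation Z := 'rV[int]_n.
Local Notation T := 'rV[R]_n.
Local Notation C := R[i].

Lemma dotDl (x y : T) (k : Z) : dot (x + y) k = dot x k + dot y k.
Proof. by rewrite -big_split; apply: eq_bigr => i _; rewrite mxE mulrDl. Qed.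

Lemma dotDr (x : T) (k l : Z) : dot x (k + l) = dot x k + dot x l.
Proof.
by rewrite -big_split; apply: eq_bigr => i _; rewrite mxE intrD mulrDr.
Qed.

Lemma dotNr (x : T) (k : Z) : dot x (- k) = - dot x k.
Proof. by rewrite -sumrN; apply: eq_bigr => i _; rewrite mxE mulrNz mulrN. Qed.

Lemma dotNl (x : T) (k : Z) : dot (- x) k = - dot x k.
Proof. by rewrite -sumrN; apply: eq_bigr => i _; rewrite mxE mulNr. Qed.

Lemma dot0r (x : T) : dot x 0 = 0.
Proof. by rewrite /dot big1// => i _; rewrite mxE mulr0. Qed.

Lemma dot_delta (h : R) (x : T) i k :
  dot (h *: delta_mx ord0 i + x) k = h * (k ord0 i)%:~R + dot x k.
Proof.
rewrite dotDl; congr (_ + _); rewrite /dot (bigD1 i)//= !mxE !eqxx mulr1 big1 ?addr0//.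
by move=> j /negbTE ji; rewrite !mxE ji andbF mulr0 mul0r.
Qed.

Lemma expi2piD (s t : R) : expi2pi (s + t) = expi2pi s * expi2pi t.
Proof.
rewrite /expi2pi mulrDr cosD sinD; apply/eqP; rewrite eq_complex/=.
by apply/andP; split; apply/eqP; ring.
Qed.

Lemma expi2pi0 : expi2pi (0 : R) = 1.
Proof. by rewrite /expi2pi mulr0 cos0 sin0. Qed.

Lemma expi2piN (t : R) : expi2pi (- t) = ((expi2pi t)^*)%C.
Proof. by rewrite /expi2pi mulrN cosN sinN. Qed.

Lemma normc_expi2pi (t : R) : normc (expi2pi t) = 1.
Proof. by rewrite /expi2pi/= cos2Dsin2 sqrtr1. Qed.

Lemma expi2pi_int (m : int) : expi2pi (m%:~R : R) = 1.
Proof.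
have natE (k : nat) : expi2pi (k%:R : R) = 1.
  elim: k => [|k IH]; first exact: expi2pi0.
  rewrite -natr1 expi2piD IH mul1r /expi2pi mulr1.
  by rewrite mulrC mulr_natr cos2pi sin2pi.
case: m => k; first exact: natE.
by rewrite NegzE mulrNz expi2piN natE conjc1.
Qed.

Definition chi (l : Z) (x : T) : C := expi2pi (dot x l).

Lemma normc_chi l x : normc (chi l x) = 1.
Proof. exact: normc_expi2pi. Qed.

Lemma chiD l m x : chi (l + m) x = chi l x * chi m x.
Proof. by rewrite /chi dotDr expi2piD. Qed.

Lemma chi0 x : chi 0 x = 1.
Proof. by rewrite /chi dot0r expi2pi0. Qed.

Lemma chiN l x : chi (- l) x = ((chi l x)^*)%C.
Proof. by rewrite /chi dotNr expi2piN. Qed.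

Lemma chi_shift l x y : chi l (x + y) = chi l x * chi l y.
Proof. by rewrite /chi dotDl expi2piD. Qed.

Lemma chi_opp l x : chi l (- x) = chi (- l) x.
Proof. by rewrite /chi dotNl dotNr. Qed.

Lemma periodic_chi l : periodic (chi l).
Proof.
move=> x m; rewrite chi_shift [X in _ * X](_ : _ = 1) ?mulr1//.
rewrite /chi (_ : dot _ _ = (\sum_i m ord0 i * l ord0 i)%:~R) ?expi2pi_int//.
rewrite /dot rmorph_sum/=; apply: eq_bigr => i _.
by rewrite mxE intrM.
Qed.

End characters.

Section partial_derivatives.
Context {R : realType} {n : nat}.
Local Notation Z := 'rV[int]_n.
Local Notation T := 'rV[R]_n.
Local Notation C := R[i].
Implicit Types f g : T -> C.

Definition Cdiff f := forall x, differentiable (fun y => complex.Re (f y)) x /\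
  differentiable (fun y => complex.Im (f y)) x.

Definition Cderiv i f g := forall x,
  is_derive x (delta_mx ord0 i) (fun y => complex.Re (f y)) (complex.Re (g x)) /\
  is_derive x (delta_mx ord0 i) (fun y => complex.Im (f y)) (complex.Im (g x)).

Lemma CderivE i f g : Cderiv i f g -> partial i f = g.
Proof.
move=> fg; apply/funext => x; have [[_ h1] [_ h2]] := fg x.
by rewrite /partial h1 h2; case: (g x).
Qed.

Lemma Cdiff_deriv i f : Cdiff f -> Cderiv i f (partial i f).
Proof.
move=> df x; have [d1 d2] := df x.
by split; apply: DeriveDef => //; exact: diff_derivable.
Qed.

Lemma Cderiv_eq i f g g' : Cderiv i f g -> g =1 g' -> Cderiv i f g'.
Proof. by move=> h /funext <-. Qed.

Lemma Cdiff_continuous f : Cdiff f ->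
  continuous (fun x => complex.Re (f x)) /\ continuous (fun x => complex.Im (f x)).
Proof.
by move=> df; split=> x; apply: differentiable_continuous; case: (df x).
Qed.

Lemma Cdiff_measurable f : Cdiff f -> Cmeasurable f.
Proof.
by move=> /Cdiff_continuous[c1 c2]; split; exact: continuous_measurable_rV.
Qed.

Lemma CdiffD f g : Cdiff f -> Cdiff g -> Cdiff (fun x => f x + g x).
Proof.
move=> df dg x; have [f1 f2] := df x; have [g1 g2] := dg x; split.
- by under eq_fun do rewrite ReD; exact: differentiableD.
- by under eq_fun do rewrite ImD; exact: differentiableD.
Qed.

Lemma CdiffM f g : Cdiff f -> Cdiff g -> Cdiff (fun x => f x * g x).
Proof.
move=> df dg x; have [f1 f2] := df x; have [g1 g2] := dg x; split.
- by under eq_fun do rewrite ReM; apply: differentiableB; exact: differentiableM.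
- by under eq_fun do rewrite ImM; apply: differentiableD; exact: differentiableM.
Qed.

Lemma Cdiff_cst (c : C) : Cdiff (fun _ => c).
Proof. by move=> x; split; exact: differentiable_cst. Qed.

Lemma Cdiff_conj f : Cdiff f -> Cdiff (fun x => ((f x)^*)%C).
Proof.
move=> df x; have [f1 f2] := df x; split.
- by under eq_fun do rewrite Re_conj.
- by under eq_fun do rewrite Im_conj; exact: differentiableN.
Qed.

Lemma Cdiff_shift (w : T) f : Cdiff f -> Cdiff (fun x => f (x - w)).
Proof.
move=> df x; have [f1 f2] := df (x - w); split.
- by apply: (@differentiable_comp _ _ _ _ (fun y : T => y - w) (fun y => complex.Re (f y))).
- by apply: (@differentiable_comp _ _ _ _ (fun y : T => y - w) (fun y => complex.Im (f y))).
Qed.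

Lemma CderivD i f g f' g' : Cderiv i f f' -> Cderiv i g g' ->
  Cderiv i (fun x => f x + g x) (fun x => f' x + g' x).
Proof.
move=> df dg x; have [f1 f2] := df x; have [g1 g2] := dg x; split.
- by under eq_fun do rewrite ReD; rewrite ReD; exact: is_deriveD.
- by under eq_fun do rewrite ImD; rewrite ImD; exact: is_deriveD.
Qed.

Lemma CderivM i f g f' g' : Cderiv i f f' -> Cderiv i g g' ->
  Cderiv i (fun x => f x * g x) (fun x => f' x * g x + f x * g' x).
Proof.
move=> df dg x; have [f1 f2] := df x; have [g1 g2] := dg x; split.
- under eq_fun do rewrite ReM.
  apply: (is_derive_eq (is_deriveB (is_deriveM f1 g1) (is_deriveM f2 g2))).
  by rewrite ReD !ReM /GRing.scale/=; ring.
- under eq_fun do rewrite ImM.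
  apply: (is_derive_eq (is_deriveD (is_deriveM f1 g2) (is_deriveM f2 g1))).
  by rewrite ImD !ImM /GRing.scale/=; ring.
Qed.

Lemma Cderiv_cst i (c : C) : Cderiv i (fun _ => c) (fun _ => 0).
Proof. by move=> x; split; exact: is_derive_cst. Qed.

Lemma CderivZ i (c : C) f f' : Cderiv i f f' ->
  Cderiv i (fun x => c * f x) (fun x => c * f' x).
Proof.
move=> df; apply: Cderiv_eq (CderivM (Cderiv_cst i c) df) _ => x.
by rewrite mul0r add0r.
Qed.

Lemma Cderiv_conj i f f' : Cderiv i f f' ->
  Cderiv i (fun x => ((f x)^*)%C) (fun x => ((f' x)^*)%C).
Proof.
move=> df x; have [f1 f2] := df x; split.
- by under eq_fun do rewrite Re_conj; rewrite Re_conj.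
- by under eq_fun do rewrite Im_conj; rewrite Im_conj; exact: is_deriveN.
Qed.

Lemma Cderiv_shift i (w : T) f f' : Cderiv i f f' ->
  Cderiv i (fun x => f (x - w)) (fun x => f' (x - w)).
Proof.
move=> df x; have [f1 f2] := df (x - w); split.
- apply: (@is_derive_shift _ _ _ (fun y => complex.Re (f y)) (fun y : T => y - w) _ _ (delta_mx ord0 i)) f1.
  by move=> h; rewrite addrA.
- apply: (@is_derive_shift _ _ _ (fun y => complex.Im (f y)) (fun y : T => y - w) _ _ (delta_mx ord0 i)) f2.
  by move=> h; rewrite addrA.
Qed.

(** The multiplier 2 i pi l_i of the partial derivatives of characters. *)
Definition twopii (l : Z) i : C := (0 +i* (2 * pi * (l ord0 i)%:~R))%C.

Let is_derive_dot i (l : Z) (x : T) (f : R -> R) (d : R) :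
  is_derive (dot x l) 1 f d ->
  is_derive x (delta_mx ord0 i) (fun y => f (dot y l)) ((l ord0 i)%:~R * d).
Proof.
move=> df; have [/derivable1_diffP fd fE] := df.
apply: (@is_derive_shift _ _ _ f (dot ^~ l) x _ (l ord0 i)%:~R).
  by move=> h; rewrite dot_delta.
apply: DeriveDef; first exact: diff_derivable.
rewrite deriveE// -[X in 'd _ _ X]mulr1 -[_ * 1]/(_ *: 1) linearZ/=.
by rewrite -deriveE// fE.
Qed.

Lemma Cderiv_chi i l : Cderiv i (chi l) (fun x => twopii l i * chi l x).
Proof.
move=> x; rewrite ReM ImM /= !mul0r !add0r; split.
- apply: is_derive_eq.
    exact: (@is_derive_dot i l x (fun t => cos (2 * pi * t))).
  by rewrite /GRing.scale/=; ring.
- apply: is_derive_eq.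
    exact: (@is_derive_dot i l x (fun t => sin (2 * pi * t))).
  by rewrite /GRing.scale/=; ring.
Qed.

Let differentiable_dot l (x : T) : differentiable (fun y => dot y l) x.
Proof.
rewrite (_ : (fun y => dot y l) = \sum_i (fun y : T => y ord0 i * (l ord0 i)%:~R)).
  apply: differentiable_sum => i; apply: differentiableM => //.
  exact: differentiable_coord.
by apply/funext => y; rewrite fct_sumE.
Qed.

Let differentiable_trig (f : R -> R) l (x : T) : (forall t, derivable f t 1) ->
  differentiable (fun y => f (2 * pi * dot y l)) x.
Proof.
move=> df.
apply: (@differentiable_comp _ _ _ _ (fun y => 2 * pi * dot y l) f).
  by apply: differentiableM => //; exact: differentiable_dot.
by apply/derivable1_diffP.
Qed.

Lemma Cdiff_chi l : Cdiff (chi l).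
Proof. by move=> x; split; apply: differentiable_trig. Qed.

End partial_derivatives.

Section smooth_functions.
Context {R : realType} {n : nat}.
Local Notation Z := 'rV[int]_n.
Local Notation T := 'rV[R]_n.
Local Notation C := R[i].
Local Notation periodic := Defs.periodic.
Implicit Types f g : T -> C.

Lemma partials_rcons s i f : partials (rcons s i) f = partials s (partial i f).
Proof. by rewrite /partials -cats1 foldr_cat. Qed.

Lemma smooth_Cdiff f : smooth f -> Cdiff f.
Proof. by move=> sf; exact: (sf [::]). Qed.

Lemma smooth_partials s f : smooth f -> smooth (partials s f).
Proof. by move=> sf s' x; rewrite /partials -foldr_cat; exact: sf. Qed.

Lemma smooth_partial i f : smooth f -> smooth (partial i f).
Proof. exact: (@smooth_partials [:: i]). Qed.

(** A coinductive principle: a class of functions stable under partial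
derivatives consists of smooth functions. *)
Lemma smooth_coind (P : (T -> C) -> Prop) :
  (forall f, P f -> Cdiff f /\ forall i, P (partial i f)) ->
  forall f, P f -> smooth f.
Proof.
move=> h f Pf s; elim/last_ind: s f Pf => [|s i IH] f Pf x.
  exact: (h _ Pf).1.
by rewrite partials_rcons; apply: IH; exact: (h _ Pf).2.
Qed.

Lemma smooth_deriv i f : smooth f -> Cderiv i f (partial i f).
Proof. by move=> /smooth_Cdiff; exact: Cdiff_deriv. Qed.

Lemma partialsD s f g : smooth f -> smooth g ->
  partials s (fun x => f x + g x) = (fun x => partials s f x + partials s g x).
Proof.
move=> sf sg; elim: s => [//|i s IH].
rewrite [LHS]/= IH; apply: CderivE; apply: CderivD;
  exact/smooth_deriv/smooth_partials.
Qed.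

Lemma partialsZ s (c : C) f : smooth f ->
  partials s (fun x => c * f x) = (fun x => c * partials s f x).
Proof.
move=> sf; elim: s => [//|i s IH].
rewrite [LHS]/= IH; apply: CderivE; apply: CderivZ.
exact/smooth_deriv/smooth_partials.
Qed.

Lemma partials_conj s f : smooth f ->
  partials s (fun x => ((f x)^*)%C) = (fun x => ((partials s f x)^*)%C).
Proof.
move=> sf; elim: s => [//|i s IH].
rewrite [LHS]/= IH; apply: CderivE; apply: Cderiv_conj.
exact/smooth_deriv/smooth_partials.
Qed.

Lemma partials_shift s (w : T) f : smooth f ->
  partials s (fun x => f (x - w)) = (fun x => partials s f (x - w)).
Proof.
move=> sf; elim: s => [//|i s IH].
rewrite [LHS]/= IH; apply: CderivE; apply: Cderiv_shift.
exact/smooth_deriv/smooth_partials.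
Qed.

Lemma smoothD f g : smooth f -> smooth g -> smooth (fun x => f x + g x).
Proof.
by move=> sf sg s; rewrite partialsD//; apply: CdiffD; apply/smooth_Cdiff/smooth_partials.
Qed.

Lemma smoothZ (c : C) f : smooth f -> smooth (fun x => c * f x).
Proof.
move=> sf s; rewrite partialsZ//; apply: CdiffM; first exact: Cdiff_cst.
exact/smooth_Cdiff/smooth_partials.
Qed.

Lemma smooth_conj f : smooth f -> smooth (fun x => ((f x)^*)%C).
Proof.
by move=> sf s; rewrite partials_conj//; apply: Cdiff_conj; apply/smooth_Cdiff/smooth_partials.
Qed.

Lemma smooth_shift (w : T) f : smooth f -> smooth (fun x => f (x - w)).
Proof.
by move=> sf s; rewrite partials_shift//; apply: Cdiff_shift; apply/smooth_Cdiff/smooth_partials.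
Qed.

Lemma smooth0 : smooth (fun _ : T => 0 : C).
Proof.
apply: (@smooth_coind (fun f => f = fun _ => 0)) => // _ ->; split.
  exact: Cdiff_cst.
by move=> i; apply: CderivE; exact: Cderiv_cst.
Qed.

Lemma smooth_chi l : smooth (chi l : T -> C).
Proof.
apply: (@smooth_coind (fun f => exists c, f = fun x => c * chi l x)); last first.
  by exists 1; apply/funext => x; rewrite mul1r.
move=> _ [c ->]; split.
  by apply: CdiffM; [exact: Cdiff_cst|exact: Cdiff_chi].
move=> i; exists (c * twopii l i).
rewrite (CderivE (CderivZ c (Cderiv_chi i l))).
by apply/funext => x; rewrite mulrA.
Qed.

Lemma partial_chiM l i f : smooth f -> partial i (fun x => chi l x * f x) =
  (fun x => chi l x * (partial i f x + twopii l i * f x)).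
Proof.
move=> sf; rewrite (CderivE (CderivM (Cderiv_chi i l) (smooth_deriv i sf))).
by apply/funext => x; ring.
Qed.

Lemma smooth_chiM l f : smooth f -> smooth (fun x => chi l x * f x).
Proof.
move=> sf; apply: (@smooth_coind (fun g => exists f, smooth f /\
    g = fun x => chi l x * f x)); last by exists f.
move=> _ [{sf}f [sf ->]]; split.
  by apply: CdiffM; [exact: Cdiff_chi|exact: smooth_Cdiff].
move=> i; eexists; split; last exact: partial_chiM.
by apply: smoothD; [exact: smooth_partial|exact: smoothZ].
Qed.

Definition partials_bounded (N : nat) f (B : R) :=
  forall s x, (size s <= N)%N -> normc (partials s f x) <= B.

Lemma partials_bounded_ge0 N f B : partials_bounded N f B -> 0 <= B.
Proof. by move=> /(_ [::] 0 isT); apply: le_trans; exact: normc_ge0. Qed.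

Lemma partials_boundedW N M f B : (N <= M)%N -> partials_bounded M f B ->
  partials_bounded N f B.
Proof. by move=> NM h s x sN; apply: h; exact: leq_trans NM. Qed.

Lemma partials_bounded_le N f B B' : B <= B' -> partials_bounded N f B ->
  partials_bounded N f B'.
Proof. by move=> BB h s x sN; apply: le_trans BB; exact: h. Qed.

Lemma partials_bounded_partial N f B i : partials_bounded N.+1 f B ->
  partials_bounded N (partial i f) B.
Proof.
by move=> h s x sN; rewrite -partials_rcons; apply: h; rewrite size_rcons.
Qed.

Lemma partials_boundedD N f g A B : smooth f -> smooth g ->
  partials_bounded N f A -> partials_bounded N g B ->
  partials_bounded N (fun x => f x + g x) (A + B).
Proof.
move=> sf sg fA gB s x sN; rewrite partialsD//.
by apply: le_trans (normcD _ _) _; rewrite lerD ?fA ?gB.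
Qed.

Lemma partials_boundedZ N c f A : smooth f -> partials_bounded N f A ->
  partials_bounded N (fun x => c * f x) (normc c * A).
Proof.
by move=> sf fA s x sN; rewrite partialsZ// normcM ler_wpM2l ?normc_ge0 ?fA.
Qed.

Lemma partials_bounded_conj N f A : smooth f -> partials_bounded N f A ->
  partials_bounded N (fun x => ((f x)^*)%C) A.
Proof. by move=> sf fA s x sN; rewrite partials_conj// normc_conj fA. Qed.

Lemma partials_bounded_shift N w f A : smooth f -> partials_bounded N f A ->
  partials_bounded N (fun x => f (x - w)) A.
Proof. by move=> sf fA s x sN; rewrite partials_shift// fA. Qed.

(** Each derivative of chi l times f costs at most this factor. *)
Definition chi_growth (l : Z) : R := 1 + \sum_i normc (twopii l i : C).

Lemma chi_growth_ge1 l : 1 <= chi_growth l.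
Proof. by rewrite lerDl sumr_ge0// => i _; exact: normc_ge0. Qed.

Lemma partials_bounded_chiM l N f B : smooth f -> partials_bounded N f B ->
  partials_bounded N (fun x => chi l x * f x) (chi_growth l ^+ N * B).
Proof.
elim: N f B => [|N IH] f B sf fB s x.
  by rewrite leqn0 size_eq0 => /eqP ->; rewrite /= expr0 mul1r normcM normc_chi
    mul1r; exact: (fB [::]).
elim/last_ind: s => [_|s i _].
  rewrite /= normcM normc_chi mul1r (le_trans (fB [::] x isT))//.
  by rewrite ler_peMl ?(partials_bounded_ge0 fB)// exprn_ege1// chi_growth_ge1.
rewrite size_rcons ltnS => sN; rewrite partials_rcons partial_chiM// exprSr -mulrA.
apply: (IH (fun x => partial i f x + twopii l i * f x)) => //.
  by apply: smoothD; [exact: smooth_partial|exact: smoothZ].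
apply: (@partials_bounded_le _ _ (B + normc (twopii l i : C) * B)).
  rewrite /chi_growth mulrDl mul1r lerD2l ler_wpM2r ?(partials_bounded_ge0 fB)//.
  by rewrite (bigD1 i)//= lerDl sumr_ge0// => j _; exact: normc_ge0.
apply: partials_boundedD => //.
- exact: smooth_partial.
- exact: smoothZ.
- exact: partials_bounded_partial.
- by apply: partials_boundedZ => //; exact: partials_boundedW fB.
Qed.

Lemma periodic_chiM l f : periodic f -> periodic (fun x => chi l x * f x).
Proof. by move=> pf x m; rewrite pf periodic_chi. Qed.

Lemma periodic_shift w f : periodic f -> periodic (fun x => f (x - w)).
Proof. by move=> pf x m; rewrite addrAC pf. Qed.

Lemma periodic_partial i f : smooth f -> periodic f -> periodic (partial i f).
Proof.
move=> sf pf x m.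
have -> : partial i f x = partial i (fun y => f (y - - map_mx intr m)) x.
  by congr (partial i _ x); apply/funext => y; rewrite opprK pf.
by rewrite (CderivE (Cderiv_shift _ (smooth_deriv i sf))) opprK.
Qed.

End smooth_functions.

(** * Fourier coefficients *)

Section fourier.
Context {R : realType} {n : nat}.
Local Notation Z := 'rV[int]_n.
Local Notation T := 'rV[R]_n.
Local Notation C := R[i].
Local Notation periodic := Defs.periodic.
Local Notation mu := (@haar R n).
Implicit Types f g : T -> C.

Lemma Cintegrable_bounded f (B : R) : Cmeasurable f ->
  (forall x, normc (f x) <= B) -> Cintegrable mu f.
Proof.
move=> mf fB; apply: (@le_Cintegrable _ _ _ mu f (fun _ => B)) => //.
by rewrite integral_haar_cst ltry.
Qed.

Lemma le_integral_haar (h : T -> \bar R) (B : R) :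
  measurable_fun setT h -> (forall x, 0 <= h x)%E -> (forall x, h x <= B%:E)%E ->
  (\int[mu]_x h x <= B%:E)%E.
Proof.
move=> mh h0 hB; rewrite -(integral_haar_cst n B); exact: ge0_le_integral.
Qed.

Lemma normc_Cintegral_le f (B : R) : Cmeasurable f ->
  (forall x, normc (f x) <= B) -> normc (Cintegral mu f) <= B.
Proof.
move=> mf fB; rewrite -lee_fin; apply: le_trans (normc_Cintegral _) _.
  exact: Cintegrable_bounded fB.
apply: le_integral_haar => //; first exact: emeasurable_normc.
by move=> x; rewrite lee_fin normc_ge0.
Qed.

Let Rintegral_haar_derivative i (g h : T -> R) (B : R) :
  continuous h -> (forall x, is_derive x (delta_mx ord0 i) g (h x)) ->
  (forall x, g (delta_mx ord0 i + x) = g x) -> (forall x, `|h x| <= B) ->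
  \int[mu]_x h x = 0.
Proof.
move=> hc gh per hB.
have := integral_haar_derivative hc gh per hB.
have hi : mu.-integrable setT (EFin \o h).
  apply/integrableP; split.
    by apply/measurable_EFinP; exact: continuous_measurable_rV.
  apply: (@le_lt_trans _ _ B%:E); last by rewrite ltry.
  apply: le_integral_haar => //.
  by apply: measurableT_comp => //; apply/measurable_EFinP; exact: continuous_measurable_rV.
have Bi : mu.-integrable setT (fun _ => B%:E).
  apply/integrableP; split => //.
  by rewrite (integral_haar_cst n `|B|) ltry.
rewrite (_ : (fun x => (h x + B)%:E) = (fun x => (EFin \o h) x + B%:E)%E); last first.
  by apply/funext.
rewrite integralD// integral_haar_cst /Rintegral.
have hf := integrable_fin_num measurableT hi.
rewrite -(fineK hf) -EFinD => -[] /(congr1 (fun t => t - B)).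
by rewrite addrK subrr => h0; exact: h0.
Qed.

Lemma Cintegral_haar_derivative i f g (B : R) :
  Cderiv i f g -> Cdiff g -> (forall x, normc (g x) <= B) -> periodic f ->
  Cintegral mu g = 0.
Proof.
move=> fg /Cdiff_continuous[c1 c2] gB pf.
have per x : f (delta_mx ord0 i + x) = f x.
  rewrite -(pf x (delta_mx ord0 i)) addrC; congr (f (_ + _)).
  by apply/matrixP => a b; rewrite !mxE; case: (_ && _).
have r1 : \int[mu]_x complex.Re (g x) = 0.
  apply: (@Rintegral_haar_derivative i (fun x => complex.Re (f x)) _ B) => //.
  - by move=> x; exact: (fg x).1.
  - by move=> x; rewrite per.
  - by move=> x; exact: le_trans (normr_Re _) (gB x).
have r2 : \int[mu]_x complex.Im (g x) = 0.
  apply: (@Rintegral_haar_derivative i (fun x => complex.Im (f x)) _ B) => //.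
  - by move=> x; exact: (fg x).2.
  - by move=> x; rewrite per.
  - by move=> x; exact: le_trans (normr_Im _) (gB x).
by rewrite /Cintegral r1 r2.
Qed.

Lemma twopii_eq0 (l : Z) i : (twopii l i == 0 :> C) = (l ord0 i == 0).
Proof.
by rewrite eq_complex/= eqxx !mulf_eq0 intr_eq0 pnatr_eq0 (gt_eqF (pi_gt0 R)).
Qed.

Lemma Cintegrable_chi l : Cintegrable mu (chi l).
Proof.
apply: (@Cintegrable_bounded _ 1); first exact/Cdiff_measurable/Cdiff_chi.
by move=> x; rewrite normc_chi.
Qed.

Lemma Cintegral_chi l : Cintegral mu (chi l) = (l == 0)%:R.
Proof.
have [->|/eqP l0] := eqVneq l 0.
  under eq_Cintegral do rewrite chi0.
  by rewrite /Cintegral /Rintegral !integral_haar_cst.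
have [i li] : exists i, l ord0 i != 0.
  by apply/existsP; apply: contra_notT l0 => /existsPn h; apply/rowP => i;
    rewrite mxE; apply/eqP/negPn/h.
have := @Cintegral_haar_derivative i _ _ (normc (twopii l i : C)) (Cderiv_chi i l).
rewrite CintegralZ; last exact: Cintegrable_chi.
move=> /(_ _ _ (periodic_chi l)) h.
have /eqP : twopii l i * Cintegral mu (chi l) = 0.
  apply: h; first by apply: CdiffM; [exact: Cdiff_cst|exact: Cdiff_chi].
  by move=> x; rewrite normcM normc_chi mulr1.
by rewrite mulf_eq0 twopii_eq0 (negbTE li) => /eqP.
Qed.

Definition fourier f (l : Z) : C := Cintegral mu (fun x => f x * chi (- l) x).

Lemma fourier_integrable f l (B : R) : Cmeasurable f ->
  (forall x, normc (f x) <= B) -> Cintegrable mu (fun x => f x * chi (- l) x).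
Proof.
move=> mf fB; apply: (@Cintegrable_bounded _ B).
  by apply: CmeasurableM => //; exact/Cdiff_measurable/Cdiff_chi.
by move=> x; rewrite normcM normc_chi mulr1.
Qed.

Lemma normc_fourier_le f l (B : R) : Cmeasurable f ->
  (forall x, normc (f x) <= B) -> normc (fourier f l) <= B.
Proof.
move=> mf fB; apply: normc_Cintegral_le.
  by apply: CmeasurableM => //; exact/Cdiff_measurable/Cdiff_chi.
by move=> x; rewrite normcM normc_chi mulr1.
Qed.

Lemma fourierB f g l (A B : R) : Cmeasurable f -> Cmeasurable g ->
  (forall x, normc (f x) <= A) -> (forall x, normc (g x) <= B) ->
  fourier (fun x => f x - g x) l = fourier f l - fourier g l.
Proof.
move=> mf mg fA gB; rewrite /fourier.
under eq_Cintegral do rewrite mulrBl -mulN1r.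
rewrite CintegralD ?CintegralZ ?mulN1r//.
- exact: fourier_integrable gB.
- exact: fourier_integrable fA.
- by apply: CintegrableZ; exact: fourier_integrable gB.
Qed.

(** Integration by parts. *)
Lemma fourier_partial f i l (B : R) : smooth f -> periodic f ->
  partials_bounded 1 f B -> fourier (partial i f) l = twopii l i * fourier f l.
Proof.
move=> sf pf fB.
have f0 x : normc (f x) <= B := fB [::] x isT.
have f1 x : normc (partial i f x) <= B := fB [:: i] x isT.
have mf := Cdiff_measurable (smooth_Cdiff sf).
have mf1 := Cdiff_measurable (smooth_Cdiff (smooth_partial i sf)).
have tN : twopii (- l) i = - twopii l i :> C.
  by apply/eqP; rewrite eq_complex/= oppr0 eqxx/= mxE mulrNz mulrN.
have := @Cintegral_haar_derivative i _ _ (B + normc (twopii l i : C) * B)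
  (CderivM (smooth_deriv i sf) (Cderiv_chi i (- l))).
rewrite tN => h; apply/eqP; rewrite -subr_eq0 /fourier; apply/eqP.
rewrite -mulNr -CintegralZ; last exact: fourier_integrable f0.
rewrite -CintegralD; last 2 first.
- exact: fourier_integrable f1.
- by apply: CintegrableZ; exact: fourier_integrable f0.
rewrite -{}h.
- by apply: eq_Cintegral => x; ring.
- apply: CdiffD; apply: CdiffM.
  + exact/smooth_Cdiff/smooth_partial.
  + exact: Cdiff_chi.
  + exact: smooth_Cdiff.
  + by apply: CdiffM; [exact: Cdiff_cst|exact: Cdiff_chi].
- move=> x; apply: le_trans (normcD _ _) _; rewrite !normcM normc_chi !mulr1 normcN.
  by rewrite lerD// mulrC ler_wpM2l ?normc_ge0.
- by move=> x m; rewrite pf periodic_chi.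
Qed.

(** Lists of terms, in which a frequency may be repeated, make the coefficients
easy to transport along linear functionals. *)
Definition trigpoly (tp : seq (C * Z)) (x : T) : C :=
  \sum_(p <- tp) p.1 * chi p.2 x.

Definition trigpoly_coef (tp : seq (C * Z)) (l : Z) : C :=
  \sum_(p <- tp | p.2 == l) p.1.

Lemma smooth_trigpoly tp : smooth (trigpoly tp).
Proof.
elim: tp => [|p tp IH].
  have -> : trigpoly [::] = fun=> 0.
    by apply/funext => x; rewrite /trigpoly big_nil.
  exact: smooth0.
have -> : trigpoly (p :: tp) = fun x => p.1 * chi p.2 x + trigpoly tp x.
  by apply/funext => x; rewrite /trigpoly big_cons.
by apply: smoothD => //; apply: smoothZ; exact: smooth_chi.
Qed.

Lemma Cmeasurable_trigpoly tp : Cmeasurable (trigpoly tp).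
Proof. exact/Cdiff_measurable/smooth_Cdiff/smooth_trigpoly. Qed.

Lemma trigpoly_bounded tp x : normc (trigpoly tp x) <= \sum_(p <- tp) normc p.1.
Proof.
apply: le_trans (normc_sum _ _ _) _; apply: ler_sum => p _.
by rewrite normcM normc_chi mulr1.
Qed.

Lemma fourier_trigpoly tp l : fourier (trigpoly tp) l = trigpoly_coef tp l.
Proof.
rewrite /fourier /trigpoly.
under eq_Cintegral do rewrite mulr_suml.
rewrite Cintegral_sum => [|p].
  rewrite /trigpoly_coef [RHS]big_mkcond/=; apply: eq_bigr => p _.
  under eq_Cintegral do rewrite -mulrA -chiD.
  rewrite CintegralZ; last exact: Cintegrable_chi.
  by rewrite Cintegral_chi subr_eq0; case: eqP; rewrite ?mulr1 ?mulr0.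
under eq_fun do rewrite -mulrA -chiD.
by apply: CintegrableZ; exact: Cintegrable_chi.
Qed.

End fourier.

(** * Density of the trigonometric polynomials *)

Lemma Cderiv_sum {R : realType} {n : nat} k I (s : seq I)
    (f g : I -> 'rV[R]_n -> R[i]) : (forall i, Cderiv k (f i) (g i)) ->
  Cderiv k (fun x => \sum_(i <- s) f i x) (fun x => \sum_(i <- s) g i x).
Proof.
move=> fg; have sumE (h : I -> 'rV[R]_n -> R[i]) i s' :
    (fun x => \sum_(j <- i :: s') h j x) = (fun x => h i x + \sum_(j <- s') h j x).
  by apply/funext => x; rewrite big_cons.
elim: s => [|i s IH]; last by rewrite !sumE; exact: CderivD.
have nilE (h : I -> 'rV[R]_n -> R[i]) : (fun x => \sum_(j <- [::]) h j x) = fun=> 0.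
  by apply/funext => x; rewrite big_nil.
by rewrite !nilE; exact: Cderiv_cst.
Qed.

Section lipschitz.
Context {R : realType} {n : nat}.
Local Notation Z := 'rV[int]_n.
Local Notation T := 'rV[R]_n.
Local Notation C := R[i].
Local Notation periodic := Defs.periodic.

Let cos_pi4 : 1 / 2 <= cos (pi / 4 : R).
Proof.
have c0 : 0 <= cos (pi / 4 : R).
  by apply: cos_ge0_pihalf; have := pi_ge0 R; lra.
have : cos ((pi / 4 : R) *+ 2) = 0.
  by rewrite -[RHS](@cos_pihalf R); congr cos; rewrite -mulr_natl; lra.
rewrite cos_mulr2n => /eqP h.
have h2 : cos (pi / 4 : R) ^+ 2 = 1 / 2 by move/eqP: h; lra.
rewrite leNgt; apply/negP => lt.
have : cos (pi / 4 : R) ^+ 2 < (1 / 2) ^+ 2 by rewrite ltr_pXn2r// nnegrE; lra.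
by rewrite h2; lra.
Qed.

Let sin_ge (u : R) : 0 <= u <= 1 / 2 -> u <= sin (pi * u).
Proof.
move=> /andP[u0 u2]; have pi2 := pi_ge2 R.
have cosE (v : R) : 0 <= v <= pi / 4 -> 1 / 2 <= cos v.
  move=> v4; apply: le_trans cos_pi4 _; rewrite leNgt; apply/negP.
  rewrite ltr_cos ?in_itv/=; lra.
have [u4|u4] := leP u (1 / 4); last first.
  have -> : sin (pi * u) = cos (pi / 2 - pi * u).
    by rewrite cosB cos_pihalf sin_pihalf mul0r add0r mul1r.
  have h1 : 0 <= pi * (1 / 2 - u) by rewrite mulr_ge0//; lra.
  have h2 : 0 <= pi * (u - 1 / 4) by rewrite mulr_ge0//; lra.
  by apply: le_trans u2 _; apply: cosE; apply/andP; split; lra.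
have [c /[!in_itv]/= c01 E] : exists2 c : R, c \in `[0, u] &
    sin (pi * u) - sin (pi * 0) = pi * cos (pi * c) * (u - 0).
  apply: (@MVT_segment _ (fun s => sin (pi * s)) (fun s => pi * cos (pi * s))) => //.
    by move=> x _; apply: is_derive_eq; rewrite /GRing.scale/=; ring.
  apply: continuous_subspaceT => x; apply: differentiable_continuous.
  by apply/derivable1_diffP.
rewrite mulr0 sin0 !subr0 in E; rewrite E.
have := cosE (pi * c); have -> : 0 <= pi * c <= pi / 4 by apply/andP; split; nra.
move=> /(_ isT) h; have h1 : 1 <= pi * cos (pi * c) by nra.
by rewrite ler_peMl.
Qed.

(** Jordan's inequality for the sine, squared: 1 - cos measures the distance to
the integers. *)
Lemma sqr_le_1Bcos (t : R) : `|t| <= 1 / 2 -> t ^+ 2 <= (1 - cos (2 * pi * t)) / 2.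
Proof.
move=> t2; rewrite -real_normK ?num_real//.
have -> : cos (2 * pi * t) = cos ((pi * `|t|) *+ 2).
  have [t0|t0] := leP 0 t; first by rewrite ger0_norm// -[in RHS]mulr_natl mulrA.
  by rewrite ltr0_norm// -[LHS]cosN; congr cos; rewrite -[in RHS]mulr_natl; ring.
have h := @sin_ge `|t|; rewrite normr_ge0 t2/= in h.
have -> : (1 - cos ((pi * `|t|) *+ 2)) / 2 = sin (pi * `|t|) ^+ 2.
  by rewrite cos_mulr2n; have := cos2Dsin2 (pi * `|t|); lra.
by rewrite ler_pXn2r ?nnegrE ?h//; exact: le_trans (h isT).
Qed.

Let real_lipschitz (g : T -> R) (B : R) (x h : T) :
  (forall y, differentiable g y) ->
  (forall i y, `|'D_(delta_mx ord0 i) g y| <= B) ->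
  `|g (x + h) - g x| <= B * \sum_i `|h ord0 i|.
Proof.
move=> dg gB.
have dgh y : is_derive y h g ('d g y h).
  by apply: DeriveDef; [exact: diff_derivable|exact: deriveE].
pose phi (t : R) : T := t *: h + x.
have dphi (t : R) : is_derive t (1 : R) (g \o phi) ('d g (phi t) h).
  apply: (@is_derive_shift _ _ _ g phi t 1 h) => // s.
  by rewrite /phi scalerDl addrA /GRing.scale/= mulr1.
have [c _ E] : exists2 c : R, c \in `[0, 1] &
    (g \o phi) 1 - (g \o phi) 0 = 'd g (phi c) h * (1 - 0).
  apply: (@MVT_segment _ (g \o phi) (fun t => 'd g (phi t) h)) => //.
  apply: continuous_subspaceT => t; apply: differentiable_continuous.
  by apply/derivable1_diffP; case: (dphi t).
move: E; rewrite /= /phi scale1r scale0r add0r addrC subr0 mulr1 addrC [h + x]addrC => ->.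
have dsum (y : T) : 'd g y h = \sum_i h ord0 i * 'd g y (delta_mx ord0 i).
  rewrite {1}(row_sum_delta h) linear_sum; apply: eq_bigr => i _.
  by rewrite linearZ.
rewrite dsum; apply: le_trans (ler_norm_sum _ _ _) _.
rewrite mulr_sumr; apply: ler_sum => i _.
by rewrite normrM mulrC ler_wpM2r// -deriveE.
Qed.

Lemma Clipschitz (f : T -> C) (B : R) (x h : T) : smooth f ->
  (forall i y, normc (partial i f y) <= B) ->
  normc (f (x + h) - f x) <= 2 * B * \sum_i `|h ord0 i|.
Proof.
move=> sf fB; apply: le_trans (normc_le_ReIm _) _.
rewrite -mulrA mulr_natl mulr2n lerD//.
- have -> : complex.Re (f (x + h) - f x) = complex.Re (f (x + h)) - complex.Re (f x).
    by case: (f (x + h)); case: (f x).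
  apply: (@real_lipschitz (fun y => complex.Re (f y))).
    by move=> y; exact: (smooth_Cdiff sf y).1.
  by move=> i y; exact: le_trans (normr_Re (partial i f y)) (fB i y).
- have -> : complex.Im (f (x + h) - f x) = complex.Im (f (x + h)) - complex.Im (f x).
    by case: (f (x + h)); case: (f x).
  apply: (@real_lipschitz (fun y => complex.Im (f y))).
    by move=> y; exact: (smooth_Cdiff sf y).2.
  by move=> i y; exact: le_trans (normr_Im (partial i f y)) (fB i y).
Qed.

(** The increment of a periodic function is controlled by the distance d to the
lattice in each coordinate.  For every threshold lam one has
d <= lam + d^2 / lam, and d^2 is dominated by a trigonometric polynomial. *)
Lemma periodic_increment (f : T -> C) (B lam : R) (x y : T) : smooth f ->
  periodic f -> (forall i y, normc (partial i f y) <= B) -> 0 <= B -> 0 < lam ->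
  normc (f y - f x) <= 2 * B *
    \sum_i (lam + (1 - complex.Re (chi (delta_mx ord0 i) (x - y))) / (2 * lam)).
Proof.
move=> sf pf fB B0 lam0.
(* m is the lattice point nearest to y - x. *)
pose m : Z := \row_i Num.floor (y ord0 i - x ord0 i + 1 / 2).
pose h : T := y - x - map_mx intr m.
have hi i : `|h ord0 i| <= 1 / 2.
  rewrite !mxE; set t := y ord0 i - x ord0 i + 1 / 2.
  have := ge_floor t; have := floorD1_gt t; rewrite intrD => h1 h2.
  rewrite ler_norml; rewrite /t in h1 h2 *; apply/andP; split; lra.
have -> : f y = f (x + h).
  by rewrite -(pf (x + h) m) /h; congr f; apply/rowP => j; rewrite !mxE; lra.
apply: le_trans (Clipschitz _ _ sf fB) _.
rewrite ler_wpM2l ?mulr_ge0//; apply: ler_sum => i _.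
have -> : complex.Re (chi (delta_mx ord0 i) (x - y)) = cos (2 * pi * h ord0 i).
  have -> : x - y = - h + map_mx intr (- m).
    by apply/rowP => j; rewrite !mxE; lra.
  rewrite periodic_chi chi_opp chiN Re_conj /chi /expi2pi/=.
  congr (cos (_ * _)); rewrite /dot (bigD1 i)//= big1 ?addr0.
    by rewrite [delta_mx _ _ _ _]mxE !eqxx mulr1.
  by move=> j ji; rewrite [delta_mx _ _ _ _]mxE (negbTE ji) andbF mulr0.
have := sqr_le_1Bcos (hi i); set c := cos _ => hc.
have hc' : h ord0 i ^+ 2 / lam <= (1 - c) / (2 * lam).
  by rewrite invfM mulrA ler_wpM2r// invr_ge0 ltW.
apply: le_trans (_ : lam + h ord0 i ^+ 2 / lam <= _); last by rewrite lerD2l.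
have [le|/ltW lt] := leP `|h ord0 i| lam.
  by rewrite ler_wpDr// mulr_ge0 ?sqr_ge0// invr_ge0 ltW.
apply: ler_wpDl; first exact: ltW.
rewrite ler_pdivlMr// -real_normK ?num_real// expr2.
by rewrite ler_wpM2l.
Qed.

End lipschitz.

Section fejer.
Context {R : realType} {n : nat}.
Local Notation Z := 'rV[int]_n.
Local Notation T := 'rV[R]_n.
Local Notation C := R[i].
Local Notation periodic := Defs.periodic.
Local Notation mu := (@haar R n).
Variable r : nat.
Local Notation q := r.+1.
Local Notation J := {ffun 'I_n -> 'I_q}.
Local Notation M := (#|{: J}|%:R).

Let z (a : J) : Z := \row_i (a i : nat)%:Z.
Let dz (p : J * J) : Z := z p.1 - z p.2.

Let z_inj : injective z.
Proof.
by move=> a b /rowP ab; apply/ffunP => i; apply/val_inj; have := ab i; rewrite !mxE => -[].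
Qed.

Let M0 : M != 0 :> C.
Proof. by rewrite pnatr_eq0 -lt0n; apply/card_gt0P; exists [ffun=> ord0]. Qed.

(** The Fejer kernel of the box, a normalized squared modulus. *)
Let K (x : T) : C := M^-1 * \sum_p chi (dz p) x.

Let kernelE x : K x = ((M^-1 * normc (\sum_a chi (z a) x) ^+ 2)%:C)%C.
Proof.
rewrite rmorphM/= -mulr_conj fmorphV rmorph_nat; congr (_ * _).
rewrite rmorph_sum/= mulr_suml -(pair_bigA _ (fun a b => chi (z a - z b) x))/=.
apply: eq_bigr => a _; rewrite mulr_sumr; apply: eq_bigr => b _.
by rewrite chiD chiN.
Qed.

Let kernel_ge0 x : 0 <= complex.Re (K x).
Proof. by rewrite kernelE/= mulr_ge0 ?invr_ge0 ?ler0n// sqr_ge0. Qed.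

Let ImK x : complex.Im (K x) = 0.
Proof. by rewrite kernelE. Qed.

Let normK x : normc (K x) = complex.Re (K x).
Proof. by move: (kernel_ge0 x); rewrite kernelE normc_real => h; exact: ger0_norm. Qed.

Let chi_refl (l : Z) (x y : T) : chi l (x - y) = chi l x * chi (- l) y.
Proof. by rewrite chi_shift chi_opp. Qed.

Let iKchi (l : Z) x : Cintegrable mu (fun y => K (x - y) * chi l (x - y)) /\
  Cintegral mu (fun y => K (x - y) * chi l (x - y)) =
  M^-1 * \sum_p ((dz p + l == 0)%:R : C).
Proof.
have E y : K (x - y) * chi l (x - y) =
    M^-1 * \sum_p (chi (dz p + l) x * chi (- (dz p + l)) y).
  rewrite /K -mulrA mulr_suml; congr (_ * _); apply: eq_bigr => p _.
  by rewrite -chiD chi_refl.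
have i1 p : Cintegrable mu (fun y => chi (dz p + l) x * chi (- (dz p + l)) y).
  by apply: CintegrableZ; exact: Cintegrable_chi.
have i2 := Cintegrable_sum (index_enum _) i1.
split; first by under eq_fun do rewrite E; exact: CintegrableZ.
rewrite (eq_Cintegral _ E) CintegralZ// Cintegral_sum//; congr (_ * _).
apply: eq_bigr => p _; rewrite CintegralZ; last exact: Cintegrable_chi.
rewrite Cintegral_chi oppr_eq0; case: eqP => [->|_]; last by rewrite mulr0.
by rewrite chi0 mulr1.
Qed.

Let iK x : Cintegrable mu (fun y => K (x - y)) /\
  Cintegral mu (fun y => K (x - y)) = 1.
Proof.
have [i1 e1] := iKchi 0 x.
have E y : K (x - y) * chi 0 (x - y) = K (x - y) by rewrite chi0 mulr1.
split; first by rewrite (_ : (fun y => _) = (fun y => K (x - y) * chi 0 (x - y)))//; apply/funext => y; rewrite E.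
rewrite -(eq_Cintegral _ E) e1 -(pair_bigA _ (fun a b => (dz (a, b) + 0 == 0)%:R))/=.
rewrite (eq_bigr (fun=> 1)) ?sumr_const ?mulVf// => a _.
rewrite (bigD1 a)//= /dz subrr addr0 eqxx big1 ?addr0// => b ba.
by rewrite addr0 subr_eq0 (inj_eq z_inj) eq_sym (negbTE ba).
Qed.

(** A fraction 1 / q of the points of the box lies on its last face. *)
Let card_last i : (q * \sum_(a : J) (a i == ord_max) = #|{: J}|)%N.
Proof.
pose F (j : 'I_n) (k : 'I_q) : nat := if j == i then k == ord_max : nat else 1%N.
have -> : (\sum_(a : J) (a i == ord_max) = \sum_(a : J) \prod_j F j (a j))%N.
  apply: eq_bigr => a _; rewrite (bigD1 i)//= /F eqxx big1 ?muln1// => j /negbTE ->.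
  by [].
rewrite -(bigA_distr_bigA F) (bigD1 i)//= /F eqxx.
rewrite (bigD1 ord_max)//= eqxx big1 ?addn0 ?mul1n; last by move=> k /negbTE ->.
have -> : #|{: J}| = (\prod_(j < n) q)%N.
  by rewrite card_ffun !card_ord prod_nat_const card_ord.
rewrite [RHS](bigD1 i)//=.
congr (_ * _)%N; apply: eq_bigr => j /negbTE ->.
by rewrite sum_nat_const card_ord muln1.
Qed.

(** The translate of a point of the box by a basis vector leaves the box exactly
when the point lies on the last face. *)
Let shifted_pairs i : (\sum_(p : J * J) (dz p + delta_mx ord0 i == 0%R)%:R : C) =
  M - M / q%:R.
Proof.
have shiftE (a : J) : \sum_b ((dz (a, b) + delta_mx ord0 i == 0)%:R : C) =
    1 - (a i == ord_max)%:R.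
  have zab b : (dz (a, b) + delta_mx ord0 i == 0) = (z b == z a + delta_mx ord0 i).
    by rewrite /dz/= addrAC subr_eq0 eq_sym.
  have [am|am] := eqVneq (a i) ord_max.
    rewrite subrr big1// => b _; rewrite zab; case: eqP => // /rowP/(_ i).
    rewrite !mxE !eqxx am /= => /eqP; rewrite -PoszD eqz_nat => /eqP E.
    by have := ltn_ord (b i); rewrite E addn1 ltnn.
  have ai : ((a i).+1 < q)%N.
    by have := ltn_ord (a i); rewrite ltnS leq_eqVlt => /predU1P[E|//]; case/eqP: am; exact: val_inj.
  pose b : J := [ffun j => if j == i then Ordinal ai else a j].
  have bE : z b = z a + delta_mx ord0 i.
    apply/rowP => j; rewrite !mxE ffunE; case: eqVneq => [->|_] /=.
      by rewrite -PoszD addn1.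
    by rewrite addr0.
  rewrite subr0 (bigD1 b)//= zab bE eqxx big1 ?addr0// => c cb.
  by rewrite zab -bE (inj_eq z_inj) (negbTE cb).
rewrite -(pair_bigA _ (fun a b => (dz (a, b) + delta_mx ord0 i == 0)%:R))/=.
under eq_bigr do rewrite shiftE.
rewrite sumrB sumr_const; congr (_ - _).
rewrite -(card_last i) natrM mulrAC mulfV ?pnatr_eq0// mul1r.
by rewrite natr_sum.
Qed.

Definition fejer (f : T -> C) (x : T) : C :=
  M^-1 * \sum_p fourier f (dz p) * chi (dz p) x.

Lemma fejer_trigpoly f : exists tp, fejer f = trigpoly tp.
Proof.
exists [seq (M^-1 * fourier f (dz p), dz p) | p <- index_enum _].
apply/funext => x; rewrite /fejer /trigpoly big_map mulr_sumr.
by apply: eq_bigr => p _; rewrite mulrA.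
Qed.

Lemma partial_fejer i f (B : R) : smooth f -> periodic f ->
  partials_bounded 1 f B -> partial i (fejer f) = fejer (partial i f).
Proof.
move=> sf pf fB; apply: CderivE; apply: CderivZ.
apply: Cderiv_sum => p.
apply: (Cderiv_eq (CderivZ (fourier f (dz p)) (Cderiv_chi i (dz p)))) => x.
by rewrite (fourier_partial _ _ sf pf fB); ring.
Qed.

(** Convolution with the kernel averages the increments of f.  They are controlled
by the functions 1 - Re chi_i, with chi_i the character of the i-th basis vector,
and these have integral 1 / q against the kernel by shifted_pairs. *)
Lemma fejer_approx f (B lam : R) x : smooth f -> periodic f ->
  partials_bounded 1 f B -> 0 < lam ->
  normc (fejer f x - f x) <= 2 * B * (n%:R * (lam + 1 / (2 * q%:R * lam))).
Proof.
move=> sf pf fB lam0.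
have mf := Cdiff_measurable (smooth_Cdiff sf).
have f0 y : normc (f y) <= B := fB [::] y isT.
have fK y : f y * K (x - y) = M^-1 * \sum_p (chi (dz p) x * (f y * chi (- dz p) y)).
  rewrite /K mulrCA mulr_sumr; congr (_ * _); apply: eq_bigr => p _.
  by rewrite chi_refl; ring.
have i1 p : Cintegrable mu (fun y => chi (dz p) x * (f y * chi (- dz p) y)).
  by apply: CintegrableZ; exact: fourier_integrable f0.
have ifK : Cintegrable mu (fun y => f y * K (x - y)).
  by under eq_fun do rewrite fK; apply: CintegrableZ; exact: Cintegrable_sum.
have ifxK : Cintegrable mu (fun y => - f x * K (x - y)).
  by apply: CintegrableZ; exact: (iK x).1.
have -> : fejer f x - f x = Cintegral mu (fun y => (f y - f x) * K (x - y)).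
  under eq_Cintegral do rewrite mulrBl -mulNr.
  rewrite CintegralD// CintegralZ ?(iK x).2 ?mulr1; last exact: (iK x).1.
  congr (_ - _); rewrite (eq_Cintegral _ fK) CintegralZ; last exact: Cintegrable_sum.
  rewrite Cintegral_sum// /fejer; congr (_ * _); apply: eq_bigr => p _.
  by rewrite [LHS]mulrC; apply/esym/CintegralZ; exact: fourier_integrable f0.
(* The real part of w i is the i-th term of periodic_increment, times the kernel. *)
pose w i y : C := ((lam + 1 / (2 * lam))%:C)%C * K (x - y) -
  ((1 / (2 * lam))%:C)%C * (K (x - y) * chi (delta_mx ord0 i) (x - y)).
have iw i : Cintegrable mu (w i).
  apply: CintegrableD; first by apply: CintegrableZ; exact: (iK x).1.
  under eq_fun do rewrite -mulNr.
  by apply: CintegrableZ; exact: (iKchi _ x).1.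
have wE i : Cintegral mu (w i) = ((lam + 1 / (2 * q%:R * lam))%:C)%C.
  rewrite /w; under eq_Cintegral do rewrite -mulNr.
  have [h1 h2] := iK x; have [h3 h4] := iKchi (delta_mx ord0 i) x.
  rewrite CintegralD; [|exact: CintegrableZ|exact: CintegrableZ].
  rewrite (CintegralZ _ h1) (CintegralZ _ h3) h2 h4 shifted_pairs mulr1 mulrBr mulVf// mulKf//.
  rewrite (_ : q%:R^-1 = (q%:R^-1)%:C%C); last by rewrite fmorphV rmorph_nat.
  rewrite -(rmorph1 (real_complex R)) -rmorphB -rmorphN -rmorphM -rmorphD; congr (_%:C)%C.
  have q0 : q%:R != 0 :> R by rewrite pnatr_eq0.
  by move: (q%:R : R) q0 => c c0; field; rewrite ?c0 ?lt0r_neq0.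
pose W y := ((2 * B)%:C)%C * \sum_i w i y.
have iW : Cintegrable mu W by apply: CintegrableZ; exact: Cintegrable_sum.
have WE : Cintegral mu W = ((2 * B * (n%:R * (lam + 1 / (2 * q%:R * lam))))%:C)%C.
  rewrite CintegralZ ?Cintegral_sum//; last exact: Cintegrable_sum.
  rewrite (eq_bigr _ (fun i _ => wE i)) sumr_const card_ord -rmorphMn -rmorphM.
  by congr (_%:C)%C; rewrite -[_ *+ n]mulr_natl.
have le y : normc ((f y - f x) * K (x - y)) <= complex.Re (W y).
  have -> : complex.Re (W y) = 2 * B *
      (\sum_i (lam + (1 - complex.Re (chi (delta_mx ord0 i) (x - y))) / (2 * lam))) *
      complex.Re (K (x - y)).
    rewrite /W [LHS]ReM [complex.Re (_%:C)%C]/= [complex.Im (_%:C)%C]/= mul0r subr0.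
    rewrite -[RHS]mulrA; congr (_ * _).
    rewrite mulr_suml (_ : complex.Re (\sum_i w i y) = \sum_i complex.Re (w i y)); last first.
      by elim/big_ind2 : _ => // a b c d <- <-; rewrite ReD.
    apply: eq_bigr => i _; rewrite /w /chi /expi2pi.
    by move: (ImK (x - y)); case: (K (x - y)) => k1 k2 /= ->; ring.
  rewrite normcM normK.
  rewrite ler_wpM2r//; apply: periodic_increment => //.
    by move=> i y'; exact: (fB [:: i]).
  exact: partials_bounded_ge0 fB.
have ig : Cintegrable mu (fun y => (f y - f x) * K (x - y)).
  by under eq_fun do rewrite mulrBl -mulNr; exact: CintegrableD.
have : ((normc (Cintegral mu (fun y => (f y - f x) * K (x - y))))%:E <=
    (complex.Re (Cintegral mu W))%:E)%E.
  apply: le_trans (normc_Cintegral ig) _.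
  rewrite /Cintegral [complex.Re _]/= /Rintegral fineK; last exact: integrable_fin_num iW.1.
  apply: ge0_le_integral => //.
  - by move=> y _; rewrite lee_fin normc_ge0.
  - by apply: emeasurable_normc; exact: Cintegrable_meas ig.
  - by have /integrableP[] := iW.1.
  - by move=> y _; rewrite lee_fin.
by rewrite lee_fin WE.
Qed.

End fejer.

Section density.
Context {R : realType} {n : nat}.
Local Notation T := 'rV[R]_n.
Local Notation C := R[i].
Local Notation periodic := Defs.periodic.

Let partials_fejer r s f (B : R) : smooth f -> periodic f ->
  partials_bounded (size s) f B ->
  partials s (fejer r f) = fejer r (partials s f) :> (T -> C).
Proof.
move=> sf pf; elim/last_ind: s f sf pf => [//|s i IH] f sf pf.
rewrite size_rcons => fB; rewrite !partials_rcons.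
rewrite (partial_fejer _ _ sf pf (partials_boundedW _ fB))// IH//.
- exact: smooth_partial.
- exact: periodic_partial.
- exact: partials_bounded_partial.
Qed.

(** The order depends on f only through the bound B, so that one order serves
all derivatives of f at once. *)
Lemma fejer_uniform (B eps : R) : 0 <= B -> 0 < eps -> exists r,
  forall f : T -> C, smooth f -> periodic f -> partials_bounded 1 f B ->
  forall x, normc (fejer r f x - f x) <= eps.
Proof.
move=> B0 eps0; pose D := 2 * (B + 1) * (n%:R + 1).
have B1 : 0 < B + 1 by lra.
have n1 : 0 < n%:R + 1 :> R by rewrite ltr_wpDl.
have D0 : 0 < D by rewrite !mulr_gt0.
pose lam := eps / (2 * D).
have lam0 : 0 < lam by rewrite divr_gt0// mulr_gt0.
have [r rlam] : exists r : nat, 1 / (2 * r.+1%:R * lam) <= lam.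
  pose x := (2 * lam ^+ 2)^-1.
  have x0 : 0 <= x by rewrite invr_ge0 mulr_ge0// sqr_ge0.
  exists (Num.truncn x); have := truncnS_gt x => xr.
  have r0 : 0 < (Num.truncn x).+1%:R :> R by rewrite ltr0n.
  have L0 : 0 < 2 * lam ^+ 2 by rewrite mulr_gt0// exprn_gt0.
  have h : 1 <= (Num.truncn x).+1%:R * (2 * lam ^+ 2).
    rewrite [leLHS](_ : 1 = x * (2 * lam ^+ 2)).
      by rewrite ler_wpM2r// ltW.
    by rewrite mulVf// lt0r_neq0.
  have P0 : 0 < 2 * (Num.truncn x).+1%:R * lam := mulr_gt0 (mulr_gt0 (ltr0Sn R 1) r0) lam0.
  rewrite ler_pdivrMr//; move: h; set t := _%:R => h.
  by apply: le_trans h _; rewrite le_eqVlt; apply/orP; left; apply/eqP; ring.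
exists r => f sf pf fB x.
apply: le_trans (fejer_approx r x sf pf fB lam0) _.
have c0 : 0 <= 1 / (2 * r.+1%:R * lam).
  by apply: divr_ge0 => //; apply: mulr_ge0; [exact: mulr_ge0|exact: ltW].
move: c0 rlam; set c := 1 / _ => c0 clam.
have X0 : 0 <= n%:R * (lam + c) by rewrite mulr_ge0// addr_ge0// ltW.
have h : n%:R * (lam + c) <= (n%:R + 1) * (2 * lam).
  by have : 0 <= n%:R * (lam - c) by [rewrite mulr_ge0// subr_ge0]; lra.
apply: le_trans (_ : 2 * (B + 1) * ((n%:R + 1) * (2 * lam)) <= _).
  move: X0 h; set X := n%:R * _; set Y := _ * (2 * lam) => X0 XY.
  by have : 0 <= B * (Y - X) by [rewrite mulr_ge0// subr_ge0]; lra.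
rewrite mulrA -/D /lam le_eqVlt; apply/orP; left; apply/eqP.
by field; rewrite lt0r_neq0.
Qed.

(** Fejer sums commute with partial derivatives, so the uniform convergence
for each of them is one and the same statement. *)
Lemma trigonometric_density (f : T -> C) (N : nat) (B eps : R) :
  smooth f -> periodic f -> partials_bounded N.+1 f B -> 0 < eps ->
  exists tp, partials_bounded N (fun x => f x - trigpoly tp x) eps.
Proof.
move=> sf pf fB eps0.
have [r rP] := fejer_uniform (partials_bounded_ge0 fB) eps0.
have [tp tpE] := fejer_trigpoly r f; exists tp => s x sN; rewrite -tpE.
have sfj : smooth (fejer r f) by rewrite tpE; exact: smooth_trigpoly.
have E : (fun x => f x - fejer r f x) = (fun x => f x + -1 * fejer r f x).
  by apply/funext => y; rewrite mulN1r.
rewrite {}E partialsD// ?(partialsZ s (-1) sfj)//; last exact: smoothZ.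
rewrite mulN1r normcB.
have fs : partials_bounded (size s) f B by exact: (partials_boundedW (leqW sN)).
rewrite (partials_fejer _ sf pf fs); apply: rP.
- exact: smooth_partials.
- by elim: (s) => //= i s' IH; apply: periodic_partial => //; exact: smooth_partials.
- move=> s' y s1; rewrite /partials -foldr_cat; apply: fB.
  by rewrite size_cat -addn1 addnC leq_add.
Qed.

(** Its Fejer sums vanish and converge to f. *)
Lemma fourier_eq0 (f : T -> C) (B : R) x : smooth f -> periodic f ->
  partials_bounded 1 f B -> (forall l, fourier f l = 0) -> f x = 0.
Proof.
move=> sf pf fB f0; apply/eqP; rewrite -normc_eq0 eq_le normc_ge0 andbT.
apply/ler_addgt0Pl => e e0; rewrite addr0.
have [r rP] := fejer_uniform (partials_bounded_ge0 fB) e0.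
have := rP f sf pf fB x; rewrite /fejer big1 ?mulr0 ?sub0r ?normcN// => p _.
by rewrite f0 mul0r.
Qed.

End density.

(** * Test functions and tempered functionals *)

Section weights.
Context {R : realType} {n : nat}.
Local Notation Z := 'rV[int]_n.
Local Notation w := (@weight R n).

Lemma weight_ge1 (k : Z) : 1 <= w k.
Proof. by rewrite /weight lerDl sumr_ge0. Qed.

Lemma weight_gt0 (k : Z) : 0 < w k.
Proof. exact: lt_le_trans ltr01 (weight_ge1 k). Qed.

Lemma weightX_gt0 (k : Z) N : 0 < w k ^+ N.
Proof. by rewrite exprn_gt0// weight_gt0. Qed.

Lemma weightD (k l : Z) : w (k + l) <= w k * w l.
Proof.
apply: le_trans (_ : 1 + (\sum_i `|(k ord0 i)%:~R| + \sum_i `|(l ord0 i)%:~R|) <= _).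
  rewrite lerD2l -big_split/=; apply: ler_sum => i _.
  by rewrite mxE intrD ler_normD.
rewrite /weight; set x := \sum_i _; set y := \sum_i _.
have x0 : 0 <= x by apply: sumr_ge0.
have y0 : 0 <= y by apply: sumr_ge0.
by have := mulr_ge0 x0 y0; lra.
Qed.

(** The cubes exhaust the lattice. *)
Definition cube (M : nat) : seq Z :=
  [seq \row_i ((f i : nat)%:Z - M%:Z) | f : {ffun 'I_n -> 'I_(M + M).+1}].

Lemma cube_uniq M : uniq (cube M).
Proof.
rewrite map_inj_uniq ?enum_uniq// => f g /rowP fg; apply/ffunP => i; apply: val_inj.
by have := fg i; rewrite !mxE => /addIr[].
Qed.

Lemma mem_cube M (k : Z) : (forall i, `|k ord0 i| <= M%:Z) -> k \in cube M.
Proof.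
move=> kM; pose f : {ffun 'I_n -> 'I_(M + M).+1} := [ffun i => inord (absz (k ord0 i + M%:Z))].
apply/mapP; exists f; first exact: mem_enum.
apply/rowP => i; rewrite !mxE ffunE.
have := kM i; set a := k ord0 i => aM.
have aM0 : 0 <= a + M%:Z by lia.
rewrite inordK; last by lia.
by rewrite gez0_abs// addrK.
Qed.

Lemma weight_le_cube (k : Z) (W : R) : w k <= W -> k \in cube (Num.truncn W).
Proof.
move=> kW; apply: mem_cube => i.
have W0 : 0 <= W by apply: le_trans kW; exact: ltW (weight_gt0 k).
have kiW : `|(k ord0 i)%:~R| <= W :> R.
  apply: le_trans kW; rewrite /weight (bigD1 i)//= addrCA lerDl.
  by rewrite addr_ge0// sumr_ge0.
have : `|(k ord0 i)%:~R| < (Num.truncn W).+1%:R :> R.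
  by apply: le_lt_trans kiW _; exact: truncnS_gt.
by rewrite -intr_norm (_ : _.+1%:R = (Posz (Num.truncn W).+1)%:~R)// ltr_int; lia.
Qed.

(** A bounded function whose increments dominate the inverse squares up to a factor
2, which makes the majorant of their sum telescope. *)
Let h (a : int) : R := a%:~R / (1 + `|a%:~R|).

Let inv_sq_le (a : int) : ((1 + `|a%:~R|) ^+ 2)^-1 <= 2 * (h (a + 1) - h a).
Proof.
rewrite /h; case: a => m.
  have -> : `|(Posz m + 1)%:~R| = m%:R + 1 :> R.
    by rewrite -PoszD addn1 -[X in `|X|]/(m.+1%:R : R) -natr1 ger0_norm// addr_ge0.
  have -> : `|(Posz m)%:~R| = m%:R :> R by rewrite ger0_norm.
  rewrite intrD; have := ler0n R m; rewrite -[(Posz m)%:~R]/(m%:R).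
  move: (m%:R : R) => x x0.
  have -> : 2 * ((x + 1) / (1 + (x + 1)) - x / (1 + x)) = 2 * ((x + 1) * (x + 2))^-1.
    by field; apply/andP; split; rewrite gt_eqF//; lra.
  have -> : ((1 + x) ^+ 2)^-1 = 2 * ((x + 1) * (2 * (x + 1)))^-1.
    by field; rewrite gt_eqF//; lra.
  rewrite ler_pM2l// lef_pV2 ?posrE; [|nra|nra].
  by rewrite ler_pM2l; lra.
have -> : (Negz m + 1)%:~R = - m%:R :> R.
  by rewrite NegzE intrD mulrNz -[(m.+1)%:~R]/(m.+1%:R) -natr1; lra.
have -> : (Negz m)%:~R = - (m%:R + 1) :> R.
  by rewrite NegzE mulrNz -[(m.+1)%:~R]/(m.+1%:R) -natr1.
rewrite !normrN ger0_norm ?ler0n//; have := ler0n R m; move: (m%:R : R) => x x0.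
rewrite ger0_norm; last by lra.
have -> : 2 * (- x / (1 + x) - - (x + 1) / (1 + (x + 1))) = 2 * ((x + 1) * (x + 2))^-1.
  by field; apply/andP; split; rewrite gt_eqF//; lra.
have -> : ((1 + (x + 1)) ^+ 2)^-1 = ((x + 2) * (x + 2))^-1 by congr (_^-1); ring.
apply: (@le_trans _ _ ((x + 1) * (x + 2))^-1).
  by rewrite lef_pV2 ?posrE; nra.
by rewrite -[leLHS]mul1r; apply: ler_wpM2r; [rewrite invr_ge0; nra|lra].
Qed.

Let h_bound a : `|h a| <= 1.
Proof.
have d0 : 0 < 1 + `|a%:~R| :> R by rewrite ltr_wpDr.
by rewrite /h normrM normfV (gtr0_norm d0) ler_pdivrMr//; lra.
Qed.

Let sum_inv_sq M :
  \sum_(c < (M + M).+1) ((1 + `|((c : nat)%:Z - M%:Z)%:~R|) ^+ 2)^-1 <= 4 :> R.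
Proof.
pose H (c : nat) : R := h (c%:Z - M%:Z).
apply: (@le_trans _ _ (\sum_(c < (M + M).+1) 2 * (H c.+1 - H c))).
  apply: ler_sum => c _; apply: le_trans (inv_sq_le _) _.
  rewrite /H (_ : (c.+1)%:Z - M%:Z = c%:Z - M%:Z + 1)//; lia.
rewrite -mulr_sumr -(big_mkord xpredT (fun c => H c.+1 - H c)) telescope_sumr//.
have := h_bound (((M + M).+1)%:Z - M%:Z); have := h_bound (0%:Z - M%:Z).
by rewrite !ler_norml /H => /andP[? ?] /andP[? ?]; lra.
Qed.

Let weight_prod (k : Z) : (w k ^+ (n + n))^-1 <= \prod_i ((1 + `|(k ord0 i)%:~R|) ^+ 2)^-1.
Proof.
rewrite [X in _ <= X]prodfV lef_pV2 ?posrE ?weightX_gt0//; last first.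
  by apply: prodr_gt0 => i _; rewrite exprn_gt0// ltr_wpDr.
apply: (@le_trans _ _ (\prod_(i < n) w k ^+ 2)).
  apply: ler_prod => i _; rewrite exprn_ge0 ?addr_ge0//=.
  rewrite ler_pXn2r// ?nnegrE; last 2 first.
  - exact: addr_ge0.
  - exact: ltW (weight_gt0 k).
  by rewrite /weight lerD2l (bigD1 i)//= lerDl sumr_ge0.
by rewrite prodr_const card_ord -exprM mul2n addnn.
Qed.

(** The n-fold product of the inverse squares of 1 + |k_i| dominates
weight^-(2n), and its sum over a cube is a product of one-dimensional sums, each at
most 4. *)
Lemma weight_summable :
  (\int[@counting Z R]_k ((w k ^+ (n + n))^-1)%:E <= (4 ^+ n)%:E)%E.
Proof.
apply: integral_counting_le => [k|s us]; first by rewrite lee_fin invr_ge0 ltW// weightX_gt0.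
have [M sM] : exists M, {subset s <= cube M}.
  elim: s us => [|k s IH]; first by exists 0%N.
  move=> /=/andP[_ /IH[M sM]].
  have [M' [MM' kM']] : exists M', (M <= M')%N /\ forall i, (absz (k ord0 i) <= M')%N.
    exists (maxn M (\max_i absz (k ord0 i))%N); split; first exact: leq_maxl.
    by move=> i; rewrite leq_max; apply/orP; right; apply: (leq_bigmax i).
  exists M' => l; rewrite inE => /predU1P[->|/sM].
    by apply: mem_cube => i; have := kM' i; lia.
  move=> /mapP[f _ ->]; apply: mem_cube => i; rewrite mxE.
  by have := ltn_ord (f i); move: (f i : nat) => c; lia.
rewrite sumEFin lee_fin.
apply: (@le_trans _ _ (\sum_(k <- cube M) (w k ^+ (n + n))^-1)).
  have ps : perm_eq [seq x <- cube M | x \in s] s.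
    apply: uniq_perm => //; first exact/filter_uniq/cube_uniq.
    by move=> k; rewrite mem_filter; apply: andb_idr => /sM.
  rewrite -(perm_big _ ps)/= big_filter [leRHS](bigID (mem s))/= lerDl; apply: sumr_ge0 => k _.
  by rewrite invr_ge0 ltW// weightX_gt0.
apply: (@le_trans _ _ (\sum_(k <- cube M) \prod_i ((1 + `|(k ord0 i)%:~R|) ^+ 2)^-1)).
  by apply: ler_sum => k _; exact: weight_prod.
rewrite /cube big_map big_enum/=.
under eq_bigr => f _ do under eq_bigr => i _ do rewrite mxE.
rewrite -(bigA_distr_bigA (fun (i : 'I_n) (c : 'I_(M + M).+1) =>
  ((1 + `|((c : nat)%:Z - M%:Z)%:~R|) ^+ 2)^-1)).
have -> : 4 ^+ n = \prod_(i < n) 4 :> R by rewrite prodr_const card_ord.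
apply: ler_prod => i _; rewrite sum_inv_sq andbT; apply: sumr_ge0 => c _.
by rewrite invr_ge0 exprn_ge0// addr_ge0.
Qed.

End weights.

Section test_function_space.
Context {R : realType} {n : nat}.
Local Notation Z := 'rV[int]_n.
Local Notation T := 'rV[R]_n.
Local Notation C := R[i].
Local Notation periodic := Defs.periodic.
Implicit Types (phi psi : Z * T -> C) (f g : T -> C).

(** The seminorm of order N, handled through its real upper bounds. *)
Definition schwartz_bounded N phi (B : R) :=
  forall j, partials_bounded N (fun y => phi (j, y)) (B / weight j ^+ N).

Lemma schwartz_bounded_ge0 N phi B : schwartz_bounded N phi B -> 0 <= B.
Proof.
by move=> /(_ 0)/partials_bounded_ge0; rewrite pmulr_lge0// invr_gt0 weightX_gt0.
Qed.

Lemma seminormZT_le N phi B : schwartz_bounded N phi B ->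
  (seminormZT N phi <= B%:E)%E.
Proof.
move=> h; apply: ge_ereal_sup => _ [j [x [s [sN ->]]]].
by rewrite lee_fin mulrC -ler_pdivlMr ?weightX_gt0//; exact: h.
Qed.

Lemma seminormZT_bounded N phi : (seminormZT N phi < +oo)%E ->
  exists B, schwartz_bounded N phi B.
Proof.
move=> h; exists (fine (seminormZT N phi)) => j s x sN.
have le : ((weight j ^+ N * normc (partials s (fun y => phi (j, y)) x))%:E <=
    seminormZT N phi)%E.
  by apply: ereal_sup_ubound; exists j, x, s.
rewrite ler_pdivlMr ?weightX_gt0// mulrC -lee_fin fineK//.
rewrite fin_numE (lt_eqF h) andbT; apply/eqP => h'.
by rewrite h' in le.
Qed.

Lemma schwartzZTP phi : schwartzZT phi <->
  [/\ forall j, periodic (fun y => phi (j, y)), forall j, smooth (fun y => phi (j, y)) &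
      forall N, exists B, schwartz_bounded N phi B].
Proof.
split=> [[p [s b]]|[p s b]]; first by split=> // N; exact/seminormZT_bounded/b.
split=> //; split=> // N; have [B] := b N.
by move=> /seminormZT_le h; exact: le_lt_trans h (ltry _).
Qed.

Lemma schwartz_smooth phi j : schwartzZT phi -> smooth (fun y => phi (j, y)).
Proof. by move=> /schwartzZTP[]. Qed.

Lemma schwartz_periodic phi j : schwartzZT phi -> periodic (fun y => phi (j, y)).
Proof. by move=> /schwartzZTP[]. Qed.

Lemma schwartz_bound phi N : schwartzZT phi -> exists B, schwartz_bounded N phi B.
Proof. by move=> /schwartzZTP[]. Qed.

Lemma schwartz_boundedD N phi psi A B : schwartzZT phi -> schwartzZT psi ->
  schwartz_bounded N phi A -> schwartz_bounded N psi B ->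
  schwartz_bounded N (fun y => phi y + psi y) (A + B).
Proof.
move=> sphi spsi bA bB j; rewrite mulrDl.
by apply: partials_boundedD; rewrite //; exact: schwartz_smooth.
Qed.

Lemma schwartz_boundedZ N (c : C) phi A : schwartzZT phi ->
  schwartz_bounded N phi A -> schwartz_bounded N (fun y => c * phi y) (normc c * A).
Proof.
move=> sphi bA j; rewrite -mulrA.
by apply: (@partials_boundedZ _ _ _ c (fun y => phi (j, y))); [exact: schwartz_smooth|exact: bA].
Qed.

Lemma schwartz_boundedMZ N (g : Z -> C) phi A : (forall j, normc (g j) <= 1) ->
  schwartzZT phi -> schwartz_bounded N phi A ->
  schwartz_bounded N (fun y => g y.1 * phi y) A.
Proof.
move=> g1 sphi bA j /=.
apply: (@partials_bounded_le _ _ _ _ (normc (g j) * (A / weight j ^+ N))).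
  by rewrite ler_piMl ?normc_ge0//; exact: partials_bounded_ge0 (bA j).
by apply: (@partials_boundedZ _ _ _ (g j) (fun y => phi (j, y))); [exact: schwartz_smooth|exact: bA].
Qed.

Lemma schwartz_bounded_chi N l phi A : schwartzZT phi ->
  schwartz_bounded N phi A ->
  schwartz_bounded N (fun y => chi l y.2 * phi y) (chi_growth l ^+ N * A).
Proof.
move=> sphi bA j /=; rewrite -mulrA.
by apply: (@partials_bounded_chiM _ _ l N (fun y => phi (j, y))); [exact: schwartz_smooth|exact: bA].
Qed.

Lemma schwartz_bounded_conj N phi A : schwartzZT phi ->
  schwartz_bounded N phi A -> schwartz_bounded N (fun y => ((phi y)^*)%C) A.
Proof.
move=> sphi bA j.
by apply: (@partials_bounded_conj _ _ N (fun y => phi (j, y))); [exact: schwartz_smooth|exact: bA].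
Qed.

Lemma schwartz_bounded_shift N m w phi A : schwartzZT phi ->
  schwartz_bounded N phi A ->
  schwartz_bounded N (fun y => phi (y.1 - m, y.2 - w)) (weight m ^+ N * A).
Proof.
move=> sphi bA j /=.
apply: (@partials_bounded_le _ _ _ _ (A / weight (j - m) ^+ N)); last first.
  apply: (@partials_bounded_shift _ _ N w (fun y => phi (j - m, y))); last exact: bA.
  exact: schwartz_smooth.
rewrite ler_pdivrMr ?weightX_gt0// mulrAC ler_pdivlMr ?weightX_gt0//.
rewrite [A * _]mulrC [leRHS]mulrAC ler_wpM2r ?(schwartz_bounded_ge0 bA)//.
rewrite -exprMn; apply: lerXn2r; rewrite ?nnegrE ?mulr_ge0 ?(ltW (weight_gt0 _))//.
by rewrite -{1}(subrKC m j) weightD.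
Qed.

Lemma schwartzZT_add phi psi : schwartzZT phi -> schwartzZT psi ->
  schwartzZT (fun y => phi y + psi y).
Proof.
move=> sphi spsi; apply/schwartzZTP; split=> [j|j|N].
- by move=> x l; rewrite (schwartz_periodic j sphi) (schwartz_periodic j spsi).
- by apply: smoothD; exact: schwartz_smooth.
- have [A hA] := schwartz_bound N sphi; have [B hB] := schwartz_bound N spsi.
  by exists (A + B); exact: schwartz_boundedD.
Qed.

Lemma schwartzZT_scale (c : C) phi : schwartzZT phi -> schwartzZT (fun y => c * phi y).
Proof.
move=> sphi; apply/schwartzZTP; split=> [j|j|N].
- by move=> x l; rewrite (schwartz_periodic j sphi).
- by apply: smoothZ; exact: schwartz_smooth.
- have [A hA] := schwartz_bound N sphi.
  by exists (normc c * A); exact: schwartz_boundedZ.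
Qed.

Lemma schwartzMZ (g : Z -> C) phi : (forall j, normc (g j) <= 1) ->
  schwartzZT phi -> schwartzZT (fun y => g y.1 * phi y).
Proof.
move=> g1 sphi; apply/schwartzZTP; split=> [j|j|N].
- by move=> x l; rewrite /= (schwartz_periodic j sphi).
- exact: (smoothZ (g j) (schwartz_smooth j sphi)).
- have [A hA] := schwartz_bound N sphi.
  by exists A; exact: schwartz_boundedMZ.
Qed.

Lemma schwartz_chi l phi : schwartzZT phi -> schwartzZT (fun y => chi l y.2 * phi y).
Proof.
move=> sphi; apply/schwartzZTP; split=> [j|j|N].
- by apply: (@periodic_chiM _ _ l (fun y => phi (j, y))); exact: schwartz_periodic.
- by apply: (@smooth_chiM _ _ l (fun y => phi (j, y))); exact: schwartz_smooth.
- have [A hA] := schwartz_bound N sphi.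
  by eexists; apply: schwartz_bounded_chi hA.
Qed.

Lemma schwartz_conj phi : schwartzZT phi -> schwartzZT (fun y => ((phi y)^*)%C).
Proof.
move=> sphi; apply/schwartzZTP; split=> [j|j|N].
- by move=> x l; rewrite (schwartz_periodic j sphi).
- by apply: smooth_conj; exact: schwartz_smooth.
- have [A hA] := schwartz_bound N sphi.
  by exists A; exact: schwartz_bounded_conj.
Qed.

Lemma schwartz_shift m w phi : schwartzZT phi ->
  schwartzZT (fun y => phi (y.1 - m, y.2 - w)).
Proof.
move=> sphi; apply/schwartzZTP; split=> [j|j|N].
- by apply: (@periodic_shift _ _ w (fun y => phi (j - m, y))); exact: schwartz_periodic.
- by apply: (@smooth_shift _ _ w (fun y => phi (j - m, y))); exact: schwartz_smooth.
- have [A hA] := schwartz_bound N sphi.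
  by eexists; apply: schwartz_bounded_shift hA.
Qed.

(** The functions level j (chi k) are the test functions on which the
coefficients of a distribution are read. *)
Definition level (j : Z) f (y : Z * T) : C := (y.1 == j)%:R * f y.2.

Lemma levelE j f i y : level j f (i, y) = (i == j)%:R * f y.
Proof. by []. Qed.

Lemma schwartz_bounded_level N j f A : smooth f -> partials_bounded N f A ->
  schwartz_bounded N (level j f) (weight j ^+ N * A).
Proof.
move=> sf bA i; apply: (@partials_bounded_le _ _ _ _ (normc ((i == j)%:R : C) * A)).
  case: eqP => [->|_]; first by rewrite normc1 mul1r mulrAC mulfV ?mul1r// gt_eqF// weightX_gt0.
  rewrite normc0 mul0r !mulr_ge0 ?invr_ge0 ?(ltW (weightX_gt0 _ _))//.
  exact: partials_bounded_ge0 bA.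
exact: (partials_boundedZ ((i == j)%:R) sf bA).
Qed.

Definition schwartzT f :=
  [/\ smooth f, periodic f & forall N, exists B, partials_bounded N f B].

Lemma schwartz_level j f : schwartzT f -> schwartzZT (level j f).
Proof.
move=> [sf pf bf]; apply/schwartzZTP; split=> [i|i|N].
- by move=> x l; rewrite !levelE pf.
- exact: (smoothZ ((i == j)%:R) sf).
- have [A hA] := bf N; eexists; exact: schwartz_bounded_level hA.
Qed.

Lemma schwartzT_slice phi j : schwartzZT phi -> schwartzT (fun y => phi (j, y)).
Proof.
move=> sphi; split; [exact: schwartz_smooth|exact: schwartz_periodic|].
by move=> N; have [B hB] := schwartz_bound N sphi; eexists; exact: hB.
Qed.

Lemma partials_cst s (c : C) : exists c', partials s (fun _ : T => c) = (fun=> c') /\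
  normc c' <= normc c.
Proof.
elim: s => [|i s [c' [IH cc]]]; first by exists c.
exists 0; rewrite normc0 normc_ge0; split=> //.
by rewrite [LHS]/= IH; apply: CderivE; exact: Cderiv_cst.
Qed.

Lemma partials_bounded_cst N (c : C) : partials_bounded N (fun _ : T => c) (normc c).
Proof. by move=> s x _; have [c' [-> cc]] := partials_cst s c. Qed.

Lemma smooth_cst (c : C) : smooth (fun _ : T => c).
Proof. by move=> s; have [c' [-> _]] := partials_cst s c; exact: Cdiff_cst. Qed.

Lemma schwartzT_chi l : schwartzT (chi l).
Proof.
split; [exact: smooth_chi|exact: periodic_chi|] => N.
exists (chi_growth l ^+ N * normc (1 : C)).
rewrite (_ : chi l = fun x => chi l x * 1); last by apply/funext => x; rewrite mulr1.
by apply: partials_bounded_chiM; [exact: smooth_cst|exact: partials_bounded_cst].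
Qed.

Lemma schwartzTD f g : schwartzT f -> schwartzT g -> schwartzT (fun x => f x + g x).
Proof.
move=> [sf pf bf] [sg pg bg]; split; first exact: smoothD.
  by move=> x l; rewrite pf pg.
move=> N; have [A hA] := bf N; have [B hB] := bg N.
by exists (A + B); exact: partials_boundedD.
Qed.

Lemma schwartzTZ c f : schwartzT f -> schwartzT (fun x => c * f x).
Proof.
move=> [sf pf bf]; split; first exact: smoothZ.
  by move=> x l; rewrite pf.
by move=> N; have [A hA] := bf N; eexists; exact: partials_boundedZ hA.
Qed.

Lemma schwartzT_trigpoly tp : schwartzT (trigpoly tp).
Proof.
elim: tp => [|p tp IH].
  rewrite (_ : trigpoly _ = fun=> 0); last by apply/funext => x; rewrite /trigpoly big_nil.
  split=> //; first exact: smooth_cst.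
  by move=> N; eexists; exact: partials_bounded_cst.
rewrite (_ : trigpoly _ = fun x => p.1 * chi p.2 x + trigpoly tp x); last first.
  by apply/funext => x; rewrite /trigpoly big_cons.
by apply: schwartzTD => //; apply: schwartzTZ; exact: schwartzT_chi.
Qed.

Lemma schwartzT_chiM l f : schwartzT f -> schwartzT (fun x => chi l x * f x).
Proof.
move=> [sf pf bf]; split; [exact: smooth_chiM|exact: periodic_chiM|].
by move=> N; have [A hA] := bf N; eexists; exact: partials_bounded_chiM hA.
Qed.

Lemma schwartzT_shift w f : schwartzT f -> schwartzT (fun x => f (x - w)).
Proof.
move=> [sf pf bf]; split; [exact: smooth_shift|exact: periodic_shift|].
by move=> N; have [A hA] := bf N; eexists; exact: partials_bounded_shift hA.
Qed.

Lemma schwartz_level_chi j l : schwartzZT (level j (chi l)).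
Proof. by apply: schwartz_level; exact: schwartzT_chi. Qed.

Lemma schwartzT_density f N eps : schwartzT f -> 0 < eps ->
  exists tp, partials_bounded N (fun x => f x - trigpoly tp x) eps.
Proof.
move=> [sf pf bf] eps0; have [B hB] := bf N.+1.
exact: trigonometric_density hB eps0.
Qed.

(** Far away, the seminorm of order N + 1 gains a factor 1 / weight over the
seminorm of order N, and the weights tend to infinity. *)
Lemma schwartz_truncation phi N (eps : R) (j0 : Z) : schwartzZT phi -> 0 < eps ->
  exists A : seq Z, [/\ uniq A, j0 \in A &
    schwartz_bounded N (fun y => (y.1 \notin A)%:R * phi y) eps].
Proof.
move=> sphi eps0; have [B hB] := schwartz_bound N.+1 sphi.
have B0 := schwartz_bounded_ge0 hB.
pose W := Num.max (weight j0) (B / eps).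
have W0 : 0 < W by rewrite lt_max weight_gt0.
exists (cube (Num.truncn W)); split; first exact: cube_uniq.
  by apply: weight_le_cube; rewrite le_max lexx.
move=> j /=; have [jA|jA] := boolP (j \in cube _).
  apply: (@partials_bounded_le _ _ _ _ (normc (0 : C) * (B / weight j ^+ N.+1))).
    by rewrite normc0 mul0r divr_ge0 ?ltW// weightX_gt0.
  apply: partials_boundedZ; first exact: schwartz_smooth.
  exact: partials_boundedW (hB j).
apply: (@partials_bounded_le _ _ _ _ (normc (1 : C) * (B / weight j ^+ N.+1))); last first.
  apply: partials_boundedZ; first exact: schwartz_smooth.
  exact: partials_boundedW (hB j).
have jW : W <= weight j.
  by rewrite leNgt; apply: contra jA => /ltW /weight_le_cube.
rewrite normc1 mul1r exprS invfM mulrA ler_wpM2r ?invr_ge0 ?(ltW (weightX_gt0 _ _))//.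
rewrite ler_pdivrMr ?weight_gt0// -ler_pdivrMl// mulrC.
by apply: le_trans jW; rewrite le_max lexx orbT.
Qed.

Lemma level_decomposition phi (A : seq Z) : uniq A ->
  phi = (fun y => \sum_(j <- A) level j (fun x => phi (j, x)) y +
    (y.1 \notin A)%:R * phi y).
Proof.
move=> uA; apply/funext => -[i y] /=; have [iA|iA] := boolP (i \in A).
  rewrite (bigD1_seq i)//= levelE eqxx mul1r mul0r addr0 big1 ?addr0// => j ji.
  by rewrite levelE eq_sym (negbTE ji) mul0r.
rewrite mul1r big_seq big1 ?add0r// => j jA; rewrite levelE.
by case: eqP => [E|_]; [rewrite E jA in iA|rewrite mul0r].
Qed.

End test_function_space.

Section bounded_functionals.
Context {R : realType} {n : nat}.
Local Notation Z := 'rV[int]_n.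
Local Notation T := 'rV[R]_n.
Local Notation C := R[i].
Local Notation periodic := Defs.periodic.
Implicit Types (phi psi : Z * T -> C) (f : T -> C) (H : (Z * T -> C) -> C).

Definition linear_on_schwartz H := forall (a : C) phi psi,
  schwartzZT phi -> schwartzZT psi -> H (fun y => a * phi y + psi y) = a * H phi + H psi.

Definition bounded_by H N (K : R) := forall phi B, schwartzZT phi ->
  schwartz_bounded N phi B -> normc (H phi) <= K * B.

Lemma schwartz0 : schwartzZT (fun _ : Z * T => 0 : C).
Proof.
rewrite (_ : (fun=> 0) = fun y => 0 * level 0 (chi 0) y :> C).
  by apply: schwartzZT_scale; exact: schwartz_level_chi.
by apply/funext => y; rewrite mul0r.
Qed.

Lemma tempered_linear H : tempered schwartzZT seminormZT H -> linear_on_schwartz H.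
Proof. by move=> [lin _] a phi psi sphi spsi; exact: lin. Qed.

Section linear_functional.
Variables (H : (Z * T -> C) -> C) (Hlin : linear_on_schwartz H).

Lemma linear_on0 : H (fun _ => 0) = 0.
Proof.
have := Hlin 1 schwartz0 schwartz0.
rewrite (_ : (fun _ => 1 * 0 + 0) = fun=> 0); last by apply/funext => y; rewrite mulr0 addr0.
by rewrite mul1r => /eqP; rewrite -subr_eq subrr eq_sym => /eqP.
Qed.

Lemma linear_onD phi psi : schwartzZT phi -> schwartzZT psi ->
  H (fun y => phi y + psi y) = H phi + H psi.
Proof.
move=> sphi spsi; have := Hlin 1 sphi spsi; rewrite mul1r => <-.
by congr H; apply/funext => y; rewrite mul1r.
Qed.

Lemma linear_onZ c phi : schwartzZT phi -> H (fun y => c * phi y) = c * H phi.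
Proof.
move=> sphi; have := Hlin c sphi schwartz0; rewrite linear_on0 addr0 => <-.
by congr H; apply/funext => y; rewrite addr0.
Qed.

Lemma schwartz_sum I (s : seq I) (F : I -> Z * T -> C) :
  (forall i, schwartzZT (F i)) -> schwartzZT (fun y => \sum_(i <- s) F i y).
Proof.
move=> sF; elim: s => [|i s IH].
  rewrite (_ : (fun _ => _) = fun=> 0) ?schwartz0//; last first.
    by apply/funext => y; rewrite big_nil.
  exact: schwartz0.
rewrite (_ : (fun _ => _) = fun y => F i y + \sum_(i <- s) F i y); last first.
  by apply/funext => y; rewrite big_cons.
exact: schwartzZT_add.
Qed.

Lemma linear_on_sum I (s : seq I) (F : I -> Z * T -> C) :
  (forall i, schwartzZT (F i)) ->
  H (fun y => \sum_(i <- s) F i y) = \sum_(i <- s) H (F i).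
Proof.
move=> sF; elim: s => [|i s IH].
  rewrite big_nil -[RHS]linear_on0; congr H.
  by apply/funext => y; rewrite big_nil.
rewrite big_cons -IH -linear_onD//; last exact: schwartz_sum.
by congr H; apply/funext => y; rewrite big_cons.
Qed.

Lemma linear_on_trigpoly j (tp : seq (C * Z)) :
  H (level j (trigpoly tp)) = \sum_(p <- tp) p.1 * H (level j (chi p.2)).
Proof.
transitivity (H (fun y => \sum_(p <- tp) p.1 * level j (chi p.2) y)).
  congr H; apply/funext => -[i y]; rewrite levelE /trigpoly mulr_sumr.
  by apply: eq_bigr => p _; rewrite levelE mulrCA.
rewrite linear_on_sum => [|p]; last by apply: schwartzZT_scale; exact: schwartz_level_chi.
by apply: eq_bigr => p _; rewrite linear_onZ//; exact: schwartz_level_chi.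
Qed.

Lemma linear_onB j f g : schwartzT f -> schwartzT g ->
  H (level j (fun x => f x - g x)) = H (level j f) - H (level j g).
Proof.
move=> sf sg.
transitivity (H (fun y => level j f y + -1 * level j g y)).
  by congr H; apply/funext => -[i y]; rewrite !levelE; ring.
rewrite linear_onD ?linear_onZ ?mulN1r//.
- exact: schwartz_level.
- exact: schwartz_level.
- by apply: schwartzZT_scale; exact: schwartz_level.
Qed.

Lemma level_approx N K j f g eps : bounded_by H N K -> schwartzT f -> schwartzT g ->
  partials_bounded N (fun x => f x - g x) eps ->
  normc (H (level j f) - H (level j g)) <= K * (weight j ^+ N * eps).
Proof.
move=> HK sf sg fg; rewrite -linear_onB//; apply: HK.
  apply: schwartz_level; rewrite (_ : (fun x => _) = fun x => f x + -1 * g x).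
    by apply: schwartzTD => //; exact: schwartzTZ.
  by apply/funext => x; rewrite mulN1r.
apply: schwartz_bounded_level => //.
rewrite (_ : (fun x => _) = fun x => f x + -1 * g x).
  by apply: smoothD; [case: sf|apply: smoothZ; case: sg].
by apply/funext => x; rewrite mulN1r.
Qed.

Lemma truncated_functional phi (A : seq Z) : uniq A -> schwartzZT phi ->
  H phi = \sum_(j <- A) H (level j (fun x => phi (j, x))) +
          H (fun y => (y.1 \notin A)%:R * phi y).
Proof.
move=> uA sphi; rewrite {1}(level_decomposition phi uA) linear_onD.
- by rewrite linear_on_sum// => j; apply: schwartz_level; exact: schwartzT_slice.
- by apply: schwartz_sum => j; apply: schwartz_level; exact: schwartzT_slice.
- apply: (@schwartzMZ _ _ (fun j => (j \notin A)%:R)) => // j.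
  by case: (_ \notin _); rewrite ?normc1 ?normc0.
Qed.

(** A continuous functional is determined by its values on the characters of
the levels. *)
Lemma functional_eq0 N K phi : bounded_by H N K -> 0 <= K -> schwartzZT phi ->
  (forall j l, H (level j (chi l)) = 0) -> H phi = 0.
Proof.
move=> HK K0 sphi H0.
have small (z : C) (D : R) : 0 <= D -> (forall eps, 0 < eps -> normc z <= D * eps) -> z = 0.
  move=> D0 h; apply/eqP; rewrite -normc_eq0 eq_le normc_ge0 andbT.
  apply/ler_addgt0Pl => e e0; rewrite addr0.
  have D1 : 0 < D + 1 by lra.
  apply: le_trans (h (e / (D + 1)) _) _; first by rewrite divr_gt0.
  by rewrite mulrCA ger_pMr// ler_pdivrMr// mul1r; lra.
have Hlevel j f : schwartzT f -> H (level j f) = 0.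
  move=> sf; apply: (@small _ (K * weight j ^+ N)).
    by rewrite mulr_ge0// ltW// weightX_gt0.
  move=> eps eps0; have [tp htp] := schwartzT_density N sf eps0.
  have := level_approx j HK sf (schwartzT_trigpoly tp) htp.
  rewrite linear_on_trigpoly big1 ?subr0 ?mulrA// => p _.
  by rewrite H0 mulr0.
apply: (@small _ K) => // eps eps0.
have [A [uA _ hA]] := schwartz_truncation N 0 sphi eps0.
rewrite (truncated_functional uA sphi) big1 ?add0r.
  apply: HK => //.
  apply: (@schwartzMZ _ _ (fun j => (j \notin A)%:R)) => // j.
  by case: (_ \notin _); rewrite ?normc1 ?normc0.
by move=> j _; apply: Hlevel; exact: schwartzT_slice.
Qed.

End linear_functional.

(** Homogeneity turns continuity at zero into a bound by one seminorm. *)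
Lemma tempered_bounded H : tempered schwartzZT seminormZT H ->
  exists N K, 0 <= K /\ bounded_by H N K.
Proof.
move=> tH; have lH := tempered_linear tH; have H0 := linear_on0 lH.
have [N [delta [delta0 h]]] := tH.2 _ schwartz0 1 ltr01.
exists N, (2 / delta); split; first by rewrite divr_ge0// ltW.
move=> phi B sphi hB; have B0 := schwartz_bounded_ge0 hB.
rewrite H0 in h.
have le (B' : R) : B < B' -> normc (H phi) <= 2 / delta * B'.
  move=> BB'; have B'0 : 0 < B' by exact: le_lt_trans BB'.
  pose t := delta / (2 * B').
  have t0 : 0 < t by rewrite divr_gt0// mulr_gt0.
  have nt : normc ((t%:C)%C : C) = t by rewrite normc_real gtr0_norm.
  have bt := schwartz_boundedZ ((t%:C)%C) sphi hB.
  have : normc (H (fun y => (t%:C)%C * phi y) - 0) < 1.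
    apply: h; first exact: schwartzZT_scale.
    rewrite (_ : (_ - _)%R = (fun y => (t%:C)%C * phi y)); last first.
      by apply/funext => y; rewrite /GRing.add /GRing.opp/= oppr0 addr0.
    apply: le_lt_trans (seminormZT_le bt) _.
    rewrite lte_fin nt; apply: (@le_lt_trans _ _ (t * B')); first by rewrite ler_pM2l// ltW.
    have -> : t * B' = delta / 2 by rewrite /t; field; rewrite gt_eqF.
    by lra.
  rewrite subr0 linear_onZ// normcM nt => /ltW.
  by rewrite -ler_pdivlMl// mulr1 /t invf_div mulrAC.
apply/ler_addgt0Pr => e e0.
have d0 : 0 < 2 / delta by rewrite divr_gt0.
have := le (B + e / (2 / delta)); rewrite ltrDl divr_gt0// => /(_ isT) h1.
by apply: le_trans h1 _; rewrite mulrDr lerD2l mulrC divfK// gt_eqF.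
Qed.

End bounded_functionals.

(** * Coefficients of a distribution and its short-time Fourier transform *)

Section coefficient_estimates.
Context {R : realType} {n : nat}.
Local Notation Z := 'rV[int]_n.
Local Notation T := 'rV[R]_n.
Local Notation C := R[i].
Local Notation mu := (@haar R n).

(** A coefficient of a trigonometric polynomial is at most its mean modulus;
the bound survives uniform approximation. *)
Lemma coefficient_le (V : T -> C) (Q : T -> \bar R) (a : C) (l : Z) :
  measurable_fun setT Q -> (forall x, (normc (V x))%:E <= Q x)%E ->
  (forall eps : R, 0 < eps -> exists tp, (forall x, normc (V x - trigpoly tp x) <= eps) /\
     normc (trigpoly_coef tp l - a) <= eps) ->
  ((normc a)%:E <= \int[mu]_x Q x)%E.
Proof.
move=> mQ VQ h; apply/lee_addgt0Pr => e e0.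
have Q0 x : (0 <= Q x)%E by apply: le_trans (VQ x); rewrite lee_fin normc_ge0.
have e2 : 0 < e / 2 by lra.
have [tp [h1 h2]] := h _ e2.
have ->  : (\int[mu]_x Q x + e%:E = \int[mu]_x (Q x + (e / 2)%:E) + (e / 2)%:E)%E.
  rewrite ge0_integralD//; last by move=> x _; rewrite lee_fin ltW.
  by rewrite integral_haar_cst -addeA -EFinD -splitr.
apply: (@le_trans _ _ ((normc (trigpoly_coef tp l))%:E + (e / 2)%:E)%E).
  rewrite -EFinD lee_fin; have := ler_normcB a (trigpoly_coef tp l).
  by rewrite normcB; lra.
rewrite leeD2r// -fourier_trigpoly.
apply: le_trans (normc_Cintegral _) _.
  exact: fourier_integrable (Cmeasurable_trigpoly tp) (trigpoly_bounded tp).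
apply: ge0_le_integral => //.
- by move=> x _; rewrite lee_fin normc_ge0.
- apply: emeasurable_normc; apply: CmeasurableM; first exact: Cmeasurable_trigpoly.
  exact/Cdiff_measurable/Cdiff_chi.
- exact: emeasurable_funD.
- move=> x _; rewrite normcM normc_chi mulr1.
  apply: (@le_trans _ _ ((normc (V x))%:E + (e / 2)%:E)%E); last by rewrite leeD2r.
  rewrite -EFinD lee_fin; have := ler_normcB (trigpoly tp x) (V x).
  by rewrite normcB; have := h1 x; lra.
Qed.

Variables (H : (Z * T -> C) -> C) (N : nat) (K : R).
Hypotheses (Hlin : linear_on_schwartz H) (HK : bounded_by H N K) (K0 : 0 <= K).

(** Modulating a test function in the lattice variable makes its levels the
coefficients of a trigonometric series. *)
Lemma level_value_le phi j0 (Q : T -> \bar R) : schwartzZT phi ->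
  measurable_fun setT Q ->
  (forall xi, (normc (H (fun y => expi2pi (- dot xi y.1) * phi y)))%:E <= Q xi)%E ->
  ((normc (H (level j0 (fun x => phi (j0, x)))))%:E <= \int[mu]_xi Q xi)%E.
Proof.
move=> sphi mQ VQ; apply: (@coefficient_le _ Q _ (- j0) mQ VQ) => eps eps0.
have K1 : 0 < K + 1 := ltr_wpDl K0 ltr01.
have [|A [uA j0A hA]] := @schwartz_truncation _ _ phi N (eps / (K + 1)) j0 sphi.
  by rewrite divr_gt0.
exists [seq (H (level j (fun x => phi (j, x))), - j) | j <- A]; split=> [xi|]; last first.
  rewrite /trigpoly_coef big_map big_mkcond/= (bigD1_seq j0)//= eqxx big1.
    by rewrite addr0 subrr normc0 (ltW eps0).
  by move=> j /negbTE jj0; rewrite eqr_opp jj0.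
have e1 j : normc (expi2pi (- dot xi j) : C) <= 1 by rewrite normc_expi2pi.
have s1 : schwartzZT (fun y => expi2pi (- dot xi y.1) * phi y).
  exact: (@schwartzMZ _ _ (fun j => expi2pi (- dot xi j))).
have sA : schwartzZT (fun y => (y.1 \notin A)%:R * phi y).
  apply: (@schwartzMZ _ _ (fun j => (j \notin A)%:R)) => // j.
  by case: (_ \notin _); rewrite ?normc1 ?normc0.
rewrite (truncated_functional Hlin uA s1) /trigpoly big_map/=.
rewrite (eq_bigr (fun j => H (level j (fun x => phi (j, x))) * chi (- j) xi)); last first.
  move=> j _; rewrite mulrC -(linear_onZ Hlin).
    by congr H; apply/funext => -[i x]; rewrite !levelE /chi dotNr; ring.
  by apply: schwartz_level; exact: schwartzT_slice.
rewrite addrC addKr.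
apply: (@le_trans _ _ (K * (eps / (K + 1)))); last first.
  by rewrite mulrCA ger_pMr// ler_pdivrMr// mul1r; lra.
have -> : (fun y => (y.1 \notin A)%:R * (expi2pi (- dot xi y.1) * phi y)) =
    (fun y => expi2pi (- dot xi y.1) * ((y.1 \notin A)%:R * phi y)).
  by apply/funext => y; ring.
apply: HK; first exact: (@schwartzMZ _ _ (fun j => expi2pi (- dot xi j))).
exact: (@schwartz_boundedMZ _ _ _ (fun j => expi2pi (- dot xi j))).
Qed.

(** Translating the profile of a level turns the functional into a convolution,
whose coefficients are products. *)
Lemma level_fourier_le (f : T -> C) j (k l : Z) (Q : T -> \bar R) : schwartzT f ->
  measurable_fun setT Q ->
  (forall w, (normc (H (level j (fun x => chi (- k) x * f (x - w)))))%:E <= Q w)%E ->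
  ((normc (fourier f l * H (level j (chi (l - k)))))%:E <= \int[mu]_w Q w)%E.
Proof.
move=> sf mQ VQ; apply: (@coefficient_le _ Q _ (- l) mQ VQ) => eps eps0.
(* Approximating f up to eps / D makes both errors at most eps. *)
pose D := K * (weight j ^+ N * (chi_growth (R := R) (- k) ^+ N)) +
  normc (H (level j (chi (l - k)))) + 1.
have g0 : 0 <= chi_growth (R := R) (- k) ^+ N.
  by rewrite exprn_ge0// (le_trans ler01)// chi_growth_ge1.
have P0 : 0 <= K * (weight j ^+ N * (chi_growth (R := R) (- k) ^+ N)).
  by rewrite mulr_ge0// mulr_ge0// ltW// weightX_gt0.
have D0 : 0 < D by rewrite /D; have := normc_ge0 (H (level j (chi (l - k)))); lra.
have [|tp htp] := @schwartzT_density _ _ f N (eps / D) sf; first by rewrite divr_gt0.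
have stp := schwartzT_trigpoly tp.
have [f0 B0 bf] := sf; have [B /(_ [::] _ isT)/= hB] := bf 0%N.
exists [seq (p.1 * H (level j (chi (p.2 - k))), - p.2) | p <- tp]; split=> [w|]; last first.
  rewrite /trigpoly_coef big_map/=.
  rewrite (eq_big (fun p => p.2 == l) (fun p => p.1 * H (level j (chi (l - k))))); last 2 first.
  - by move=> p; rewrite eqr_opp.
  - by move=> p; rewrite eqr_opp => /eqP ->.
  rewrite -mulr_suml -mulrBl normcM.
  rewrite -/(trigpoly_coef tp l) -fourier_trigpoly normcB.
  rewrite -(@fourierB _ _ f (trigpoly tp) l B (\sum_(p <- tp) normc p.1)); last 4 first.
  - exact/Cdiff_measurable/smooth_Cdiff.
  - exact: Cmeasurable_trigpoly.
  - by move=> x; exact: hB.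
  - exact: trigpoly_bounded.
  apply: (@le_trans _ _ (eps / D * normc (H (level j (chi (l - k)))))).
    rewrite ler_wpM2r ?normc_ge0//; apply: normc_fourier_le.
      apply/Cdiff_measurable; rewrite (_ : (fun x => _) = fun x => f x + -1 * trigpoly tp x).
        apply: CdiffD; first exact: smooth_Cdiff.
        by apply/smooth_Cdiff/smoothZ; case: stp.
      by apply/funext => x; rewrite mulN1r.
    by move=> x; exact: (htp [::]).
  rewrite mulrAC ler_pdivrMr// ler_pM2l//.
  by rewrite /D; lra.
have -> : trigpoly [seq (p.1 * H (level j (chi (p.2 - k))), - p.2) | p <- tp] w =
    H (level j (fun x => chi (- k) x * trigpoly tp (x - w))).
  rewrite /trigpoly big_map/=.
  transitivity (H (fun y => \sum_(p <- tp) (p.1 * chi (- p.2) w) * level j (chi (p.2 - k)) y)).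
    rewrite (linear_on_sum Hlin); last by move=> p; apply: schwartzZT_scale; exact: schwartz_level_chi.
    apply: eq_bigr => p _; rewrite (linear_onZ Hlin); last exact: schwartz_level_chi.
    by ring.
  congr H; apply/funext => -[i x]; rewrite levelE !mulr_sumr; apply: eq_bigr => p _.
  by rewrite levelE chiD chi_shift chi_opp; ring.
have stw : schwartzT (fun x => chi (- k) x * trigpoly tp (x - w)).
  by apply: schwartzT_chiM; exact: schwartzT_shift.
have sfw : schwartzT (fun x => chi (- k) x * f (x - w)).
  by apply: schwartzT_chiM; exact: schwartzT_shift.
have hd : partials_bounded N
    (fun x => chi (- k) x * f (x - w) - chi (- k) x * trigpoly tp (x - w))
    (chi_growth (- k) ^+ N * (eps / D)).
  rewrite (_ : (fun x => _) = fun x => chi (- k) x * ((fun y => f y - trigpoly tp y) (x - w))); last first.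
    by apply/funext => x; ring.
  have sd : smooth (fun y => f y - trigpoly tp y).
    rewrite (_ : (fun x => _) = fun x => f x + -1 * trigpoly tp x).
      by apply: smoothD => //; apply: smoothZ; case: stp.
    by apply/funext => x; rewrite mulN1r.
  apply: partials_bounded_chiM; first exact: (smooth_shift w sd).
  exact: (partials_bounded_shift w sd).
apply: le_trans (level_approx Hlin j HK sfw stw hd) _.
rewrite !mulrA ler_pdivrMr// mulrC ler_pM2l//.
rewrite /D !mulrA; have := normc_ge0 (H (level j (chi (l - k)))).
by rewrite -!mulrA; lra.
Qed.

End coefficient_estimates.

Section reindexing.
Context {R : realType} {n : nat}.
Local Notation Z := 'rV[int]_n.

Lemma integral_counting_inj (F : Z -> \bar R) (g : Z -> Z) : injective g ->
  (forall k, 0 <= F k)%E ->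
  (\int[counting]_k F (g k) <= \int[counting]_k F k)%E.
Proof.
move=> gi F0; apply: integral_counting_le => // s us.
rewrite -(big_map g xpredT F); apply: sum_le_integral_counting => //.
by rewrite map_inj_uniq.
Qed.

Lemma le_integral_Z (F G : Z -> \bar R) : (forall k, 0 <= F k)%E ->
  (forall k, F k <= G k)%E -> (\int[counting]_k F k <= \int[counting]_k G k)%E.
Proof.
by move=> F0 FG; apply: ge0_le_integral => //; exact: measurable_Z.
Qed.

End reindexing.

Section modulation_space_M1.
Context {R : realType} {n : nat}.
Local Notation Z := 'rV[int]_n.
Local Notation T := 'rV[R]_n.
Local Notation C := R[i].

Lemma seminormZ_bounded N (phi : Z -> C) : (seminormZ N phi < +oo)%E ->
  exists B, forall k, weight k ^+ N * normc (phi k) <= B.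
Proof.
move=> h; exists (fine (seminormZ N phi)) => k.
have le : ((weight k ^+ N * normc (phi k))%:E <= seminormZ N phi)%E.
  by apply: ereal_sup_ubound; exists k.
rewrite -lee_fin fineK// fin_numE (lt_eqF h) andbT; apply/eqP => h'.
by rewrite h' in le.
Qed.

(** Rapidly decreasing sequences, as test functions constant on the torus. *)
Lemma schwartz_extension (phi : Z -> C) : schwartzZ phi ->
  schwartzZT (fun y : Z * T => phi y.1).
Proof.
move=> sphi; apply/schwartzZTP; split=> [j|j|N]; [by []|exact: (smooth_cst (phi j))|].
have [B hB] := seminormZ_bounded (sphi N); exists B => j.
apply: (@partials_bounded_le _ _ N (fun _ => phi j) (normc (phi j))); last first.
  exact: partials_bounded_cst.
by rewrite ler_pdivlMr ?weightX_gt0// mulrC.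
Qed.

Lemma schwartz_restriction (phi : Z * T -> C) : schwartzZT phi ->
  schwartzZ (fun k => phi (k, 0)).
Proof.
move=> sphi N; have [B hB] := schwartz_bound N sphi.
apply: (@le_lt_trans _ _ B%:E); last exact: ltry.
apply: ge_ereal_sup => _ [k _ <-]; rewrite lee_fin mulrC -ler_pdivlMr ?weightX_gt0//.
exact: (hB k [::]).
Qed.

(** A distribution on the lattice, as a distribution carried by the origin of the
torus, so that the estimates on the phase space apply to it. *)
Lemma tempered_restriction (u : (Z -> C) -> C) : tempered schwartzZ seminormZ u ->
  tempered schwartzZT seminormZT (fun phi : Z * T -> C => u (fun k => phi (k, 0))).
Proof.
move=> [lin cont]; split=> [a phi psi sphi spsi|phi sphi eps eps0].
  by apply: lin; exact: schwartz_restriction.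
have [N [d [d0 h]]] := cont _ (schwartz_restriction sphi) eps eps0.
exists N, d; split=> // psi spsi hd; apply: h; first exact: schwartz_restriction.
apply: le_lt_trans hd; apply: ge_ereal_sup => _ [k _ <-].
by apply: ereal_sup_ubound; exists k, 0, [::].
Qed.

(** With y(k) = conj(gamma(k - m)), the transform at (m, w) is the value of u on the
sequence exp(-2 i pi w.k) y(k).  Extended to functions constant on the torus, u satisfies
level_value_le, whose coefficient of index m + k0 is conj(gamma(k0)) u(m + k0). *)
Lemma modulation_space_l1 (gamma : Z -> C) k0 (u : (Z -> C) -> C) :
  schwartzZ gamma -> gamma k0 != 0 -> modulation_spaceZ gamma 1 u ->
  (\int[@counting Z R]_k (normc (seq_of_dist u k))%:E < +oo)%E.
Proof.
move=> gS g0 [tu [mV NV]].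
pose H (phi : Z * T -> C) := u (fun k => phi (k, 0)).
have tH : tempered schwartzZT seminormZT H by exact: tempered_restriction.
have [N [K [K0 HK]]] := tempered_bounded tH.
have lH := tempered_linear tH.
pose V := stft_dist gamma u.
have mnV : measurable_fun setT (fun x => (normc (V x))%:E) by exact: emeasurable_normc.
have sec m : measurable_fun setT (fun w => (normc (V (m, w)))%:E).
  exact: (measurable_fun_pair2 m mnV).
have key m : ((normc (gamma k0))%:E * (normc (seq_of_dist u (m + k0)))%:E <=
    \int[haar n]_w (normc (V (m, w)))%:E)%E.
  pose phi (y : Z * T) : C := ((gamma (y.1 - m))^*)%C.
  have sphi : schwartzZT phi.
    apply: schwartz_conj.
    exact: (schwartz_shift m 0 (schwartz_extension gS)).
  have := @level_value_le _ _ H N K lH HK K0 phi (m + k0)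
    (fun w => (normc (V (m, w)))%:E) sphi (sec m).
  have -> : H (level (m + k0) (fun x => phi (m + k0, x))) =
      ((gamma k0)^*)%C * seq_of_dist u (m + k0).
    rewrite (_ : level _ _ = fun y => ((gamma k0)^*)%C * level (m + k0) (chi 0) y).
      rewrite (linear_onZ lH); last exact: schwartz_level_chi.
      congr (_ * _); rewrite /H /seq_of_dist; congr u.
      by apply/funext => j; rewrite levelE chi0 mulr1.
    by apply/funext => -[i x]; rewrite !levelE /phi/= chi0 addrAC subrr add0r; ring.
  rewrite normcM normc_conj EFinM; apply => w.
  rewrite lee_fin le_eqVlt; apply/orP; left; apply/eqP; congr normc.
  rewrite /H /V /stft_dist /=; congr u; apply/funext => k.
  by rewrite /modulation /translation rmorphM/= expi2piN.
have fin : (\int[@counting Z R]_m \int[haar n]_w (normc (V (m, w)))%:E < +oo)%E.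
  move: NV; rewrite /CLnorm Lnorm1.
  rewrite (eq_integral (fun x => (normc (V x))%:E)); last first.
    by move=> x _ /=; rewrite ger0_norm ?normc_ge0.
  rewrite /muZT fubini_tonelli1//.
  by move=> x; rewrite lee_fin normc_ge0.
have gp : 0 < normc (gamma k0) by rewrite lt_neqAle normc_ge0 eq_sym normc_eq0 g0.
have F0 m : (0 <= (normc (gamma k0))%:E * (normc (seq_of_dist u m))%:E)%E.
  by rewrite -EFinM lee_fin mulr_ge0 ?normc_ge0.
have : (\int[@counting Z R]_m ((normc (gamma k0))%:E * (normc (seq_of_dist u m))%:E) < +oo)%E.
  apply: le_lt_trans fin.
  apply: (@le_trans _ _ (\int[@counting Z R]_m ((normc (gamma k0))%:E * (normc (seq_of_dist u (m + k0)))%:E))%E).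
    pose F (m : Z) : \bar R := ((normc (gamma k0))%:E * (normc (seq_of_dist u (m + k0)))%:E)%E.
    have FE m : ((normc (gamma k0))%:E * (normc (seq_of_dist u m))%:E)%E = F (m - k0).
      by rewrite /F subrK.
    have inj : injective (fun m : Z => m - k0) by move=> x y /addIr.
    have := integral_counting_inj inj (fun m => F0 (m + k0) : (0 <= F m)%E).
    by apply: le_trans; rewrite le_eqVlt; apply/orP; left; apply/eqP/eq_integral.
  apply: le_integral_Z; last exact: key.
  by move=> m; exact: F0.
rewrite ge0_integralZl//; last 3 first.
- exact: measurable_Z.
- by move=> k _; rewrite lee_fin normc_ge0.
- by rewrite lee_fin normc_ge0.
rewrite ltey; apply: contraTT; rewrite -leNgt leye_eq => /eqP ->.
by rewrite gt0_muley ?lte_fin// eqxx.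
Qed.

End modulation_space_M1.

Section modulation_space_Mp.
Context {R : realType} {n : nat}.
Local Notation Z := 'rV[int]_n.
Local Notation T := 'rV[R]_n.
Local Notation C := R[i].
Local Notation mu := (@haar R n).

(** Jensen's inequality up to a constant, from t <= 1/2 + 2 t^p. *)
Lemma power_mean_le (p h : R) (v : T -> T -> R) : 1 <= p <= 2 -> 0 <= h ->
  measurable_fun setT (fun x : T * T => v x.1 x.2) -> (forall x y, 0 <= v x y) ->
  (h%:E <= \int[mu]_x \int[mu]_y (v x y)%:E)%E ->
  ((h `^ p)%:E <= 4%:E * \int[mu]_x \int[mu]_y (v x y `^ p)%:E)%E.
Proof.
move=> /andP[p1 p2] h0 mv v0 hle; have p0 : 0 < p := lt_le_trans ltr01 p1.
have vp0 x y : (0 <= (v x y `^ p)%:E)%E by rewrite lee_fin powR_ge0.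
have I0 : (0 <= \int[mu]_x \int[mu]_y (v x y `^ p)%:E)%E.
  by apply: integral_ge0 => x _; apply: integral_ge0.
have [->|hn0] := eqVneq h 0.
  by rewrite powR0 ?gt_eqF// mule_ge0// lee_fin.
have hgt0 : 0 < h by rewrite lt_neqAle eq_sym hn0.
have pointwise (t : R) : 0 <= t -> t <= 1 / 2 + 2 * t `^ p.
  move=> t0; have [t1|t1] := leP t (1 / 2); first by have := powR_ge0 t p; lra.
  have tp : t / 2 <= t `^ p.
    have [t1'|t1'] := leP 1 t.
      apply: (@le_trans _ _ t); first by lra.
      by rewrite -{1}(powRr1 t0) ler_powR.
    apply: (@le_trans _ _ (t `^ 2)); first by rewrite powR_mulrn// expr2; nra.
    apply: ger_powR => //.
    by apply/andP; split; lra.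
  by lra.
have scaled x y : ((v x y)%:E <= (h / 2)%:E + (2 * h / (h `^ p))%:E * (v x y `^ p)%:E)%E.
  rewrite -EFinM -EFinD lee_fin.
  have := pointwise (v x y / h) (divr_ge0 (v0 x y) h0).
  have hV : h^-1 `^ p = (h `^ p)^-1 by rewrite -[h^-1]powR_inv1// -powRrM mulN1r powRN.
  rewrite powRM ?invr_ge0// hV.
  rewrite ler_pdivrMr// => le; apply: le_trans le _.
  by rewrite le_eqVlt; apply/orP; left; apply/eqP; field; rewrite gt_eqF// powR_gt0.
have mvp : measurable_fun setT (fun x : T * T => (v x.1 x.2 `^ p)%:E).
  apply/measurable_EFinP; exact: (measurableT_comp (measurable_powR p) mv).
have mve : measurable_fun setT (fun x : T * T => (v x.1 x.2)%:E) by exact/measurable_EFinP.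
pose K := (2 * h / (h `^ p)); have K0 : 0 <= K by rewrite divr_ge0 ?mulr_ge0 ?powR_ge0.
have sec x : measurable_fun setT (fun y => (v x y `^ p)%:E).
  exact: (measurable_fun_pair2 x mvp).
have msec : measurable_fun setT (fun x => \int[mu]_y (v x y `^ p)%:E)%E.
  by apply: (@measurable_integral2 _ _ _ _ _ mu (fun x y => (v x y `^ p)%:E)).
have v0e x y : (0 <= (v x y)%:E)%E by rewrite lee_fin.
have mI : measurable_fun setT (fun x => \int[mu]_y (v x y)%:E)%E.
  by apply: (@measurable_integral2 _ _ _ _ _ mu (fun x y => (v x y)%:E)).
have bound : (\int[mu]_x \int[mu]_y (v x y)%:E <=
    (h / 2)%:E + K%:E * \int[mu]_x \int[mu]_y (v x y `^ p)%:E)%E.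
  have h2 : (0 <= (h / 2)%:E :> \bar R)%E by rewrite lee_fin divr_ge0.
  have -> : ((h / 2)%:E + K%:E * \int[mu]_x \int[mu]_y (v x y `^ p)%:E =
      \int[mu]_x ((h / 2)%:E + K%:E * \int[mu]_y (v x y `^ p)%:E))%E.
    rewrite [RHS]ge0_integralD//; last 2 first.
    - by move=> x _; rewrite mule_ge0//; apply: integral_ge0.
    - by apply: emeasurable_funM.
    rewrite integral_haar_cst ge0_integralZl//.
    by move=> x _; apply: integral_ge0.
  apply: ge0_le_integral => //.
  - by move=> x _; apply: integral_ge0.
  - by apply: emeasurable_funD => //; apply: emeasurable_funM.
  - move=> x _; have -> : ((h / 2)%:E + K%:E * \int[mu]_y (v x y `^ p)%:E =
        \int[mu]_y ((h / 2)%:E + K%:E * (v x y `^ p)%:E))%E.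
      rewrite [RHS]ge0_integralD//; last 2 first.
      + by move=> y _; rewrite mule_ge0.
      + by apply: emeasurable_funM.
      by rewrite integral_haar_cst ge0_integralZl.
    have m1 : measurable_fun setT (fun y => (v x y)%:E) by exact: (measurable_fun_pair2 x mve).
    have m2 : measurable_fun setT (fun y => ((h / 2)%:E + K%:E * (v x y `^ p)%:E)%E).
      by apply: emeasurable_funD => //; apply: emeasurable_funM.
    by apply: ge0_le_integral => // y _; exact: scaled.
have := le_trans hle bound.
move: I0; case: (\int[mu]_x _)%E => [r| |] //; last first.
  by move=> _ _; rewrite gt0_muley ?lte_fin// leey.
rewrite !lee_fin => r0 le.
have hp : 0 < h `^ p by rewrite powR_gt0.
have KE : K * h `^ p = 2 * h by rewrite /K divfK// gt_eqF.
have Kgt0 : 0 < K by rewrite divr_gt0// mulr_gt0.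
rewrite leNgt; apply/negP => lt.
have : K * (4 * r) < K * h `^ p by rewrite ltr_pM2l.
by rewrite KE; lra.
Qed.

Lemma phase_space_tonelli (g : (Z * T) * (T * Z) -> \bar R) :
  measurable_fun setT g -> (forall x, 0 <= g x)%E ->
  (\int[muZT \x muTZ]_x g x = \int[counting]_m \int[counting]_k
     \int[mu]_w \int[mu]_xi g ((m, w), (xi, k)))%E.
Proof.
move=> mg g0; rewrite fubini_tonelli1//.
have mgx x : measurable_fun setT (fun y => g (x, y)) by exact: measurable_fun_pair2.
have E x : fubini_F muTZ g x = (\int[counting]_k \int[mu]_xi g (x, (xi, k)))%E.
  rewrite /fubini_F /muTZ fubini_tonelli2//.
have mK k : measurable_fun setT (fun z : (Z * T) * T => g (z.1, (z.2, k))).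
  apply: (measurableT_comp mg); apply: measurable_fun_pair => //.
  by apply: measurable_fun_pair.
have mE k : measurable_fun setT (fun x => \int[mu]_xi g (x, (xi, k)))%E.
  exact: (@measurable_integral2 _ _ _ _ _ mu (fun x xi => g (x, (xi, k)))).
have mF : measurable_fun setT (fun x => \int[counting]_k \int[mu]_xi g (x, (xi, k)))%E.
  apply: (@measurable_integral2 _ _ _ _ _ (@counting Z R) (fun x k => \int[mu]_xi g (x, (xi, k))))%E.
    by apply: measurable_prodZr.
  by move=> x k; apply: integral_ge0.
rewrite (eq_integral (fun x => \int[counting]_k \int[mu]_xi g (x, (xi, k))))%E; last first.
  by move=> x _; exact: E.
rewrite /muZT fubini_tonelli1//; last first.
  by move=> x; apply: integral_ge0 => k _; apply: integral_ge0.
apply: eq_integral => m _; rewrite /fubini_F -tonelliZ//.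
- by move=> k; exact: (measurable_fun_pair2 m (mE k)).
- by move=> k w; apply: integral_ge0.
Qed.

(** Let f be the conjugate of a slice of the window that does not vanish, and l0 a
frequency at which its Fourier coefficient is not zero.  For fixed m and k, the
integral in xi isolates the level m + j0, and the integral in w isolates the
frequency l0: this bounds |f^(l0) c(m + j0, l0 - k)| by the mean of |V| over the
two tori.  The rest is Jensen's inequality and the inclusion of l^p in l^2. *)
Lemma modulation_space_l2 (Gamma : Z * T -> C) x0 (p : R)
    (F : (Z * T -> C) -> C) : 1 <= p <= 2 ->
  schwartzZT Gamma -> Gamma x0 != 0 -> modulation_spaceZT Gamma p F ->
  (\int[@counting Z R]_j \int[@counting Z R]_k
     (normc (F (level j (chi k))) ^+ 2)%:E < +oo)%E.
Proof.
move=> p12 GS G0 [tF [mV NV]]; have /andP[p1 p2] := p12.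
have p0 : 0 < p := lt_le_trans ltr01 p1.
have [N [K [K0 HK]]] := tempered_bounded tF.
have lF := tempered_linear tF.
pose V := stftZT_dist Gamma F.
pose v x := normc (V x).
have mv : measurable_fun setT v by exact: measurable_normc.
have v0 x : 0 <= v x by exact: normc_ge0.
pose j0 := x0.1.
pose f (x : T) : C := ((Gamma (j0, x))^*)%C.
have sf : schwartzT f := schwartzT_slice j0 (schwartz_conj GS).
have [l0 fl0] : exists l, fourier f l != 0.
  apply: contra_notP (_ : f x0.2 <> 0); last first.
    by apply/eqP; rewrite -normc_eq0 normc_conj normc_eq0 /j0 -surjective_pairing.
  move=> nl; have [smf pf bf] := sf; have [B hB] := bf 1%N.
  apply: (fourier_eq0 _ smf pf hB) => l; apply/eqP/negPn/negP => h; apply: nl.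
  by exists l.
pose c j k := F (level j (chi k)).
pose h m k := normc (fourier f l0 * c (m + j0) (l0 - k)).
have sec m k : measurable_fun setT (fun x : T * T => v ((m, x.1), (x.2, k))).
  apply: (measurableT_comp mv); apply: measurable_fun_pair => //.
    by apply: measurable_fun_pair.
  by apply: measurable_fun_pair.
have key m k : ((h m k)%:E <= \int[mu]_w \int[mu]_xi (v ((m, w), (xi, k)))%:E)%E.
  apply: (@level_fourier_le _ _ F N K lF HK K0 f (m + j0) k l0
    (fun w => \int[mu]_xi (v ((m, w), (xi, k)))%:E)%E sf).
    apply: (@measurable_integral2 _ _ _ _ _ mu (fun w xi => (v ((m, w), (xi, k)))%:E)).
      by apply/measurable_EFinP; exact: sec.
    by move=> w xi; rewrite lee_fin.
  move=> w; pose phi (y : Z * T) : C := chi (- k) y.2 * ((Gamma (y.1 - m, y.2 - w))^*)%C.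
  have sphi : schwartzZT phi.
    by apply: schwartz_chi; apply: schwartz_conj; exact: schwartz_shift.
  have := @level_value_le _ _ F N K lF HK K0 phi (m + j0)
    (fun xi => (v ((m, w), (xi, k)))%:E) sphi.
  have -> : (fun x => phi (m + j0, x)) = (fun x => chi (- k) x * f (x - w)).
    by apply/funext => x; rewrite /phi/= addrAC subrr add0r.
  apply; first by apply/measurable_EFinP; exact: (measurable_fun_pair2 w (sec m k)).
  move=> xi; rewrite lee_fin le_eqVlt; apply/orP; left; apply/eqP; congr normc.
  rewrite /V /=; congr F; apply/funext => y.
  by rewrite /phi /chi dotNr mulrA.
have keyp m k : (((h m k) `^ p)%:E <=
    4%:E * \int[mu]_w \int[mu]_xi (v ((m, w), (xi, k)) `^ p)%:E)%E.
  apply: (@power_mean_le p (h m k) (fun w xi => v ((m, w), (xi, k))) p12).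
  - exact: normc_ge0.
  - exact: sec.
  - by move=> w xi; exact: v0.
  - exact: key.
pose gp x := ((v x `^ p)%:E : \bar R).
have mgp : measurable_fun setT gp.
  have : measurable_fun setT (fun x => v x `^ p).
    exact: (measurableT_comp (measurable_powR p) mv).
  by move/measurable_EFinP.
have gp0 x : (0 <= gp x)%E by rewrite lee_fin powR_ge0.
have fin : (\int[muZT \x muTZ]_x gp x < +oo)%E.
  have := poweR_lty p NV; rewrite /CLnorm poweR_Lnorm ?gt_eqF//.
  apply: le_lt_trans; rewrite le_eqVlt; apply/orP; left; apply/eqP/eq_integral => x _.
  by rewrite /gp /= ger0_norm ?normc_ge0.
have hfin : (\int[@counting Z R]_m \int[@counting Z R]_k ((h m k) `^ p)%:E < +oo)%E.
  apply: (@le_lt_trans _ _ (4%:E * \int[muZT \x muTZ]_x gp x)%E); last first.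
    by rewrite lte_mul_pinfty// lee_fin.
  have I0 m k : (0 <= \int[mu]_w \int[mu]_xi gp ((m, w), (xi, k)))%E.
    by apply: integral_ge0 => w _; apply: integral_ge0.
  rewrite phase_space_tonelli// -ge0_integralZl//; last 2 first.
  - exact: measurable_Z.
  - by move=> m _; apply: integral_ge0.
  apply: le_integral_Z => [m|m]; first by apply: integral_ge0 => k _; rewrite lee_fin powR_ge0.
  rewrite -ge0_integralZl//; last exact: measurable_Z.
  by apply: le_integral_Z => [k|k]; [rewrite lee_fin powR_ge0|exact: keyp].
move: hfin; set E := (\int[counting]_m _)%E => hfin.
have E0 : (0 <= E)%E.
  by apply: integral_ge0 => m _; apply: integral_ge0 => k _; rewrite lee_fin powR_ge0.
have Efin : E \is a fin_num by rewrite ge0_fin_numE.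
pose M := Num.max 1 (fine E).
have M1 : 1 <= M by rewrite le_max lexx.
have hM m k : (h m k) `^ p <= M.
  apply: (@le_trans _ _ (fine E)); last by rewrite le_max lexx orbT.
  rewrite -lee_fin fineK//.
  apply: le_trans (le_integral_counting m _); last first.
    by move=> m'; apply: integral_ge0 => k' _; rewrite lee_fin powR_ge0.
  apply: (@le_integral_counting _ _ k (fun k => ((h m k) `^ p)%:E)).
  by move=> k'; rewrite lee_fin powR_ge0.
have h0 m k : 0 <= h m k by exact: normc_ge0.
(* h ^ 2 <= h ^ p where h <= 1, and h <= h ^ p <= M elsewhere. *)
have h2 m k : (h m k) ^+ 2 <= M * (h m k) `^ p.
  have [h1|/ltW h1] := leP (h m k) 1.
    apply: (@le_trans _ _ ((h m k) `^ p)); last by rewrite ler_peMl// powR_ge0.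
    rewrite -powR_mulrn//; have [->|hn0] := eqVneq (h m k) 0.
      by rewrite !powR0// gt_eqF.
    by apply: ger_powR => //; rewrite lt_neqAle eq_sym hn0 h0.
  have hp : h m k <= (h m k) `^ p by rewrite -{1}(powRr1 (h0 m k)) ler_powR.
  by rewrite expr2; apply: ler_pM => //; exact: le_trans hp (hM m k).
have h2fin : (\int[@counting Z R]_m \int[@counting Z R]_k ((h m k) ^+ 2)%:E < +oo)%E.
  apply: (@le_lt_trans _ _ (M%:E * E)%E); last first.
    by rewrite lte_mul_pinfty// lee_fin (le_trans ler01).
  have M0 : (0 <= M%:E)%E by rewrite lee_fin (le_trans ler01).
  rewrite -ge0_integralZl//; last 2 first.
  - exact: measurable_Z.
  - by move=> m _; apply: integral_ge0 => k _; rewrite lee_fin powR_ge0.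
  apply: le_integral_Z => [m|m]; first by apply: integral_ge0 => k _; rewrite lee_fin sqr_ge0.
  rewrite -ge0_integralZl//; last 2 first.
  - exact: measurable_Z.
  - by move=> k _; rewrite lee_fin powR_ge0.
  apply: le_integral_Z => [k|k]; first by rewrite lee_fin sqr_ge0.
  by rewrite -EFinM lee_fin.
pose a := normc (fourier f l0) ^+ 2.
have a0 : 0 < a by rewrite exprn_gt0// lt_neqAle normc_ge0 eq_sym normc_eq0 fl0.
have cE j k : (normc (F (level j (chi k))) ^+ 2)%:E =
    (a^-1%:E * ((h (j - j0) (l0 - k)) ^+ 2)%:E)%E.
  rewrite /h subrK subKr normcM exprMn -EFinM mulrA mulVf ?mul1r//.
  by rewrite gt_eqF.
under eq_integral => j _ do under eq_integral => k _ do rewrite cE.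
have sq0 m k : (0 <= ((h m k) ^+ 2)%:E)%E by rewrite lee_fin sqr_ge0.
have aV0 : (0 <= a^-1%:E)%E by rewrite lee_fin invr_ge0 ltW.
apply: (@le_lt_trans _ _ (a^-1%:E * \int[@counting Z R]_m \int[@counting Z R]_k ((h m k) ^+ 2)%:E)%E); last first.
  by rewrite lte_mul_pinfty.
rewrite -ge0_integralZl//; last 2 first.
- exact: measurable_Z.
- by move=> m _; apply: integral_ge0.
apply: le_trans (integral_counting_inj (_ : injective (fun j => j - j0)) _); last 2 first.
- by move=> x y /addIr.
- by move=> m; rewrite mule_ge0//; apply: integral_ge0.
apply: le_integral_Z => [j|j]; first by apply: integral_ge0 => k _; rewrite mule_ge0.
rewrite ge0_integralZl//; last exact: measurable_Z.
rewrite lee_wpmul2l//.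
apply: (integral_counting_inj (_ : injective (fun k => l0 - k)) (sq0 _)).
by move=> x y /addrI /oppr_inj.
Qed.

End modulation_space_Mp.

(** * The Riesz-Fischer theorem on the torus *)

Section riesz_fischer.
Context {R : realType} {n : nat}.
Local Notation Z := 'rV[int]_n.
Local Notation T := 'rV[R]_n.
Local Notation C := R[i].
Local Notation mu := (@haar R n).
Implicit Types a : Z -> C.

Definition trigsum a (s : seq Z) (x : T) : C := \sum_(k <- s) a k * chi (- k) x.

Lemma trigsumE a s : trigsum a s = trigpoly [seq (a k, - k) | k <- s].
Proof. by apply/funext => x; rewrite /trigpoly big_map. Qed.

Lemma Cmeasurable_trigsum a s : Cmeasurable (trigsum a s).
Proof. by rewrite trigsumE; exact: Cmeasurable_trigpoly. Qed.

Lemma trigsum_cat a s t x : trigsum a (s ++ t) x = trigsum a s x + trigsum a t x.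
Proof. exact: big_cat. Qed.

Lemma Cintegral_trigsum_chi a s k : uniq s ->
  Cintegral mu (fun x => trigsum a s x * chi k x) = if k \in s then a k else 0.
Proof.
move=> us; have := fourier_trigpoly [seq (a k, - k) | k <- s] (- k).
rewrite /fourier -trigsumE opprK => ->.
rewrite /trigpoly_coef big_map big_mkcond/=; case: ifPn => ks.
  rewrite (bigD1_seq k)//= eqxx big1 ?addr0// => j /negbTE jk.
  by rewrite eqr_opp jk.
rewrite big_seq big1// => j js; rewrite eqr_opp; case: eqP => // jk.
by move: ks; rewrite -jk js.
Qed.

Lemma trigsum_L2 a s : uniq s ->
  (\int[mu]_x (normc (trigsum a s x) ^+ 2)%:E = (\sum_(k <- s) normc (a k) ^+ 2)%:E)%E.
Proof.
move=> us.
have i1 k : Cintegrable mu (fun x => ((a k)^*)%C * (trigsum a s x * chi k x)).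
  apply: CintegrableZ; rewrite trigsumE -[k]opprK.
  exact: fourier_integrable (Cmeasurable_trigpoly _) (trigpoly_bounded _).
have E x : trigsum a s x * ((trigsum a s x)^*)%C =
    \sum_(k <- s) ((a k)^*)%C * (trigsum a s x * chi k x).
  rewrite [in X in _ * X]/trigsum rmorph_sum/= mulr_sumr; apply: eq_bigr => k _.
  have -> : ((a k * chi (- k) x)^*)%C = ((a k)^*)%C * ((chi (- k) x)^*)%C.
    exact: rmorphM.
  by rewrite [chi (- k) x]chiN conjcK; ring.
have ci : Cintegrable mu (fun x => trigsum a s x * ((trigsum a s x)^*)%C).
  by under eq_fun do rewrite E; exact: Cintegrable_sum.
have := congr1 (@complex.Re R) (eq_Cintegral mu E); rewrite Cintegral_sum//.
rewrite (eq_big_seq (fun k => ((normc (a k) ^+ 2)%:C)%C)); last first.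
  move=> k ks; rewrite CintegralZ; last first.
    rewrite trigsumE -[k]opprK.
    exact: fourier_integrable (Cmeasurable_trigpoly _) (trigpoly_bounded _).
  by rewrite Cintegral_trigsum_chi// ks mulrC mulr_conj.
rewrite -(rmorph_sum (real_complex R)) [RHS]/= => <-.
rewrite [complex.Re _]/= /Rintegral fineK; last exact: integrable_fin_num ci.1.
by apply: eq_integral => x _; rewrite mulr_conj.
Qed.

Lemma trigsum_L1 a s (A : R) : uniq s -> 0 <= A ->
  \sum_(k <- s) normc (a k) ^+ 2 <= A ^+ 2 ->
  (\int[mu]_x (normc (trigsum a s x))%:E <= A%:E)%E.
Proof.
move=> us A0 sA; have := @cauchy_schwarz_integral _ _ _ mu
  (fun x => normc (trigsum a s x)) (fun _ => 1) A 1 _ _ A0 ler01.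
rewrite trigsum_L2// lee_fin expr1n mulr1 => h.
apply: le_trans (h _ _ sA _); last by rewrite integral_haar_cst.
- rewrite le_eqVlt; apply/orP; left; apply/eqP/eq_integral => x _.
  by rewrite mulr1 ger0_norm ?normc_ge0.
- exact/measurable_normc/Cmeasurable_trigsum.
- exact: measurable_cst.
Qed.

Lemma cvg_normc (z : nat -> C) (w : C) :
  complex.Re (z m) @[m --> \oo] --> complex.Re w ->
  complex.Im (z m) @[m --> \oo] --> complex.Im w ->
  normc (z m) @[m --> \oo] --> normc w.
Proof.
move=> hr hi.
have normE (u : C) : normc u = Num.sqrt (complex.Re u * complex.Re u + complex.Im u * complex.Im u).
  by rewrite -!expr2 -sqr_normc sqrtr_sqr ger0_norm ?normc_ge0.
rewrite normE (_ : (fun m => normc (z m)) = (fun m => Num.sqrt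
  (complex.Re (z m) * complex.Re (z m) + complex.Im (z m) * complex.Im (z m)))); last first.
  by apply/funext => m; rewrite normE.
apply: (@cvg_comp _ _ _ (fun m => complex.Re (z m) * complex.Re (z m) +
  complex.Im (z m) * complex.Im (z m)) (@Num.sqrt R)); last exact: sqrt_continuous.
by apply: cvgD; apply: cvgM.
Qed.

Lemma complex_dominated (P : nat -> T -> C) (s : T -> C) (g : T -> \bar R) :
  (forall m, Cmeasurable (P m)) -> Cmeasurable s -> mu.-integrable setT g ->
  (\forall x \ae mu, complex.Re (P m x) @[m --> \oo] --> complex.Re (s x) /\
     complex.Im (P m x) @[m --> \oo] --> complex.Im (s x)) ->
  (forall m x, (normc (P m x))%:E <= g x)%E ->
  [/\ Cintegrable mu s,
      complex.Re (Cintegral mu (P m)) @[m --> \oo] --> complex.Re (Cintegral mu s),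
      complex.Im (Cintegral mu (P m)) @[m --> \oo] --> complex.Im (Cintegral mu s) &
      (\int[mu]_x (normc (P m x))%:E)%E @[m --> \oo] --> (\int[mu]_x (normc (s x))%:E)%E].
Proof.
move=> mP ms gi cv dom.
have real_part (f : nat -> T -> R) (h : T -> R) :
    (forall m, measurable_fun setT (f m)) -> measurable_fun setT h ->
    (\forall x \ae mu, f m x @[m --> \oo] --> h x) ->
    (forall m x, `|f m x| <= normc (P m x)) ->
    [/\ mu.-integrable setT (EFin \o h), \int[mu]_x f m x @[m --> \oo] --> \int[mu]_x h x &
     (\int[mu]_x (f m x)%:E)%E @[m --> \oo] --> (\int[mu]_x (h x)%:E)%E].
  move=> mf mh fh fg.
  have mf' m : measurable_fun setT (EFin \o f m) by apply/measurable_EFinP.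
  have mh' : measurable_fun setT (EFin \o h) by apply/measurable_EFinP.
  have fh' : \forall x \ae mu, setT x -> (EFin \o f m) x @[m --> \oo] --> (EFin \o h) x.
    by apply: filterS fh => x fx _; apply: cvg_EFin => //; exact: nearW.
  have fg' : \forall x \ae mu, forall m, setT x -> (`|(EFin \o f m) x| <= g x)%E.
    apply: nearW => x m _; apply: le_trans (dom m x).
    by rewrite lee_fin; exact: fg.
  have [hi _ lim] := dominated_convergence measurableT mf' mh' fh' gi fg'.
  split => //; apply: fine_cvg; rewrite fineK//.
  exact: integrable_fin_num hi.
have [|hr lr _] := real_part (fun m x => complex.Re (P m x)) (fun x => complex.Re (s x))
  (fun m => (mP m).1) ms.1 _ (fun m x => normr_Re _).
  by apply: filterS cv => x [].
have [|hi li _] := real_part (fun m x => complex.Im (P m x)) (fun x => complex.Im (s x))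
  (fun m => (mP m).2) ms.2 _ (fun m x => normr_Im _).
  by apply: filterS cv => x [].
have [||_ _ ln] := real_part (fun m x => normc (P m x)) (fun x => normc (s x))
  (fun m => measurable_normc (mP m)) (measurable_normc ms).
- by apply: filterS cv => x [h1 h2]; exact: cvg_normc.
- by move=> m x; rewrite ger0_norm ?normc_ge0.
by split.
Qed.

Lemma cvg_series_bounded (u : nat -> R) (B : R) :
  (forall m, \sum_(0 <= i < m) `|u i| <= B) -> cvgn (series u).
Proof.
move=> uB; apply: normed_cvg; apply: nondecreasing_is_cvgn.
  apply/nondecreasing_seqP => m.
  change (\sum_(0 <= i < m) `|u i| <= \sum_(0 <= i < m.+1) `|u i|).
  by rewrite big_nat_recr//= lerDl.
by exists B => _ [m _ <-]; exact: uB.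
Qed.

(** A subsequence of the partial sums converges fast in mean square, hence in
mean, and dominatedly almost everywhere. *)
Lemma riesz_fischer a (A : R) : 0 <= A ->
  (\int[@counting Z R]_k (normc (a k) ^+ 2)%:E <= (A ^+ 2)%:E)%E ->
  exists s : T -> C, [/\ Cmeasurable s, Cintegrable mu s,
    (\int[mu]_x (normc (s x))%:E <= A%:E)%E &
    forall k, Cintegral mu (fun x => s x * chi k x) = a k].
Proof.
move=> A0 aA.
have sq0 k : (0 <= (normc (a k) ^+ 2)%:E)%E by rewrite lee_fin sqr_ge0.
pose Sm m : R := \sum_(k <- Zrange n m) normc (a k) ^+ 2.
move: aA; set Se := (\int[counting]_k _)%E => aA.
have Sfin : Se \is a fin_num.
  rewrite ge0_fin_numE; last by apply: integral_ge0.
  by apply: le_lt_trans aA _; rewrite ltry.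
pose S := fine Se.
have SmS (s : seq Z) : uniq s -> \sum_(k <- s) normc (a k) ^+ 2 <= S.
  move=> us; rewrite -lee_fin fineK// -sumEFin.
  exact: sum_le_integral_counting.
have SA : S <= A ^+ 2 by rewrite -lee_fin fineK.
have cvgS : Sm m @[m --> \oo] --> S.
  have := cvg_sum_Zrange sq0; rewrite -/Se -(fineK Sfin) => /fine_cvgP[_].
  by under eq_fun do rewrite sumEFin.
pose eps (i : nat) : R := 1 / (2 ^ i.+1)%:R.
have eps0 i : 0 < eps i by rewrite divr_gt0// ltr0n expn_gt0.
have : forall i, exists m0, forall m, (m0 <= m)%N -> S - Sm m <= eps i ^+ 2.
  move=> i; have e0 : 0 < eps i ^+ 2 by rewrite exprn_gt0.
  have [m0 _ h] := (cvgrPdist_le _ _).1 cvgS _ e0.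
  by exists m0 => m mm; apply: le_trans (h m mm); exact: ler_norm.
move=> /choice[m_ m_P].
(* psi is increasing, beyond each m_ i, and tends to infinity: the partial sums
   up to psi i leave a remainder of norm at most eps i, and exhaust the indices. *)
pose psi i := (i + \sum_(j < i.+1) m_ j)%N.
have psiS i : psi i.+1 = (psi i + (m_ i.+1).+1)%N by rewrite /psi big_ord_recr/=; lia.
have psi_m i : (m_ i <= psi i)%N by rewrite /psi big_ord_recr/=; lia.
pose block i := pmap (@pickle_inv Z) (iota (psi i) (m_ i.+1).+1).
have ublock i : uniq (block i) := pmap_uniq (@pickle_invK Z) (iota_uniq _ _).
have ZrangeS i : Zrange n (psi i.+1) = Zrange n (psi i) ++ block i.
  by rewrite psiS /Zrange iotaD pmap_cat.
pose P i := trigsum a (Zrange n (psi i)).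
pose D i := trigsum a (block i).
have mP i : Cmeasurable (P i) := Cmeasurable_trigsum a _.
have mD i : Cmeasurable (D i) := Cmeasurable_trigsum a _.
have PS i x : P i.+1 x = P i x + D i x by rewrite /P ZrangeS trigsum_cat.
have Dsmall i : (\int[mu]_x (normc (D i x))%:E <= (eps i)%:E)%E.
  apply: trigsum_L1 => //; first exact: ltW.
  have := m_P i _ (psi_m i); apply: le_trans; rewrite lerBrDl.
  have := SmS _ (Zrange_uniq n (psi i.+1)).
  by rewrite ZrangeS big_cat.
have PA i : (\int[mu]_x (normc (P i x))%:E <= A%:E)%E.
  apply: trigsum_L1 => //; first exact: Zrange_uniq.
  by apply: le_trans SA; apply: SmS; exact: Zrange_uniq.
(* G dominates all the P i and is integrable, as the eps i have sum one. *)
pose G x : \bar R := ((normc (P 0%N x))%:E + \sum_(0 <= i <oo) (normc (D i x))%:E)%E.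
have nD0 i x : (0 <= (normc (D i x))%:E)%E by rewrite lee_fin normc_ge0.
have mnD i : measurable_fun setT (fun x => (normc (D i x))%:E) by exact: emeasurable_normc.
have sD0 x : (0 <= \sum_(0 <= i <oo) (normc (D i x))%:E)%E by exact: nneseries_ge0.
have mser : measurable_fun setT (fun x => \sum_(0 <= i <oo) (normc (D i x))%:E)%E.
  by apply: ge0_emeasurable_sum.
have mG : measurable_fun setT G.
  by apply: emeasurable_funD => //; exact: emeasurable_normc.
have G0 x : (0 <= G x)%E by rewrite adde_ge0// lee_fin normc_ge0.
have Gi : mu.-integrable setT G.
  apply/integrableP; split => //.
  rewrite (eq_integral G); last by move=> x _; rewrite gee0_abs.
  rewrite /G ge0_integralD//; last 2 first.
  - by move=> x _; rewrite lee_fin normc_ge0.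
  - exact: emeasurable_normc.
  rewrite lte_add_pinfty//; first exact: le_lt_trans (PA 0%N) (ltry _).
  rewrite integral_nneseries//.
  apply: (@le_lt_trans _ _ (1%:E : \bar R)); last exact: ltry.
  apply: le_trans (epsilon_trick0 xpredT ler01).
  by apply: lee_nneseries => [i _ _|i _]; [exact: integral_ge0|exact: Dsmall].
have dom m x : ((normc (P m x))%:E <= G x)%E.
  apply: (@le_trans _ _ ((normc (P 0%N x))%:E + \sum_(0 <= i < m) (normc (D i x))%:E)%E).
    elim: m => [|m IH]; first by rewrite big_geq// adde0.
    rewrite big_nat_recr//= addeA PS.
    apply: (@le_trans _ _ ((normc (P m x))%:E + (normc (D m x))%:E)%E).
      by rewrite -EFinD lee_fin normcD.
    by rewrite leeD2r.
  by rewrite leeD2l//; exact: nneseries_lim_ge.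
(* The telescoping series of the P i converges where G is finite; elsewhere the
   sequence is replaced by zero, which keeps the limit measurable. *)
pose E := G @^-1` (~` [set +oo%E]).
have mE : measurable E.
  by rewrite -[E]setTI; apply: mG => //; exact: measurableC.
have cvE (f : C -> R) : (forall z w, f (z + w) = f z + f w) ->
    (forall z, `|f z| <= normc z) ->
    forall x, cvgn (fun m => f (P m x) * \1_E x).
  move=> fD fn x; have [xE|xE] := pselect (E x); last first.
    by under eq_fun do rewrite indicE memNset// mulr0; exact: is_cvg_cst.
  under eq_fun do rewrite indicE mem_set// mulr1.
  have -> : (fun m => f (P m x)) = (fun m => f (P 0%N x) + series (fun i => f (D i x)) m).
    apply/funext; elim=> [|m IH]; first by rewrite /series/= big_geq// addr0.
    by rewrite PS fD IH /series/= big_nat_recr//= addrA.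
  apply: is_cvgD; first exact: is_cvg_cst.
  apply: (@cvg_series_bounded _ (fine (G x))) => m.
  have Gf : G x \is a fin_num.
    by rewrite ge0_fin_numE//; rewrite ltey; apply/eqP => h; apply: xE.
  rewrite -lee_fin fineK//.
  apply: (@le_trans _ _ (\sum_(0 <= i < m) (normc (D i x))%:E)%E).
    by rewrite sumEFin lee_fin; apply: ler_sum => i _; exact: fn.
  apply: le_trans (nneseries_lim_ge m _) _; first by move=> i _ _.
  by rewrite leeDr// lee_fin normc_ge0.
have cr := cvE (@complex.Re R) (@ReD R) (@normr_Re R).
have ci := cvE (@complex.Im R) (@ImD R) (@normr_Im R).
pose s x : C := (limn (fun m => complex.Re (P m x) * \1_E x) +i*
                 limn (fun m => complex.Im (P m x) * \1_E x))%C.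
have m1E : measurable_fun setT (\1_E : T -> R) by exact: measurable_indic.
have ms : Cmeasurable s.
  split.
  - apply: (@measurable_fun_cvg _ _ _ _ (fun m x => complex.Re (P m x) * \1_E x)).
      by move=> m; apply: measurable_funM => //; exact: (mP m).1.
    by move=> x _; exact: cr.
  - apply: (@measurable_fun_cvg _ _ _ _ (fun m x => complex.Im (P m x) * \1_E x)).
      by move=> m; apply: measurable_funM => //; exact: (mP m).2.
    by move=> x _; exact: ci.
have ae : \forall x \ae mu, complex.Re (P m x) @[m --> \oo] --> complex.Re (s x) /\
     complex.Im (P m x) @[m --> \oo] --> complex.Im (s x).
  apply: filterS (integrable_ae measurableT Gi) => x /(_ Logic.I) Gf.
  have xE : E x by rewrite /E /= => h; rewrite h in Gf.
  have := cr x; have := ci x; rewrite /s/=.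
  have -> : (fun m => complex.Re (P m x) * \1_E x) = (fun m => complex.Re (P m x)).
    by apply/funext => m; rewrite indicE mem_set// mulr1.
  have -> : (fun m => complex.Im (P m x) * \1_E x) = (fun m => complex.Im (P m x)).
    by apply/funext => m; rewrite indicE mem_set// mulr1.
  by [].
have [si _ _ ln] := complex_dominated mP ms Gi ae dom.
exists s; split => //.
  rewrite -(cvg_lim _ ln)//; apply: lime_le; first by apply/cvg_ex; eexists; exact: ln.
  exact: nearW.
move=> k.
have mchi : Cmeasurable (chi k : T -> C) by exact/Cdiff_measurable/Cdiff_chi.
have mPk m : Cmeasurable (fun x => P m x * chi k x) by exact: CmeasurableM.
have msk : Cmeasurable (fun x => s x * chi k x) by exact: CmeasurableM.
have aek : \forall x \ae mu,
    complex.Re (P m x * chi k x) @[m --> \oo] --> complex.Re (s x * chi k x) /\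
    complex.Im (P m x * chi k x) @[m --> \oo] --> complex.Im (s x * chi k x).
  apply: filterS ae => x [h1 h2]; rewrite ReM ImM; split.
    under eq_fun do rewrite ReM.
    by apply: cvgB; apply: cvgM => //; exact: cvg_cst.
  under eq_fun do rewrite ImM.
  by apply: cvgD; apply: cvgM => //; exact: cvg_cst.
have domk m x : ((normc (P m x * chi k x))%:E <= G x)%E.
  by rewrite normcM normc_chi mulr1.
have [_ lr li _] := complex_dominated mPk msk Gi aek domk.
have cst (m : nat) : ((pickle k).+1 <= m)%N -> Cintegral mu (fun x => P m x * chi k x) = a k.
  move=> km; rewrite Cintegral_trigsum_chi ?Zrange_uniq// mem_Zrange.
  by rewrite (leq_trans km)// /psi leq_addr.
apply/eqP; rewrite eq_complex; apply/andP; split; apply/eqP.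
- rewrite -(cvg_lim _ lr)//; apply: cvg_lim => //; apply: cvg_near_cst.
  by exists (pickle k).+1 => // m /= km; exact: (congr1 (@complex.Re R) (cst m km)).
- rewrite -(cvg_lim _ li)//; apply: cvg_lim => //; apply: cvg_near_cst.
  by exists (pickle k).+1 => // m /= km; exact: (congr1 (@complex.Im R) (cst m km)).
Qed.

End riesz_fischer.

(** * Symbols given by functions *)

Section symbols_as_functions.
Context {R : realType} {n : nat}.
Local Notation Z := 'rV[int]_n.
Local Notation T := 'rV[R]_n.
Local Notation C := R[i].
Local Notation mu := (@haar R n).
Implicit Types (sigma phi : Z * T -> C) (F : (Z * T -> C) -> C).

Lemma integral_muZT (g : Z * T -> \bar R) : measurable_fun setT g ->
  (forall x, 0 <= g x)%E ->
  (\int[muZT]_x g x = \int[counting]_j \int[mu]_x g (j, x))%E.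
Proof. by move=> mg g0; rewrite /muZT fubini_tonelli1. Qed.

Lemma Cmeasurable_slice sigma j : Cmeasurable sigma -> Cmeasurable (fun x => sigma (j, x)).
Proof.
by move=> [h1 h2]; split; [exact: (measurableT_comp h1 (pair1_measurable j))|
  exact: (measurableT_comp h2 (pair1_measurable j))].
Qed.

Lemma Cintegrable_slice sigma j : Cintegrable muZT sigma ->
  Cintegrable mu (fun x => sigma (j, x)).
Proof.
move=> /CintegrableP[ms fs]; apply/CintegrableP; split; first exact: Cmeasurable_slice.
apply: le_lt_trans fs; rewrite integral_muZT; last first.
- by move=> x; rewrite lee_fin normc_ge0.
- exact: emeasurable_normc.
apply: (@le_integral_counting _ _ j (fun j => \int[mu]_x (normc (sigma (j, x)))%:E))%E.
by move=> k; apply: integral_ge0 => x _; rewrite lee_fin normc_ge0.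
Qed.

(** Any function that represents the symbol has the coefficients of the symbol, so
that estimates in terms of these do not depend on its choice. *)
Lemma represents_fourier sigma F j k : represents sigma F ->
  Cintegrable mu (fun x => sigma (j, x) * chi k x) /\
  Cintegral mu (fun x => sigma (j, x) * chi k x) = F (level j (chi k)).
Proof.
move=> /(_ _ (schwartz_level_chi j k))[si ->].
have sE i : (fun x => sigma (i, x) * level j (chi k) (i, x)) =
    (fun x => (i == j)%:R * (sigma (i, x) * chi k x)).
  by apply/funext => x; rewrite levelE mulrCA.
have := Cintegrable_slice j si.
rewrite /= sE eqxx; under eq_fun do rewrite mul1r.
move=> sji; split=> //.
have [_ ->] := Cintegral_prod si.
have [|_ ->] := @Cintegral_counting_pt _ _ j
    (fun i => Cintegral mu (fun x => sigma (i, x) * level j (chi k) (i, x))).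
  move=> i /negbTE ij; rewrite sE ij; under eq_fun do rewrite mul0r.
  exact: Cintegral0.
by rewrite sE eqxx; apply: eq_Cintegral => x; rewrite mul1r.
Qed.

Section square_summable_coefficients.
Variables (F : (Z * T -> C) -> C) (A : R).
Hypotheses (Ft : tempered schwartzZT seminormZT F) (A0 : 0 <= A).

Variable sigma : Z * T -> C.
Hypotheses (msigma : forall j, Cmeasurable (fun x => sigma (j, x)))
  (sigma_le : forall j, (\int[mu]_x (normc (sigma (j, x)))%:E <= A%:E)%E)
  (sigma_chi : forall j k, Cintegral mu (fun x => sigma (j, x) * chi k x) =
                           F (level j (chi k))).

Let smeas : Cmeasurable sigma := Cmeasurable_prodZ msigma.

Let Cmeasurable_schwartz phi : schwartzZT phi -> Cmeasurable phi.
Proof.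
move=> sphi; apply: Cmeasurable_prodZ => j.
by apply: Cdiff_measurable; exact/smooth_Cdiff/schwartz_smooth.
Qed.

Let integral_sphi_le phi B : schwartzZT phi -> schwartz_bounded (n + n) phi B ->
  (\int[muZT]_x (normc (sigma x * phi x))%:E <= (A * 4 ^+ n * B)%:E)%E.
Proof.
move=> sphi hB; have B0 := schwartz_bounded_ge0 hB.
rewrite integral_muZT; last first.
- by move=> x; rewrite lee_fin normc_ge0.
- by apply: emeasurable_normc; apply: CmeasurableM => //; exact: Cmeasurable_schwartz.
apply: (@le_trans _ _ (\int[@counting Z R]_j
    ((A * B)%:E * ((weight j ^+ (n + n))^-1)%:E))%E).
  apply: le_integral_Z => j; first by apply: integral_ge0 => x _; rewrite lee_fin normc_ge0.
  have wj : 0 <= B / (weight j ^+ (n + n)) by rewrite divr_ge0// ltW// weightX_gt0.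
  apply: (@le_trans _ _ (\int[mu]_x ((B / (weight j ^+ (n + n)))%:E *
     (normc (sigma (j, x)))%:E))%E).
    apply: ge0_le_integral => //.
    + by move=> x _; rewrite lee_fin normc_ge0.
    + apply: emeasurable_normc; apply: CmeasurableM => //.
      exact/Cmeasurable_slice/Cmeasurable_schwartz.
    + by apply: measurable_funeM; exact: emeasurable_normc.
    + move=> x _; rewrite -EFinM lee_fin normcM mulrC ler_wpM2r ?normc_ge0//.
      exact: (hB j [::] x).
  rewrite ge0_integralZl//.
  - rewrite -EFinM (_ : A * B * _ = B / weight j ^+ (n + n) * A) 1?[leRHS]EFinM; last by ring.
    by apply: lee_wpmul2l => //; rewrite lee_fin.
  - exact: emeasurable_normc.
  - by move=> x _; rewrite lee_fin normc_ge0.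
rewrite ge0_integralZl//; last 3 first.
- exact: measurable_Z.
- by move=> j _; rewrite lee_fin invr_ge0 ltW// weightX_gt0.
- by rewrite lee_fin mulr_ge0.
rewrite (_ : A * 4 ^+ n * B = (A * B) * 4 ^+ n); last by ring.
rewrite [leRHS]EFinM; apply: lee_wpmul2l; first by rewrite lee_fin mulr_ge0.
exact: weight_summable.
Qed.

Let sphi_integrable phi : schwartzZT phi -> Cintegrable muZT (fun x => sigma x * phi x).
Proof.
move=> sphi; have [B hB] := schwartz_bound (n + n) sphi.
apply/CintegrableP; split; first by apply: CmeasurableM => //; exact: Cmeasurable_schwartz.
by apply: le_lt_trans (integral_sphi_le sphi hB) _; rewrite ltry.
Qed.

(** Both sides are continuous functionals on test functions, so it suffices to
compare them on the characters supported on a single level. *)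
Lemma represents_of_fourier : represents sigma F.
Proof.
move=> phi sphi; split; first exact: sphi_integrable.
pose G psi := Cintegral muZT (fun x => sigma x * psi x).
have Glin : linear_on_schwartz G.
  move=> a f g sf sg; rewrite /G -CintegralZ; last exact: sphi_integrable.
  rewrite -CintegralD; first by apply: eq_Cintegral => x; ring.
  - by apply: CintegrableZ; exact: sphi_integrable.
  - exact: sphi_integrable.
have GB : bounded_by G (n + n) (A * 4 ^+ n).
  move=> f B sf hB; rewrite -lee_fin; apply: le_trans (integral_sphi_le sf hB).
  by apply: normc_Cintegral; exact: sphi_integrable.
have [N [K [K0 FB]]] := tempered_bounded Ft.
have Flin := tempered_linear Ft.
pose D psi := F psi - G psi.
have Dlin : linear_on_schwartz D.
  by move=> a f g sf sg; rewrite /D Flin// Glin//; ring.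
pose M := (n + n + N)%N.
have sbW (N1 : nat) (psi : Z * T -> C) (B : R) : (N1 <= M)%N -> schwartz_bounded M psi B ->
    schwartz_bounded N1 psi B.
  move=> NM hB j; have B0 := schwartz_bounded_ge0 hB.
  apply: (partials_boundedW NM); apply: partials_bounded_le (hB j).
  rewrite ler_wpM2l// lef_pV2 ?posrE ?weightX_gt0//.
  by apply: ler_weXn2l => //; exact: weight_ge1.
have DB : bounded_by D M (K + A * 4 ^+ n).
  move=> f B sf hB; apply: le_trans (normcD _ _) _; rewrite normcN mulrDl lerD//.
    by apply: FB => //; apply: sbW hB; rewrite leq_addl.
  by apply: GB => //; apply: sbW hB; rewrite leq_addr.
suff : D phi = 0 by move/eqP; rewrite subr_eq0 => /eqP.
apply: (functional_eq0 Dlin DB) => //.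
  by rewrite addr_ge0// mulr_ge0// exprn_ge0.
move=> j l; rewrite /D /G; apply/eqP; rewrite subr_eq0 eq_sym; apply/eqP.
have si := sphi_integrable (schwartz_level_chi j l).
have [_ ->] := Cintegral_prod si.
have [|_ ->] := @Cintegral_counting_pt _ _ j
    (fun i => Cintegral mu (fun x => sigma (i, x) * level j (chi l) (i, x))).
  move=> i /negbTE ij; rewrite -[RHS](@Cintegral0 _ _ _ mu).
  by apply: eq_Cintegral => x; rewrite levelE ij mul0r mulr0.
by rewrite -sigma_chi; apply: eq_Cintegral => x; rewrite levelE eqxx mul1r.
Qed.

End square_summable_coefficients.

(** A symbol with square summable coefficients is a function: on each level the
Riesz-Fischer theorem sums its Fourier series. *)
Lemma symbol_representation F (A : R) : tempered schwartzZT seminormZT F -> 0 <= A ->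
  (forall j, (\int[@counting Z R]_k (normc (F (level j (chi k))) ^+ 2)%:E <=
              (A ^+ 2)%:E)%E) ->
  exists sigma, [/\ represents sigma F, Cmeasurable sigma &
    forall j, (\int[mu]_x (normc (sigma (j, x)))%:E <= A%:E)%E].
Proof.
move=> Ft A0 FA.
have [s hs] := choice (fun j => riesz_fischer A0 (FA j)).
pose sigma (y : Z * T) := s y.1 y.2; exists sigma.
have ms j : Cmeasurable (fun x => sigma (j, x)) by have [] := hs j.
split; last by move=> j; have [] := hs j.
- have le j : (\int[mu]_x (normc (sigma (j, x)))%:E <= A%:E)%E by have [] := hs j.
  have ci j k : Cintegral mu (fun x => sigma (j, x) * chi k x) = F (level j (chi k)).
    by have [] := hs j.
  exact: (represents_of_fourier Ft A0 ms le ci).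
- exact: Cmeasurable_prodZ.
Qed.

End symbols_as_functions.

(** * The Hilbert space of square summable sequences *)

Section hilbert_space_of_sequences.
Context {R : realType} {n : nat}.
Local Notation Z := 'rV[int]_n.
Local Notation C := R[i].
Implicit Types f g : ell2 R n.

Let sq_ge0 (h : Z -> C) k : (0 <= (normc (h k) ^+ 2)%:E :> \bar R)%E.
Proof. by rewrite lee_fin sqr_ge0. Qed.

Let CLnorm2 (h : Z -> C) : (CLnorm (@counting Z R) 2%:E h `^ 2 =
  \int[counting]_k (normc (h k) ^+ 2)%:E)%E.
Proof.
rewrite /CLnorm powR_Lnorm//; apply: eq_integral => k _ /=.
by rewrite ger0_norm ?normc_ge0// powR_mulrn// normc_ge0.
Qed.

Lemma ell2_norm_ge0 f : 0 <= ell2_norm f.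
Proof. by apply: fine_ge0; exact: Lnorm_ge0. Qed.

Lemma sqr_ell2_norm f :
  ((ell2_norm f ^+ 2)%:E = \int[@counting Z R]_k (normc (f k) ^+ 2)%:E)%E.
Proof.
rewrite -CLnorm2 -(@fineK _ (CLnorm counting 2%:E f)); last first.
  by rewrite ge0_fin_numE ?Lnorm_ge0//; exact/asboolP/(ell2P f).
by rewrite poweR_EFin powR_mulrn// ell2_norm_ge0.
Qed.

Lemma ell2_norm_le f (A : R) : 0 <= A ->
  (\int[@counting Z R]_k (normc (f k) ^+ 2)%:E <= (A ^+ 2)%:E)%E -> ell2_norm f <= A.
Proof.
by move=> A0; rewrite -sqr_ell2_norm lee_fin ler_sqr ?nnegrE ?ell2_norm_ge0.
Qed.

Lemma square_summableP (h : Z -> C) :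
  (\int[@counting Z R]_k (normc (h k) ^+ 2)%:E < +oo)%E -> square_summable h.
Proof.
by rewrite -CLnorm2 => h2; apply/asboolP; apply: lty_poweRy h2.
Qed.

Lemma normc_ell2_le f k : normc (f k) <= ell2_norm f.
Proof.
rewrite -ler_sqr ?nnegrE ?normc_ge0 ?ell2_norm_ge0// -lee_fin sqr_ell2_norm.
exact: (@le_integral_counting _ _ k (fun k => (normc (f k) ^+ 2)%:E)).
Qed.

Let square_summable_delta (a : Z) : square_summable (fun k : Z => (k == a)%:R : C).
Proof.
apply: square_summableP; rewrite (integral_counting_pt (a := a)) ?ltry//.
  by move=> k; rewrite lee_fin sqr_ge0.
by move=> k /negbTE ->; rewrite normc0 expr0n.
Qed.

Definition ell2_delta (a : Z) : ell2 R n := Ell2 (square_summable_delta a).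

Lemma ell2_combE (s : seq Z) (c : Z -> C) k : uniq s ->
  (\sum_(a <- s) c a *: ell2_delta a) k = if k \in s then c k else 0.
Proof.
move=> us; rewrite -[ell2_fun _]/(\val _) raddf_sum fct_sumE.
rewrite (eq_bigr (fun a => if a == k then c k else 0)); last first.
  move=> a _; rewrite -[LHS]/(c a * (k == a)%:R) eq_sym.
  by case: eqP => [->|_]; rewrite ?mulr1 ?mulr0.
rewrite -big_mkcond/=; case: ifPn => ks.
  by rewrite -big_filter filter_pred1_uniq// big_seq1.
by rewrite big_seq_cond big1// => a /andP[sa /eqP ak]; rewrite -ak sa in ks.
Qed.

Lemma ell2_truncation f (eps : R) : 0 < eps ->
  exists s, uniq s /\ ell2_norm (f - \sum_(a <- s) f a *: ell2_delta a) <= eps.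
Proof.
move=> eps0; pose F k : \bar R := (normc (f k) ^+ 2)%:E.
have cvF : \sum_(k <- Zrange n m) normc (f k) ^+ 2 @[m --> \oo] --> ell2_norm f ^+ 2.
  rewrite (_ : (fun _ => _) = fine \o (fun m => \sum_(k <- Zrange n m) F k)%E); last first.
    by apply/funext => m /=; rewrite sumEFin.
  apply: fine_cvg; rewrite sqr_ell2_norm.
  by apply: (@cvg_sum_Zrange _ _ F) => k; exact: sq_ge0.
have e2 : 0 < eps ^+ 2 by rewrite exprn_gt0.
have /cvgrPdist_le/(_ _ e2)[m _ /(_ m (leqnn m))/=] := cvF.
move=> hm; exists (Zrange n m); split; first exact: Zrange_uniq.
apply: ell2_norm_le; first exact: ltW.
set g := (f - _).
have gE k : g k = if k \in Zrange n m then 0 else f k.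
  rewrite -[LHS]/(f k - (\sum_(a <- Zrange n m) f a *: ell2_delta a) k).
  by rewrite ell2_combE ?Zrange_uniq//; case: ifP => _; rewrite ?subrr ?subr0.
pose S : R := \sum_(k <- Zrange n m) normc (f k) ^+ 2.
have : (\int[@counting Z R]_k (normc (g k) ^+ 2)%:E + S%:E = (ell2_norm f ^+ 2)%:E)%E.
  rewrite sqr_ell2_norm.
  have -> : S%:E = (\int[@counting Z R]_k
      (if k \in Zrange n m then (normc (f k) ^+ 2)%:E else 0))%E.
    rewrite (@integral_counting_seq _ _ (Zrange n m)) ?Zrange_uniq//.
    - rewrite /S -sumEFin big_seq [RHS]big_seq; apply: eq_bigr => k ks.
      by rewrite ks.
    - by move=> k; case: ifP.
    - by move=> k /negbTE ->.
  rewrite -[LHS]ge0_integralD//; last 3 first.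
  - exact: measurable_Z.
  - by move=> k _; case: ifP.
  - exact: measurable_Z.
  apply: eq_integral => k _; rewrite gE; case: ifP => _; last by rewrite adde0.
  by rewrite normc0 expr0n/= add0e.
move=> E; rewrite -(@leeD2rE _ S%:E)// E -EFinD lee_fin -lerBlDr.
by apply: le_trans hm; exact: ler_norm.
Qed.

Section functional.
Variables (Lam : ell2 R n -> C) (M : R).
Hypotheses (Lin : forall a f g, Lam (a *: f + g) = a * Lam f + Lam g)
  (LamM : forall f, normc (Lam f) <= M * ell2_norm f).

Let Lam0 : Lam 0 = 0.
Proof. by have := Lin (-1) 0 0; rewrite scaler0 addr0 mulN1r addNr. Qed.

Let LamB f g : Lam (f - g) = Lam f - Lam g.
Proof. by rewrite -scaleN1r addrC Lin mulN1r addrC. Qed.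

Let Lam_comb (s : seq Z) (c : Z -> C) :
  Lam (\sum_(a <- s) c a *: ell2_delta a) = \sum_(a <- s) c a * Lam (ell2_delta a).
Proof. by elim: s => [|a s IH]; rewrite ?big_nil ?Lam0// !big_cons Lin IH. Qed.

(** The bound need only be tested on the canonical basis: Cauchy-Schwarz handles
finite combinations, and these are dense. *)
Lemma ell2_functional_le (kappa : Z -> R) (K : R) : 0 <= K ->
  (forall a, normc (Lam (ell2_delta a)) <= kappa a) ->
  (\int[@counting Z R]_a (kappa a ^+ 2)%:E <= (K ^+ 2)%:E)%E ->
  forall f, normc (Lam f) <= K * ell2_norm f.
Proof.
move=> K0 Lk kK f.
have M0 : 0 <= `|M| by [].
apply/ler_addgt0Pr => e e0.
have e'0 : 0 < e / (`|M| + 1) by rewrite divr_gt0// ltr_wpDl.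
have [s [us hs]] := ell2_truncation f e'0.
set g := \sum_(a <- s) _ in hs.
have -> : Lam f = Lam g + Lam (f - g) by rewrite LamB addrC subrK.
apply: le_trans (normcD _ _) _; apply: lerD; last first.
  apply: le_trans (LamM _) _; apply: (@le_trans _ _ (`|M| * (e / (`|M| + 1)))).
    apply: (@le_trans _ _ (`|M| * ell2_norm (f - g))).
      by apply: ler_wpM2r; [exact: ell2_norm_ge0|exact: ler_norm].
    exact: ler_wpM2l.
  rewrite mulrCA ger_pMr// ler_pdivrMr ?ltr_wpDl// mul1r lerDl//.
rewrite /g Lam_comb; apply: le_trans (normc_sum _ _ _) _.
rewrite mulrC; apply: (@le_trans _ _ (\sum_(a <- s) `|normc (f a) * kappa a|)).
  apply: ler_sum => a _; rewrite normcM; apply: le_trans (ler_norm _).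
  by apply: ler_wpM2l; [exact: normc_ge0|exact: Lk].
rewrite -lee_fin -sumEFin.
have h0 k : (0 <= `|normc (f k) * kappa k|%:E)%E by rewrite lee_fin.
apply: le_trans (sum_le_integral_counting us h0) _.
apply: cauchy_schwarz_integral => //; try exact: measurable_Z.
- exact: ell2_norm_ge0.
- by rewrite sqr_ell2_norm.
Qed.

End functional.

End hilbert_space_of_sequences.

(** * The short-time Fourier transform of a sequence *)

Section short_time_fourier_transform.
Context {R : realType} {n : nat}.
Local Notation Z := 'rV[int]_n.
Local Notation T := 'rV[R]_n.
Local Notation C := R[i].
Local Notation cnt := (@counting Z R).

(** Cauchy-Schwarz for the measure of density x. *)
Lemma weighted_cauchy_schwarz (x y : Z -> R) (X t : R) :
  (forall k, 0 <= x k) -> (forall k, 0 <= y k) -> 0 < X -> 0 <= t ->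
  (\int[cnt]_k (x k)%:E <= X%:E)%E -> (t%:E <= \int[cnt]_k (x k * y k)%:E)%E ->
  ((t ^+ 2)%:E <= X%:E * \int[cnt]_k (x k * y k ^+ 2)%:E)%E.
Proof.
move=> x0 y0 X0 t0 xX ht.
have S0 : (0 <= \int[cnt]_k (x k * y k ^+ 2)%:E)%E.
  by apply: integral_ge0 => k _; rewrite lee_fin mulr_ge0// sqr_ge0.
have [->|Soo] := eqVneq (\int[cnt]_k (x k * y k ^+ 2)%:E)%E +oo%E.
  by rewrite gt0_muley ?lte_fin// leey.
have Sfin : (\int[cnt]_k (x k * y k ^+ 2)%:E)%E \is a fin_num.
  by rewrite ge0_fin_numE// ltey.
set S := (\int[cnt]_k _)%E in Sfin S0 *.
have s0 : 0 <= fine S by exact: fine_ge0.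
have h : (\int[cnt]_k `|Num.sqrt (x k) * (Num.sqrt (x k) * y k)|%:E <=
    (Num.sqrt X * Num.sqrt (fine S))%:E)%E.
  apply: cauchy_schwarz_integral; rewrite ?sqrtr_ge0//; try exact: measurable_Z.
    rewrite sqr_sqrtr; last exact: ltW.
    by apply: le_trans xX; apply: le_integral_Z => k; rewrite sqr_sqrtr ?lee_fin.
  rewrite sqr_sqrtr// fineK//.
  by apply: le_integral_Z => k; rewrite exprMn sqr_sqrtr ?lee_fin ?mulr_ge0// sqr_ge0.
have : (t%:E <= (Num.sqrt X * Num.sqrt (fine S))%:E)%E.
  apply: le_trans ht _; apply: le_trans h; apply: le_integral_Z => k.
    by rewrite lee_fin mulr_ge0.
  by rewrite mulrA -expr2 sqr_sqrtr// lee_fin ler_norm.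
rewrite lee_fin => tS; rewrite -(fineK Sfin) -EFinM lee_fin.
apply: (@le_trans _ _ ((Num.sqrt X * Num.sqrt (fine S)) ^+ 2)).
  by rewrite ler_sqr ?nnegrE// mulr_ge0// sqrtr_ge0.
by rewrite exprMn !sqr_sqrtr// ltW.
Qed.

Lemma Cmeasurable_Cintegral_counting d (X : measurableType d) (F : X * Z -> C) :
  (forall k, Cmeasurable (fun x => F (x, k))) ->
  Cmeasurable (fun x => Cintegral cnt (fun k => F (x, k))).
Proof.
move=> mF; have key (h : X * Z -> R) : (forall k, measurable_fun setT (fun x => h (x, k))) ->
    measurable_fun setT (fun x => \int[cnt]_k h (x, k)).
  move=> mh; rewrite /Rintegral.
  apply: (@measurableT_comp _ _ _ _ _ _ (@fine R)) => //.
  under eq_fun do rewrite integralE.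
  apply: emeasurable_funB.
  - apply: (@measurable_integral2 _ _ _ _ _ cnt
      (fun x k => ((fun k => (h (x, k))%:E)^\+ k)%E)) => //.
    apply: measurable_prodZr => k; under eq_fun do rewrite /= funeposE.
    by apply: measurable_maxe => //; exact/measurable_EFinP.
  - apply: (@measurable_integral2 _ _ _ _ _ cnt
      (fun x k => ((fun k => (h (x, k))%:E)^\- k)%E)) => //.
    apply: measurable_prodZr => k; under eq_fun do rewrite /= funenegE.
    apply: measurable_maxe => //; apply: measurableT_comp => //.
    exact/measurable_EFinP.
split.
- by apply: (key (fun y => complex.Re (F y))) => k; have [] := mF k.
- by apply: (key (fun y => complex.Im (F y))) => k; have [] := mF k.
Qed.

Lemma integral_shift_le (h : Z -> \bar R) (m : Z) : (forall k, 0 <= h k)%E ->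
  (\int[cnt]_k h (k - m)%R <= \int[cnt]_k h k)%E.
Proof. by move=> h0; apply: (@integral_counting_inj _ _ _ (fun k => k - m)) => // x y /addIr. Qed.

Lemma integral_reflect_le (h : Z -> \bar R) (m : Z) : (forall k, 0 <= h k)%E ->
  (\int[cnt]_k h (m - k)%R <= \int[cnt]_k h k)%E.
Proof.
move=> h0; apply: (@integral_counting_inj _ _ _ (fun k => m - k)) => // x y.
by move/addrI/oppr_inj.
Qed.

Section window.
Variables (g : Z -> C) (G : R).
Hypotheses (G0 : 0 < G) (gG : (\int[cnt]_k (normc (g k))%:E <= G%:E)%E).

Let ng0 k : (0 <= (normc (g k))%:E :> \bar R)%E. Proof. by rewrite lee_fin normc_ge0. Qed.

Lemma normc_window_le k : normc (g k) <= G.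
Proof.
rewrite -lee_fin; apply: le_trans gG.
exact: (@le_integral_counting _ _ k (fun k => (normc (g k))%:E)).
Qed.

Let normc_atom f m w k : normc (f k * ((modulation w (translation m g) k)^*)%C) =
  normc (g (k - m)) * normc (f k).
Proof. by rewrite normcM normc_conj normcM normc_expi2pi mul1r mulrC. Qed.

Lemma stft_integrable (f : ell2 R n) m (w : T) :
  Cintegrable cnt (fun k => f k * ((modulation w (translation m g) k)^*)%C).
Proof.
apply/CintegrableP; split; first exact: Cmeasurable_Z.
under eq_integral do rewrite normc_atom.
apply: (@le_lt_trans _ _ (\int[cnt]_k ((ell2_norm f)%:E * (normc (g (k - m)))%:E)))%E.
  apply: le_integral_Z => k; first by rewrite lee_fin mulr_ge0 ?normc_ge0.
  by rewrite -EFinM lee_fin mulrC ler_wpM2r ?normc_ge0 ?normc_ell2_le.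
rewrite ge0_integralZl//; last 2 first.
- exact: measurable_Z.
- by rewrite lee_fin ell2_norm_ge0.
apply: (@le_lt_trans _ _ ((ell2_norm f)%:E * G%:E)%E); last by rewrite -EFinM ltry.
apply: lee_wpmul2l; first by rewrite lee_fin ell2_norm_ge0.
by apply: le_trans gG; exact: (@integral_shift_le (fun k => (normc (g k))%:E)).
Qed.

Lemma stft_linear a (f f' : ell2 R n) m (w : T) :
  stft g (a *: f + f') m w = a * stft g f m w + stft g f' m w.
Proof.
rewrite /stft -CintegralZ; last exact: stft_integrable.
rewrite -CintegralD; last exact: stft_integrable.
  by apply: eq_Cintegral => k; rewrite -[ell2_fun _ k]/(a * f k + f' k); ring.
by apply: CintegrableZ; exact: stft_integrable.
Qed.

Lemma stft_delta a m (w : T) :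
  stft g (ell2_delta a) m w = ((chi a w * g (a - m))^*)%C.
Proof.
have [|_ h] := @Cintegral_counting_pt R _ a
  (fun k => (ell2_delta a : ell2 R n) k * ((modulation w (translation m g) k)^*)%C).
  by move=> k /negbTE ka; rewrite /= ka mul0r.
by rewrite /stft h /= eqxx mul1r.
Qed.

Lemma Cmeasurable_stft (f : Z -> C) : Cmeasurable (fun x : Z * T => stft g f x.1 x.2).
Proof.
apply: Cmeasurable_prodZ => m.
apply: (@Cmeasurable_Cintegral_counting _ T
  (fun y => f y.2 * ((modulation y.1 (translation m g) y.2)^*)%C)) => k /=.
apply: CmeasurableM; first exact: Cmeasurable_cst.
apply: Cmeasurable_conj; apply: CmeasurableM; last exact: Cmeasurable_cst.
exact: (Cdiff_measurable (Cdiff_chi k)).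
Qed.

(** Young's inequality for the product of an integrable and a square integrable
sequence, in the form of a majorant independent of the frequency. *)
Lemma stft_majorant (f : ell2 R n) : exists v : Z -> R,
  [/\ forall m, 0 <= v m, forall m w, normc (stft g f m w) <= v m &
      (\int[cnt]_m (v m ^+ 2)%:E <= ((G * ell2_norm f) ^+ 2)%:E)%E].
Proof.
pose Q m : \bar R := (\int[cnt]_k (normc (g (k - m)) * normc (f k) ^+ 2)%:E)%E.
have Q0 m : (0 <= Q m)%E.
  by apply: integral_ge0 => k _; rewrite lee_fin mulr_ge0 ?normc_ge0 ?sqr_ge0.
have QG : (\int[cnt]_m Q m <= (G * ell2_norm f ^+ 2)%:E)%E.
  rewrite tonelliZZ; last by move=> m k; rewrite lee_fin mulr_ge0 ?normc_ge0 ?sqr_ge0.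
  rewrite EFinM sqr_ell2_norm -ge0_integralZl//; last 3 first.
  - exact: measurable_Z.
  - by move=> k _; rewrite lee_fin sqr_ge0.
  - by rewrite lee_fin ltW.
  apply: le_integral_Z => k.
    by apply: integral_ge0 => m _; rewrite lee_fin mulr_ge0 ?normc_ge0 ?sqr_ge0.
  under eq_integral do rewrite EFinM.
  rewrite ge0_integralZr//; last 2 first.
  - exact: measurable_Z.
  - by rewrite lee_fin sqr_ge0.
  apply: lee_wpmul2r; first by rewrite lee_fin sqr_ge0.
  by apply: le_trans gG; exact: (@integral_reflect_le (fun k => (normc (g k))%:E)).
have Qfin m : Q m \is a fin_num.
  rewrite ge0_fin_numE//; apply: le_lt_trans (ltry (G * ell2_norm f ^+ 2)).
  by apply: le_trans QG; exact: (@le_integral_counting _ _ m Q).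
pose v m := Num.sqrt (G * fine (Q m)).
have v0 m : 0 <= G * fine (Q m) by rewrite mulr_ge0 ?fine_ge0// ltW.
exists v; split=> [m|m w|]; first exact: sqrtr_ge0.
  rewrite /v -ler_sqr ?nnegrE ?normc_ge0 ?sqrtr_ge0// [leRHS]sqr_sqrtr// -lee_fin.
  rewrite [leRHS]EFinM fineK//.
  apply: weighted_cauchy_schwarz => //; try by move=> k; exact: normc_ge0.
  - exact: normc_ge0.
  - by apply: le_trans gG; exact: (@integral_shift_le (fun k => (normc (g k))%:E)).
  - apply: le_trans (normc_Cintegral (stft_integrable f m w)) _.
    by under eq_integral do rewrite normc_atom.
under eq_integral do rewrite sqr_sqrtr// EFinM fineK//.
rewrite ge0_integralZl//; last 2 first.
- exact: measurable_Z.
- by rewrite lee_fin ltW.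
rewrite (_ : (G * ell2_norm f) ^+ 2 = G * (G * ell2_norm f ^+ 2)); last by ring.
by rewrite [leRHS]EFinM; apply: lee_wpmul2l => //; rewrite lee_fin ltW.
Qed.

End window.

End short_time_fourier_transform.

(** * The matrix of a localization operator *)

Section kernel_estimates.
Context {R : realType} {n : nat}.
Local Notation Z := 'rV[int]_n.
Local Notation T := 'rV[R]_n.
Local Notation C := R[i].
Local Notation cnt := (@counting Z R).
Local Notation mu := (@haar R n).

Lemma Cintegrable_inner (f h : ell2 R n) : Cintegrable cnt (fun k => f k * ((h k)^*)%C) /\
  normc (ell2_inner f h) <= ell2_norm f * ell2_norm h.
Proof.
have le : (\int[cnt]_k (normc (f k * ((h k)^*)%C))%:E <= (ell2_norm f * ell2_norm h)%:E)%E.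
  apply: (@le_trans _ _ (\int[cnt]_k `|normc (f k) * normc (h k)|%:E)%E).
    apply: le_integral_Z => k; first by rewrite lee_fin normc_ge0.
    by rewrite normcM normc_conj lee_fin ler_norm.
  apply: cauchy_schwarz_integral; rewrite ?ell2_norm_ge0 ?sqr_ell2_norm//;
    exact: measurable_Z.
have i : Cintegrable cnt (fun k => f k * ((h k)^*)%C).
  apply/CintegrableP; split; first exact: Cmeasurable_Z.
  by apply: le_lt_trans le _; rewrite ltry.
split=> //; rewrite -lee_fin; apply: le_trans le; exact: normc_Cintegral.
Qed.

Lemma ell2_inner_conj_linear a (f h h' : ell2 R n) :
  ell2_inner f (a *: h + h') = (a^*)%C * ell2_inner f h + ell2_inner f h'.
Proof.
rewrite /ell2_inner -CintegralZ; last by have [] := Cintegrable_inner f h.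
rewrite -CintegralD; last by have [] := Cintegrable_inner f h'.
  apply: eq_Cintegral => k; rewrite -[ell2_fun (_ + _) k]/(a * h k + h' k).
  by rewrite rmorphD rmorphM/=; ring.
by apply: CintegrableZ; have [] := Cintegrable_inner f h.
Qed.

Lemma ell2_inner_delta (f : ell2 R n) b : ell2_inner f (ell2_delta b) = f b.
Proof.
rewrite /ell2_inner; have [|_ ->] := @Cintegral_counting_pt R _ b
  (fun k => f k * (((ell2_delta b : ell2 R n) k)^*)%C).
  by move=> k /negbTE kb; rewrite /= kb conjc0 mulr0.
by rewrite /= eqxx conjc1 mulr1.
Qed.

Section windows.
Variables (g1 g2 : Z -> C) (G1 G2 : R).
Hypotheses (G10 : 0 < G1) (G20 : 0 < G2).
Hypotheses (gG1 : (\int[cnt]_k (normc (g1 k))%:E <= G1%:E)%E)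
           (gG2 : (\int[cnt]_k (normc (g2 k))%:E <= G2%:E)%E).

(** The matrix of the localization operator is Hilbert-Schmidt: by Cauchy-Schwarz
its Hilbert-Schmidt norm is at most the product of the l^1 norms of the windows
and of the l^2 norm of the coefficients of the symbol. *)
Lemma hilbert_schmidt_kernel (c : Z -> Z -> C) (S : R) : 0 <= S ->
  (\int[cnt]_m \int[cnt]_k (normc (c m k) ^+ 2)%:E <= S%:E)%E ->
  exists (kappa : Z -> Z -> R) (r : Z -> R) (D : R), [/\ 0 <= D, forall b, 0 <= r b,
    forall b a t, 0 <= t -> (t%:E <= \int[cnt]_m
      (normc (g1 (a - m)) * (normc (g2 (b - m)) * normc (c m (b - a))))%:E)%E ->
      t <= kappa b a,
    forall b, (\int[cnt]_a (kappa b a ^+ 2)%:E <= (r b ^+ 2)%:E)%E &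
    (\int[cnt]_b (r b ^+ 2)%:E <= (D ^+ 2)%:E)%E].
Proof.
(* Q dominates the squared entries: Cauchy-Schwarz in m with weight |g1(a - m)| gives
   one factor G1, and the bounds |g1| <= G1, |g2| <= G2 give the other two. *)
move=> S0 cS; pose K := G1 * (G1 * G2); have K0 : 0 < K by rewrite !mulr_gt0.
have t0 b m k : 0 <= normc (g2 (b - m)) * normc (c m k) ^+ 2.
  by rewrite mulr_ge0 ?normc_ge0 ?sqr_ge0.
pose Q b a : \bar R := (K%:E * \int[cnt]_m
  (normc (g2 (b - m)) * normc (c m (b - a)) ^+ 2)%:E)%E.
have Q0 b a : (0 <= Q b a)%E.
  rewrite /Q mule_ge0//; first by rewrite lee_fin ltW.
  by apply: integral_ge0 => m _; rewrite lee_fin.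
pose P b : \bar R := (\int[cnt]_a Q b a)%E.
have P0 b : (0 <= P b)%E by apply: integral_ge0.
have KG0 : 0 <= K * (G2 * S) by apply: mulr_ge0; [exact: ltW|apply: mulr_ge0 => //; exact: ltW].
have Ple b : (P b <= K%:E * \int[cnt]_m ((normc (g2 (b - m)))%:E *
    \int[cnt]_k (normc (c m k) ^+ 2)%:E))%E.
  rewrite /P /Q ge0_integralZl//; last 3 first.
  - exact: measurable_Z.
  - by move=> a _; apply: integral_ge0 => m _; rewrite lee_fin.
  - by rewrite lee_fin ltW.
  apply: lee_wpmul2l; first by rewrite lee_fin ltW.
  rewrite tonelliZZ; last by move=> a m; rewrite lee_fin.
  apply: le_integral_Z => m; first by apply: integral_ge0 => a _; rewrite lee_fin.
  under eq_integral do rewrite EFinM.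
  rewrite ge0_integralZl//; last 3 first.
  - exact: measurable_Z.
  - by move=> a _; rewrite lee_fin sqr_ge0.
  - by rewrite lee_fin normc_ge0.
  apply: lee_wpmul2l; first by rewrite lee_fin normc_ge0.
  apply: (@integral_reflect_le _ _ (fun k => (normc (c m k) ^+ 2)%:E)) => k.
  by rewrite lee_fin sqr_ge0.
have PK : (\int[cnt]_b P b <= (K * (G2 * S))%:E)%E.
  apply: le_trans (le_integral_Z P0 Ple) _.
  have c0 m : (0 <= \int[cnt]_k (normc (c m k) ^+ 2)%:E)%E.
    by apply: integral_ge0 => k _; rewrite lee_fin sqr_ge0.
  rewrite ge0_integralZl//; last 3 first.
  - exact: measurable_Z.
  - move=> b _; apply: integral_ge0 => m _.
    by rewrite mule_ge0// lee_fin normc_ge0.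
  - by rewrite lee_fin ltW.
  rewrite [leRHS]EFinM; apply: lee_wpmul2l; first by rewrite lee_fin ltW.
  rewrite tonelliZZ; last by move=> b m; rewrite mule_ge0// lee_fin normc_ge0.
  rewrite [leRHS]EFinM.
  apply: (@le_trans _ _ (G2%:E * \int[cnt]_m \int[cnt]_k (normc (c m k) ^+ 2)%:E)%E);
    last by apply: lee_wpmul2l => //; rewrite lee_fin ltW.
  rewrite -[leRHS]ge0_integralZl//; last 2 first.
  - exact: measurable_Z.
  - by rewrite lee_fin ltW.
  apply: le_integral_Z => m.
    by apply: integral_ge0 => b _; rewrite mule_ge0// lee_fin normc_ge0.
  rewrite ge0_integralZr//; last 2 first.
  - exact: measurable_Z.
  - by move=> b _; rewrite lee_fin normc_ge0.
  apply: lee_wpmul2r => //; apply: le_trans gG2.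
  apply: (@integral_shift_le _ _ (fun k => (normc (g2 k))%:E)) => k.
  by rewrite lee_fin normc_ge0.
have Pfin b : P b \is a fin_num.
  rewrite ge0_fin_numE//; apply: le_lt_trans (ltry (K * (G2 * S))).
  by apply: le_trans PK; exact: (@le_integral_counting _ _ b P).
have Qfin b a : Q b a \is a fin_num.
  rewrite ge0_fin_numE//; have := Pfin b; rewrite ge0_fin_numE//; apply: le_lt_trans.
  exact: (@le_integral_counting _ _ a (Q b)).
exists (fun b a => Num.sqrt (fine (Q b a))), (fun b => Num.sqrt (fine (P b))).
exists (Num.sqrt (K * (G2 * S))); split=> [|b|b a t tge ht|b|].
- exact: sqrtr_ge0.
- exact: sqrtr_ge0.
- rewrite -ler_sqr ?nnegrE ?sqrtr_ge0// [leRHS]sqr_sqrtr ?fine_ge0//.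
  rewrite -lee_fin fineK//.
  have h := weighted_cauchy_schwarz (x := fun m => normc (g1 (a - m)))
    (y := fun m => normc (g2 (b - m)) * normc (c m (b - a)))
    (fun m => normc_ge0 _) (fun m => mulr_ge0 (normc_ge0 _) (normc_ge0 _)) G10 tge.
  apply: le_trans (h _ ht) _.
    apply: le_trans gG1; apply: (@integral_reflect_le _ _ (fun k => (normc (g1 k))%:E)) => k.
    by rewrite lee_fin normc_ge0.
  rewrite /Q /K EFinM -muleA; apply: lee_wpmul2l; first by rewrite lee_fin ltW.
  rewrite -ge0_integralZl//; last 3 first.
  - exact: measurable_Z.
  - by move=> m _; rewrite lee_fin.
  - by rewrite lee_fin mulr_ge0// ltW.
  apply: le_integral_Z => m; first by rewrite lee_fin mulr_ge0 ?normc_ge0// sqr_ge0.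
  rewrite -EFinM lee_fin exprMn [normc (g2 _) ^+ 2]expr2 -[leRHS]mulrA.
  apply: ler_pM; rewrite ?normc_ge0 ?mulr_ge0 ?normc_ge0 ?sqr_ge0//.
    exact: (normc_window_le gG1).
  rewrite -[leLHS]mulrA; apply: ler_wpM2r; first exact: t0.
  exact: (normc_window_le gG2).
- under eq_integral do rewrite sqr_sqrtr ?fine_ge0// fineK//.
  by rewrite sqr_sqrtr ?fine_ge0// fineK.
- under eq_integral do rewrite sqr_sqrtr ?fine_ge0// fineK//.
  by rewrite sqr_sqrtr.
Qed.

Section symbol.
Variables (sigma : Z * T -> C) (F : (Z * T -> C) -> C).

Definition weak_integrand (f h : ell2 R n) (x : Z * T) : C :=
  sigma x * stft g1 f x.1 x.2 * ((stft g2 h x.1 x.2)^*)%C.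

Definition weak_form (f h : ell2 R n) : C := Cintegral muZT (weak_integrand f h).

(** The transforms of basis vectors are characters in w, so the integral over the
torus is a coefficient of the symbol. *)
Lemma weak_form_delta_le a b : represents sigma F ->
  Cintegrable muZT (weak_integrand (ell2_delta a) (ell2_delta b)) ->
  ((normc (weak_form (ell2_delta a) (ell2_delta b)))%:E <= \int[cnt]_m
    (normc (g1 (a - m)) * (normc (g2 (b - m)) * normc (F (level m (chi (b - a))))))%:E)%E.
Proof.
move=> sF si; have [i E] := Cintegral_prod si.
rewrite /weak_form [X in normc X]E.
apply: le_trans (normc_Cintegral i) _.
apply: le_integral_Z => m; first by rewrite lee_fin normc_ge0.
have [smi sm] := represents_fourier m (b - a) sF.
rewrite (@eq_Cintegral _ _ _ mu _ (fun w => (((g1 (a - m))^*)%C * g2 (b - m)) *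
    (sigma (m, w) * chi (b - a) w))); last first.
  move=> w; rewrite /weak_integrand !stft_delta chiD chiN conjcK rmorphM/=; ring.
by rewrite CintegralZ// sm !normcM normc_conj mulrA.
Qed.

End symbol.

End windows.

End kernel_estimates.

(** * Localization operators *)

Section bounded_operators.
Context {R : realType} {n : nat}.

Lemma ell2_ballE (f : ell2 R n) e : ball f e = [set h | ell2_norm (f - h) < e].
Proof. by rewrite ballEmdist. Qed.

Lemma bounded_continuous (L : {linear ell2 R n -> ell2 R n}) (M : R) : 0 <= M ->
  (forall f, ell2_norm (L f) <= M * ell2_norm f) -> continuous L.
Proof.
move=> M0 hM f U /nbhs_ballP[e /= e0 eU].
have M1 : 0 < M + 1 by rewrite ltr_wpDl.
apply/nbhs_ballP; exists (e / (M + 1)); first by rewrite /= divr_gt0.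
move=> h fh; apply: eU; move: fh.
rewrite !ell2_ballE /= -linearB => fh; apply: le_lt_trans (hM _) _.
apply: (@le_lt_trans _ _ ((M + 1) * ell2_norm (f - h))).
  by apply: ler_wpM2r; [exact: ell2_norm_ge0|rewrite lerDl].
by rewrite mulrC -ltr_pdivlMr.
Qed.

Lemma continuous_bounded (L : {linear ell2 R n -> ell2 R n}) : continuous L ->
  exists M : R, 0 <= M /\ forall f, ell2_norm (L f) <= M * ell2_norm f.
Proof.
move=> Lc; have L0 : L 0 = 0 by exact: linear0.
have /nbhs_ballP[d /= d0 hd] : nbhs (0 : ell2 R n) (L @^-1` ball (0 : ell2 R n) 1).
  by apply: Lc; rewrite L0; apply: nbhsx_ballx.
have {}hd h : ell2_norm h < d -> ell2_norm (L h) < 1.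
  have norm0B (h' : ell2 R n) : ell2_norm (0 - h') = ell2_norm h'.
    by rewrite sub0r -scaleN1r ell2_normZ normcN normc1 mul1r.
  move=> hl; by have := hd h; rewrite /preimage /= !ell2_ballE /= !norm0B; exact.
exists (2 / d); split=> [|f]; first by rewrite divr_ge0// ltW.
have [f0|f0] := eqVneq (ell2_norm f) 0.
  by rewrite (ell2_norm0_eq0 f0) linear0 -(scale0r (0 : ell2 R n)) !ell2_normZ
    normc0 !mul0r mulr0.
have fp : 0 < ell2_norm f by rewrite lt_neqAle eq_sym f0 ell2_norm_ge0.
pose t := d / (2 * ell2_norm f).
have t0 : 0 < t by rewrite divr_gt0// mulr_gt0.
have nt : normc ((t%:C)%C) = t by rewrite normc_real gtr0_norm.
have := hd ((t%:C)%C *: f); rewrite linearZ/= !ell2_normZ nt.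
have -> : t * ell2_norm f = d / 2 by rewrite /t; field; rewrite gt_eqF.
rewrite ltr_pdivrMr// ltr_pMr// ltr1n => /(_ isT)/ltW.
by rewrite -ler_pdivlMl// mulr1 /t invf_div mulrAC.
Qed.

End bounded_operators.

Section localization.
Context {R : realType} {n : nat}.
Local Notation Z := 'rV[int]_n.
Local Notation T := 'rV[R]_n.
Local Notation C := R[i].
Local Notation cnt := (@counting Z R).
Local Notation mu := (@haar R n).
Variables (g1 g2 : Z -> C) (G1 G2 : R).
Hypotheses (G10 : 0 < G1) (G20 : 0 < G2).
Hypotheses (gG1 : (\int[cnt]_k (normc (g1 k))%:E <= G1%:E)%E)
           (gG2 : (\int[cnt]_k (normc (g2 k))%:E <= G2%:E)%E).
Variables (F : (Z * T -> C) -> C) (S : R).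
Hypotheses (S0 : 0 <= S)
  (FS : (\int[cnt]_m \int[cnt]_k (normc (F (level m (chi k))) ^+ 2)%:E <= S%:E)%E).

Let weak_form_pointwise : exists (r : Z -> R) (D : R), [/\ 0 <= D, forall b, 0 <= r b,
  (\int[cnt]_b (r b ^+ 2)%:E <= (D ^+ 2)%:E)%E &
  forall sigma b (Lam : ell2 R n -> C) (M : R), represents sigma F ->
    (forall a f h, Lam (a *: f + h) = a * Lam f + Lam h) ->
    (forall f, normc (Lam f) <= M * ell2_norm f) ->
    (forall f, Cintegrable muZT (weak_integrand g1 g2 sigma f (ell2_delta b)) /\
      Lam f = weak_form g1 g2 sigma f (ell2_delta b)) ->
    forall f, normc (Lam f) <= r b * ell2_norm f].
Proof.
have [kappa [r [D [D0 r0 kle kr rD]]]] := hilbert_schmidt_kernel G10 G20 gG1 gG2 S0 FS.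
exists r, D; split=> // sigma b Lam M sF lin bnd w.
apply: (ell2_functional_le lin bnd (r0 b) _ (kr b)) => a.
have [i ->] := w (ell2_delta a); apply: kle; first exact: normc_ge0.
exact: (weak_form_delta_le sF i).
Qed.

(** The majorant r is common to all operators given by the symbol: it depends only
on the coefficients of the symbol and on the windows. *)
Lemma localization_operator_pointwise : exists (r : Z -> R) (D : R),
  [/\ 0 <= D, forall b, 0 <= r b, (\int[cnt]_b (r b ^+ 2)%:E <= (D ^+ 2)%:E)%E &
  forall L : {linear ell2 R n -> ell2 R n}, localization_operator F g1 g2 L ->
    forall f b, normc (L f b) <= r b * ell2_norm f].
Proof.
have [r [D [D0 r0 rD h]]] := weak_form_pointwise.
exists r, D; split=> // L [Lc [sigma [sF w]]] f b.
have [M [M0 hM]] := continuous_bounded Lc.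
apply: (h sigma b (fun f => L f b) M sF) => [a u v|u|u].
- by rewrite linearP.
- by apply: le_trans (normc_ell2_le _ _) (hM u).
- by have [i e] := w u (ell2_delta b); split=> //; rewrite -ell2_inner_delta e.
Qed.

Section form.
Variables (sigma : Z * T -> C) (A : R).
Hypotheses (A0 : 0 <= A) (ms : Cmeasurable sigma)
  (sA : forall m, (\int[mu]_w (normc (sigma (m, w)))%:E <= A%:E)%E).

Local Notation B := (weak_form g1 g2 sigma).

Lemma weak_form_bounded (f h : ell2 R n) :
  Cintegrable muZT (weak_integrand g1 g2 sigma f h) /\
  normc (B f h) <= A * G1 * G2 * ell2_norm f * ell2_norm h.
Proof.
have mI : Cmeasurable (weak_integrand g1 g2 sigma f h).
  apply: CmeasurableM; last by apply: Cmeasurable_conj; exact: Cmeasurable_stft.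
  by apply: CmeasurableM => //; exact: Cmeasurable_stft.
have [v1 [v10 vf v1G]] := stft_majorant G10 gG1 f.
have [v2 [v20 vh v2G]] := stft_majorant G20 gG2 h.
have le : (\int[muZT]_x (normc (weak_integrand g1 g2 sigma f h x))%:E <=
    (A * (G1 * ell2_norm f * (G2 * ell2_norm h)))%:E)%E.
  rewrite integral_muZT; last first.
  - by move=> x; rewrite lee_fin normc_ge0.
  - exact: emeasurable_normc.
  apply: (@le_trans _ _ (\int[cnt]_m (A%:E * `|v1 m * v2 m|%:E))%E).
    apply: le_integral_Z => m; first by apply: integral_ge0 => w _; rewrite lee_fin normc_ge0.
    have vv : 0 <= v1 m * v2 m by exact: mulr_ge0.
    apply: (@le_trans _ _ (\int[mu]_w ((normc (sigma (m, w)))%:E * (v1 m * v2 m)%:E))%E).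
      apply: ge0_le_integral => //.
      + by move=> w _; rewrite lee_fin normc_ge0.
      + exact/emeasurable_normc/Cmeasurable_slice.
      + by apply: emeasurable_funM => //; exact/emeasurable_normc/Cmeasurable_slice.
      + move=> w _; rewrite -EFinM lee_fin !normcM normc_conj -mulrA.
        by apply: ler_wpM2l; [exact: normc_ge0|apply: ler_pM => //; exact: normc_ge0].
    rewrite ge0_integralZr//; last 2 first.
    - exact/emeasurable_normc/Cmeasurable_slice.
    - by move=> w _; rewrite lee_fin normc_ge0.
    by rewrite (ger0_norm vv); apply: lee_wpmul2r; rewrite ?lee_fin.
  rewrite ge0_integralZl//; last by exact: measurable_Z.
  rewrite [leRHS]EFinM; apply: lee_wpmul2l => //.
  apply: cauchy_schwarz_integral => //; try exact: measurable_Z.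
  - by rewrite mulr_ge0 ?ell2_norm_ge0// ltW.
  - by rewrite mulr_ge0 ?ell2_norm_ge0// ltW.
have i : Cintegrable muZT (weak_integrand g1 g2 sigma f h).
  by apply/CintegrableP; split => //; apply: le_lt_trans le _; rewrite ltry.
split=> //; rewrite -lee_fin; apply: le_trans (normc_Cintegral i) _.
apply: le_trans le _; rewrite le_eqVlt; apply/orP; left; apply/eqP.
by congr (_%:E); ring.
Qed.

Lemma weak_form_linear a (f f' h : ell2 R n) :
  B (a *: f + f') h = a * B f h + B f' h.
Proof.
have [i _] := weak_form_bounded f h; have [i' _] := weak_form_bounded f' h.
rewrite /weak_form -(CintegralZ a i) -(CintegralD (CintegrableZ a i) i').
apply: eq_Cintegral => x; rewrite /weak_integrand (stft_linear gG1); ring.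
Qed.

Lemma weak_form_conj_linear a (f h h' : ell2 R n) :
  B f (a *: h + h') = (a^*)%C * B f h + B f h'.
Proof.
have [i _] := weak_form_bounded f h; have [i' _] := weak_form_bounded f h'.
rewrite /weak_form -(CintegralZ _ i) -(CintegralD (CintegrableZ _ i) i').
apply: eq_Cintegral => x; rewrite /weak_integrand (stft_linear gG2).
by rewrite rmorphD rmorphM/=; ring.
Qed.

(** The operator is read off the weak formula on the canonical basis; the weak
formula then extends to all of l^2 because both sides are continuous. *)
Lemma localization_operator_of_function : represents sigma F ->
  exists L : {linear ell2 R n -> ell2 R n}, localization_operator F g1 g2 L.
Proof.
move=> sF; have [r [D [D0 r0 rD h]]] := weak_form_pointwise.
have Bn (u v : ell2 R n) : normc (B u v) <= A * G1 * G2 * ell2_norm u * ell2_norm v.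
  by have [] := weak_form_bounded u v.
have Br f b : normc (B f (ell2_delta b)) <= r b * ell2_norm f.
  apply: (h sigma b (fun f => B f (ell2_delta b))
    (A * G1 * G2 * ell2_norm (ell2_delta b : ell2 R n)) sF) => [a u v|u|u].
  - exact: weak_form_linear.
  - by rewrite mulrAC; exact: Bn.
  - by split=> //; have [] := weak_form_bounded u (ell2_delta b).
have BD f : (\int[cnt]_b (normc (B f (ell2_delta b)) ^+ 2)%:E <=
    ((D * ell2_norm f) ^+ 2)%:E)%E.
  rewrite exprMn EFinM; apply: (@le_trans _ _
      (\int[cnt]_b ((r b ^+ 2)%:E * (ell2_norm f ^+ 2)%:E))%E).
    apply: le_integral_Z => b; first by rewrite lee_fin sqr_ge0.
    rewrite -EFinM lee_fin -exprMn ler_sqr ?nnegrE ?normc_ge0 ?mulr_ge0 ?ell2_norm_ge0//.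
  rewrite ge0_integralZr//; last 3 first.
  - exact: measurable_Z.
  - by move=> b _; rewrite lee_fin sqr_ge0.
  - by rewrite lee_fin sqr_ge0.
  by apply: lee_wpmul2r; rewrite ?lee_fin ?sqr_ge0.
have sq f : square_summable (fun b : Z => B f (ell2_delta b)).
  by apply: square_summableP; apply: le_lt_trans (BD f) _; rewrite ltry.
pose L0 (f : ell2 R n) : ell2 R n := Ell2 (sq f).
have L0lin : linear L0.
  by move=> a u v; apply: val_inj; apply/funext => b; exact: weak_form_linear.
pose L : {linear ell2 R n -> ell2 R n} :=
  HB.pack L0 (GRing.isLinear.Build C (ell2 R n) (ell2 R n) _ L0 L0lin).
have LD f : ell2_norm (L f) <= D * ell2_norm f.
  apply: ell2_norm_le; first by rewrite mulr_ge0// ell2_norm_ge0.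
  exact: BD.
exists L; split; first exact: bounded_continuous D0 LD.
exists sigma; split=> // f k; have [i _] := weak_form_bounded f k; split=> //.
(* Conjugation makes the defect linear in k; it vanishes on the basis. *)
pose Lam (k : ell2 R n) := ((ell2_inner (L f) k - B f k)^*)%C.
suff : normc (Lam k) <= 0 * ell2_norm k.
  rewrite mul0r normc_conj => Lk; apply/eqP; rewrite -subr_eq0 -normc_eq0.
  by rewrite eq_le Lk normc_ge0.
have Llin a u v : Lam (a *: u + v) = a * Lam u + Lam v.
  rewrite /Lam ell2_inner_conj_linear weak_form_conj_linear.
  by rewrite opprD addrACA -mulrBr rmorphD rmorphM/= conjcK.
have LamM u : normc (Lam u) <=
    (ell2_norm (L f) + A * G1 * G2 * ell2_norm f) * ell2_norm u.
  rewrite /Lam normc_conj mulrDl; apply: le_trans (normcD _ _) _; rewrite normcN.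
  by apply: lerD; [have [_] := Cintegrable_inner (L f) u|exact: Bn].
apply: (ell2_functional_le Llin LamM (lexx 0) (kappa := fun _ => 0)).
  by move=> b; rewrite /Lam ell2_inner_delta subrr conjc0 normc0.
by rewrite integral0_eq// => b _; rewrite expr0n.
Qed.

End form.

Hypothesis Ft : tempered schwartzZT seminormZT F.

Lemma localization_operator_exists :
  exists L : {linear ell2 R n -> ell2 R n}, localization_operator F g1 g2 L.
Proof.
have row m : (\int[cnt]_k (normc (F (level m (chi k))) ^+ 2)%:E <= (Num.sqrt S ^+ 2)%:E)%E.
  rewrite sqr_sqrtr//; apply: le_trans FS.
  apply: (@le_integral_counting _ _ m
    (fun m => \int[cnt]_k (normc (F (level m (chi k))) ^+ 2)%:E))%E => j.
  by apply: integral_ge0 => k _; rewrite lee_fin sqr_ge0.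
have [sigma [sF ms sA]] := symbol_representation Ft (sqrtr_ge0 S) row.
exact: (localization_operator_of_function (sqrtr_ge0 S) ms sA sF).
Qed.

End localization.

(** * Compactness of Hilbert cubes *)

Section hilbert_cube.
Context {R : realType} {n : nat}.
Local Notation Z := 'rV[int]_n.
Local Notation C := R[i].
Local Notation cnt := (@counting Z R).

(** Truncating the coordinates extends the parametrization of the cube to the whole
product space, where it is continuous. *)
Definition clamp (r t : R) : R := Num.max (- r) (Num.min t r).

Lemma clamp_bound r t : 0 <= r -> `|clamp r t| <= r.
Proof.
move=> r0; rewrite ler_norml /clamp le_max lexx/= ge_max ge_min lexx orbT andbT.
by rewrite (le_trans _ r0)// oppr_le0.
Qed.

Lemma clamp_id r t : `|t| <= r -> clamp r t = t.
Proof. by rewrite ler_norml => /andP[h1 h2]; rewrite /clamp min_l// max_r. Qed.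

Lemma clamp_lipschitz r s t : `|clamp r s - clamp r t| <= `|s - t|.
Proof.
have mono x y : x <= y -> clamp r x <= clamp r y.
  move=> xy; rewrite /clamp ge_max le_max lexx /= le_max; apply/orP; right.
  by rewrite le_min !ge_min xy lexx orbT.
have step x y : x <= y -> clamp r y <= clamp r x + (y - x).
  move=> xy; rewrite /clamp ge_max; apply/andP; split.
    by rewrite ler_wpDr ?subr_ge0// le_max lexx.
  rewrite -lerBlDr le_max; apply/orP; right; rewrite le_min.
  rewrite lerBlDr [x + _]addrC subrK ge_min lexx /=.
  by rewrite lerBlDr ge_min; apply/orP; right; rewrite lerDl subr_ge0.
have [st|/ltW ts] := leP s t.
  by rewrite distrC (distrC s) !ger0_norm ?subr_ge0 ?mono// lerBlDl step.
by rewrite !ger0_norm ?subr_ge0 ?mono// lerBlDl step.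
Qed.

Variables (r : Z -> R) (D : R).
Hypotheses (r0 : forall b, 0 <= r b)
  (rD : (\int[cnt]_b (r b ^+ 2)%:E <= (D ^+ 2)%:E)%E).

Local Notation Y := (prod_topology (fun _ : Z * bool => R)).

Let cube_fun (y : Y) (b : Z) : C :=
  (clamp (r b) (y (b, false)) +i* clamp (r b) (y (b, true)))%C.

Let normc_cube_fun y b : normc (cube_fun y b) <= 2 * r b.
Proof.
apply: le_trans (normc_le_ReIm _) _ => /=.
by rewrite mulr_natl mulr2n lerD// clamp_bound.
Qed.

Let square_summable_le (h : Z -> C) (c : R) : 0 <= c ->
  (forall b, normc (h b) <= c * r b) -> square_summable h.
Proof.
move=> c0 hr; apply: square_summableP.
apply: (@le_lt_trans _ _ (\int[cnt]_b ((c ^+ 2)%:E * (r b ^+ 2)%:E))%E).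
  apply: le_integral_Z => b; first by rewrite lee_fin sqr_ge0.
  by rewrite -EFinM lee_fin -exprMn ler_sqr ?nnegrE ?normc_ge0 ?mulr_ge0.
rewrite ge0_integralZl//; last 3 first.
- exact: measurable_Z.
- by move=> b _; rewrite lee_fin sqr_ge0.
- by rewrite lee_fin sqr_ge0.
rewrite lte_mul_pinfty ?lee_fin ?sqr_ge0//.
by apply: le_lt_trans rD _; rewrite ltry.
Qed.

Definition cube_map (y : Y) : ell2 R n :=
  Ell2 (square_summable_le (ler0n _ 2) (normc_cube_fun y)).

Let radius : ell2 R n.
Proof.
refine (Ell2 (@square_summable_le (fun b => (r b)%:C%C) 1 ler01 _)).
by move=> b; rewrite normc_real mul1r ger0_norm.
Defined.

Let near_coordinates (y : Y) (s : seq Z) (eta : R) : 0 < eta ->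
  nbhs y [set y' : Y | forall b i, b \in s -> `|y (b, i) - y' (b, i)| < eta].
Proof.
move=> eta0.
have h1 j : nbhs y [set y' : Y | `|y j - y' j| < eta].
  have hn : nbhs (y j : R) [set t : R | `|y j - t| < eta].
    by apply/nbhs_ballP; exists eta.
  exact: (@proj_continuous _ (fun _ : Z * bool => R) j y _ hn).
elim: s => [|a s IH]; first by apply: filterS filterT.
apply: filterS (filterI IH (filterI (h1 (a, false)) (h1 (a, true)))).
move=> y' [hs [hf ht]] b i; rewrite inE => /orP[/eqP ->|]; last exact: hs.
by case: i.
Qed.

(** The coordinates outside a finite set contribute little, uniformly over the
cube, and the finitely many others are controlled by the product topology. *)
Lemma cube_map_continuous : continuous cube_map.
Proof.
move=> y U /nbhs_ballP[e /= e0 eU].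
have e1 : 0 < e / 16 by rewrite divr_gt0.
have [s [us hs]] := ell2_truncation radius e1.
pose N := \sum_(a <- s) ell2_norm (ell2_delta a : ell2 R n).
have N0 : 0 <= N by apply: sumr_ge0 => a _; exact: ell2_norm_ge0.
have eta0 : 0 < e / (8 * (N + 1)) by rewrite divr_gt0// mulr_gt0// ltr_wpDl.
apply: filterS (near_coordinates y s eta0) => y' hy'; apply: eU.
(* The difference d splits into its part u on s and a tail dominated by 4 r. *)
rewrite ell2_ballE /=; set d := cube_map y - cube_map y'.
pose u := \sum_(a <- s) d a *: (ell2_delta a : ell2 R n).
have dE b : d b = cube_fun y b - cube_fun y' b by [].
have -> : d = u + (d - u) by rewrite addrC subrK.
apply: (le_lt_trans (ell2_normD _ _)).
have hu : ell2_norm u <= e / 4.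
  apply: (@le_trans _ _ (\sum_(a <- s) e / (4 * (N + 1)) *
      ell2_norm (ell2_delta a : ell2 R n))).
    rewrite /u; have : {in s, forall a, normc (d a) <= e / (4 * (N + 1))}.
      move=> a sa; rewrite dE; apply: le_trans (normc_le_ReIm _) _ => /=.
      have -> : e / (4 * (N + 1)) = e / (8 * (N + 1)) + e / (8 * (N + 1)).
        by field; rewrite gt_eqF// ltr_wpDl.
      by apply: lerD; apply: le_trans (clamp_lipschitz _ _ _) (ltW _); exact: hy'.
    elim: (s) => [|a t IH] ht.
      by rewrite !big_nil -(scale0r (0 : ell2 R n)) ell2_normZ normc0 mul0r.
    rewrite !big_cons; apply: le_trans (ell2_normD _ _) (lerD _ _).
      by rewrite ell2_normZ; apply: ler_wpM2r; [exact: ell2_norm_ge0|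
        apply: ht; rewrite mem_head].
    by apply: IH => b tb; apply: ht; rewrite inE tb orbT.
  rewrite -mulr_sumr -/N (_ : e / (4 * (N + 1)) * N = e / 4 * (N / (N + 1))); last first.
    by field; rewrite gt_eqF// ltr_wpDl.
  rewrite ger_pMr ?divr_gt0// ler_pdivrMr ?ltr_wpDl// mul1r lerDl//.
have hv : ell2_norm (d - u) <= e / 4.
  apply: ell2_norm_le; first by rewrite divr_ge0// ltW.
  set tail := radius - _ in hs.
  apply: (@le_trans _ _ (\int[cnt]_b ((4 ^+ 2)%:E * (normc (tail b) ^+ 2)%:E))%E).
    apply: le_integral_Z => b; first by rewrite lee_fin sqr_ge0.
    rewrite -EFinM lee_fin -exprMn ler_sqr ?nnegrE ?normc_ge0 ?mulr_ge0 ?normc_ge0//.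
    have -> : (d - u) b = if b \in s then 0 else d b.
      rewrite -[LHS]/(d b - u b) /u ell2_combE//.
      by case: ifP => _; rewrite ?subrr ?subr0.
    have -> : tail b = if b \in s then 0 else (r b)%:C%C.
      rewrite -[LHS]/(radius b - (\sum_(a <- s) radius a *: ell2_delta a) b) ell2_combE//.
      by case: ifP => _; rewrite ?subrr ?subr0.
    case: ifP => _; first by rewrite !normc0 mulr0.
    rewrite normc_real ger0_norm// dE; apply: le_trans (normcD _ _) _; rewrite normcN.
    rewrite (_ : 4 * r b = 2 * r b + 2 * r b); last by ring.
    by apply: lerD; exact: normc_cube_fun.
  rewrite ge0_integralZl//; last 2 first.
  - exact: measurable_Z.
  - by move=> b _; rewrite lee_fin sqr_ge0.
  rewrite -sqr_ell2_norm -EFinM lee_fin -exprMn.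
  rewrite ler_sqr ?nnegrE ?mulr_ge0 ?ell2_norm_ge0//; last exact: ltW.
  apply: (@le_trans _ _ (4 * (e / 16))); first by rewrite ler_wpM2l.
  by rewrite le_eqVlt; apply/orP; left; apply/eqP; field.
apply: le_lt_trans (lerD hu hv) _.
rewrite (_ : e / 4 + e / 4 = e / 2); last by field.
by rewrite ltr_pdivrMr// ltr_pMr// ltr1n.
Qed.

Lemma precompact_hilbert_cube :
  precompact [set f : ell2 R n | forall b, normc (f b) <= r b].
Proof.
pose K := [set y : Y | forall j : Z * bool, [set` `[- r j.1, r j.1]] (y j)].
have Kc : compact K.
  apply: (@tychonoff (Z * bool)%type (fun _ => R)
    (fun j => [set` `[- r j.1, r j.1]])) => j.
  exact: segment_compact.
have KcI : compact (cube_map @` K).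
  by apply: continuous_compact Kc; apply: continuous_subspaceT; exact: cube_map_continuous.
apply: precompact_subset (compact_precompact (@metric_hausdorff _ _) KcI).
move=> f /= fr.
pose y : Y := fun j => if j.2 then complex.Im (f j.1) else complex.Re (f j.1).
have yr j : `|y j| <= r j.1.
  rewrite /y; case: ifP => _; apply: le_trans (fr j.1); [exact: normr_Im|exact: normr_Re].
exists y; first by move=> j /=; rewrite in_itv/= -ler_norml.
apply: val_inj; apply/funext => b; rewrite /= /cube_fun.
rewrite (clamp_id (yr (b, false))) (clamp_id (yr (b, true))) /y /=.
by case: (f b).
Qed.

End hilbert_cube.

(** * Compactness of localization operators *)

Theorem theorem4p6 (R : realType) (n : nat) (p : R)
    (gamma : 'rV[int]_n -> R[i]) (Gamma : 'rV[int]_n * 'rV[R]_n -> R[i])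
    (symbol : ('rV[int]_n * 'rV[R]_n -> R[i]) -> R[i])
    (u1 u2 : ('rV[int]_n -> R[i]) -> R[i])
    (p_itv : 1 <= p <= 2)
    (gammaS : schwartzZ gamma) (gamma_neq0 : exists k, gamma k != 0)
    (GammaS : schwartzZT Gamma) (Gamma_neq0 : exists x, Gamma x != 0)
    (symbolM : modulation_spaceZT Gamma p symbol)
    (u1M : modulation_spaceZ gamma 1 u1) (u2M : modulation_spaceZ gamma 1 u2) :
  (exists L : {linear ell2 R n -> ell2 R n},
     localization_operator symbol (seq_of_dist u1) (seq_of_dist u2) L) /\
  (forall L : {linear ell2 R n -> ell2 R n},
     localization_operator symbol (seq_of_dist u1) (seq_of_dist u2) L ->
     compact_operator L).
Proof.
have [k0 hk0] := gamma_neq0; have [x0 hx0] := Gamma_neq0.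
have g1l1 := modulation_space_l1 gammaS hk0 u1M.
have g2l1 := modulation_space_l1 gammaS hk0 u2M.
have l1_bound (g : 'rV[int]_n -> R[i]) :
    (\int[@counting 'rV[int]_n R]_k (normc (g k))%:E < +oo)%E ->
    exists2 G : R, 0 < G & (\int[@counting 'rV[int]_n R]_k (normc (g k))%:E <= G%:E)%E.
  set I := (\int[_]_k _)%E => Ioo.
  have I0 : (0 <= I)%E by apply: integral_ge0 => k _; rewrite lee_fin normc_ge0.
  exists (fine I + 1); first by rewrite ltr_wpDl// fine_ge0.
  by rewrite EFinD fineK ?ge0_fin_numE// leeDl.
have [G1 G10 gG1] := l1_bound _ g1l1; have [G2 G20 gG2] := l1_bound _ g2l1.
have := modulation_space_l2 p_itv GammaS hx0 symbolM.
set E := (\int[_]_j _)%E => Eoo.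
have E0 : (0 <= E)%E.
  by apply: integral_ge0 => j _; apply: integral_ge0 => k _; rewrite lee_fin sqr_ge0.
have ES : (E <= (fine E)%:E)%E by rewrite fineK// ge0_fin_numE.
have S0 : 0 <= fine E by exact: fine_ge0.
split; first exact: (localization_operator_exists G10 G20 gG1 gG2 S0 ES symbolM.1).
have [r [D [D0 r0 rD hr]]] := localization_operator_pointwise G10 G20 gG1 gG2 S0 ES.
move=> L Lop; rewrite /compact_operator.
apply: precompact_subset (precompact_hilbert_cube r0 rD).
move=> _ [f f1 <-] b; apply: le_trans (hr L Lop f b) _.
by rewrite ler_piMr.
Qed.
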